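(* Let $N\ge 1$ be an integer, $0<\beta<2$, $p>0$, $q>1$ and $0<\gamma<N$. Let $u_0\in L^1_{loc}(\mathbb{R}^N)$ and assume that there exists a constant $\varepsilon>0$ such that $$u_0(x)\ge \varepsilon(1+|x|^2)^{-\gamma/2}\quad\text{for (almost every) } x\in\mathbb{R}^N.$$ If $$p<q<p+\frac{\beta}{\gamma},$$ then the Cauchy problem $$u_t+(-\Delta)^{\beta/2}(|u|^p)=|u|^q\quad (x\in\mathbb{R}^N,\ t>0),\qquad u(x,0)=u_0(x)\quad (x\in\mathbb{R}^N)$$ has no global weak solutions.
   Context: Fractional Laplacian: for $v$ in $H^\beta(\mathbb{R}^N)=\{v\in L^2(\mathbb{R}^N):\ (-\Delta)^{\beta/2}v\in L^2(\mathbb{R}^N)\}$, $(-\Delta)^{\beta/2}v:=\mathcal{F}^{-1}\left(|\xi|^\beta\mathcal{F}(v)(\xi)\right)$, where $\mathcal{F}$ is the Fourier transform and $\mathcal{F}^{-1}$ its inverse. Weak solution: let $u_0\in L^1_{loc}(\mathbb{R}^N)$, $0<\beta<2$, $p>0$, $q>1$ and $T>0$. A (real-valued, measurable) function $u$ is a weak solution of the Cauchy problem on $(0,T)$ if $u\in L^p((0,T),L^{2p}(\mathbb{R}^N))\cap L^q((0,T),L^q_{loc}(\mathbb{R}^N))$ and $$\int_{\mathbb{R}^N}u_0(x)\varphi(x,0)\,dx+\int_0^T\int_{\mathbb{R}^N}|u|^q\varphi(x,t)\,dx\,dt=\int_0^T\int_{\mathbb{R}^N}|u|^p(-\Delta)^{\beta/2}\varphi\,dx\,dt-\int_0^T\int_{\mathbb{R}^N}u\,\varphi_t(x,t)\,dx\,dt$$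 for all compactly supported $\varphi\in C([0,T],H^\beta(\mathbb{R}^N))\cap C^1([0,T],L^\infty(\mathbb{R}^N))$ such that $\varphi(\cdot,T)=0$. Here $(-\Delta)^{\beta/2}$ acts in the space variable $x$. Global weak solution: a function $u$ on $\mathbb{R}^N\times(0,\infty)$ whose restriction to $\mathbb{R}^N\times(0,T)$ is a weak solution on $(0,T)$ for every $T>0$. *)

(* Defs.v *)
From HB Require Import structures.
From mathcomp Require Import all_boot all_order all_algebra.
From mathcomp Require Import all_classical all_reals all_analysis.
From mathcomp Require Import complex.

Set Implicit Arguments.
Unset Strict Implicit.
Unset Printing Implicit Defensive.

Import Order.TTheory GRing.Theory Num.Theory.
Import numFieldNormedType.Exports.

Local Open Scope classical_set_scope.
Local Open Scope ring_scope.

(* R^N, with the product (= Borel) sigma-algebra.  Every Lebesgue measurable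
   function agrees a.e. with a Borel one, and all notions below are invariant
   under a.e. modification, so Borel measurability loses nothing. *)
Definition Rn (R : realType) (N : nat) := N.-tuple (measurableTypeR R).
HB.instance Definition _ (R : realType) (N : nat) := Measurable.on (Rn R N).

Section lebesgue_succ.
Context (R : realType) (n : nat).
Variable mu : {sigma_finite_measure set (Rn R n) -> \bar R}.

Definition Rn_cons (z : measurableTypeR R * Rn R n) : Rn R n.+1 :=
  [tuple of z.1 :: z.2].

Lemma measurable_Rn_cons : measurable_fun [set: _] Rn_cons.
Proof. exact: measurable_cons. Qed.

Definition lebesgue_succ : set (Rn R n.+1) -> \bar R :=
  pushforward (@lebesgue_measure R \x mu)%E Rn_cons.

Let lebesgue_succ0 : (lebesgue_succ set0 = 0)%E.
Proof. by rewrite /lebesgue_succ /pushforward preimage_set0 measure0. Qed.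

Let lebesgue_succ_ge0 A : (0 <= lebesgue_succ A)%E.
Proof. by rewrite /lebesgue_succ /pushforward; exact: measure_ge0. Qed.

Let lebesgue_succ_sigma_additive : semi_sigma_additive lebesgue_succ.
Proof.
move=> F mF tF mUF; rewrite /lebesgue_succ /pushforward preimage_bigcup.
have mpre A : measurable A -> measurable (Rn_cons @^-1` A).
  by move=> mA; rewrite -[X in measurable X]setTI; exact: measurable_Rn_cons.
apply: measure_semi_sigma_additive.
- by move=> k; exact: mpre.
- apply/trivIsetP => /= i j _ _ ij; rewrite -preimage_setI.
  by move/trivIsetP : tF => /(_ _ _ _ _ ij) ->//; rewrite preimage_set0.
- by rewrite -preimage_bigcup; exact: mpre.
Qed.

HB.instance Definition _ := isMeasure.Build _ _ _ lebesgue_succ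
  lebesgue_succ0 lebesgue_succ_ge0 lebesgue_succ_sigma_additive.

Let lebesgue_succ_sigma_finite : sigma_finite setT lebesgue_succ.
Proof.
have /sigma_finiteP[F [TF ndF Foo]] := sigma_finiteT (@lebesgue_measure R).
have /sigma_finiteP[G [TG ndG Goo]] := sigma_finiteT mu.
pose uncons (x : Rn R n.+1) : measurableTypeR R * Rn R n :=
  (thead x, [tuple of behead x]).
have consK : cancel Rn_cons uncons.
  by case=> a t; rewrite /uncons /Rn_cons theadE; congr pair; exact: val_inj.
have mFG i : measurable (F i `*` G i).
  by have [? _] := Foo i; have [? _] := Goo i; exact: measurableX.
exists (fun i => uncons @^-1` (F i `*` G i)).
  rewrite -preimage_bigcup (_ : \bigcup_i _ = setT) ?preimage_setT//.
  apply/seteqP; split => // -[x y] _.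
  have [i _ Fix] : (\bigcup_i F i) x by rewrite -TF.
  have [j _ Gjy] : (\bigcup_i G i) y by rewrite -TG.
  exists (maxn i j) => //; split => /=.
    by move: x Fix; exact/subsetPset/ndF/leq_maxl.
  by move: y Gjy; exact/subsetPset/ndG/leq_maxr.
move=> i; split.
  rewrite -[X in measurable X]setTI.
  suff : measurable_fun setT uncons by exact.
  apply/measurable_fun_pairP; split; first exact: measurable_tnth.
  exact: measurable_behead.
rewrite /lebesgue_succ /pushforward -comp_preimage.
rewrite (_ : uncons \o Rn_cons = id); last exact/funext.
rewrite preimage_id; have [mF Fi] := Foo i; have [mG Gi] := Goo i.
by rewrite product_measure1E// lte_mul_pinfty// ge0_fin_numE.
Qed.

HB.instance Definition _ := Measure_isSigmaFinite.Build _ _ _ lebesgue_succ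
  lebesgue_succ_sigma_finite.

End lebesgue_succ.

(* N-dimensional Lebesgue measure: the N-fold product of the Lebesgue measure
   of R (the unit mass at the empty tuple when N = 0). *)
Fixpoint lebesgueRn (R : realType) (N : nat) :
    {sigma_finite_measure set (Rn R N) -> \bar R} :=
  match N with
  | 0 => [the {sigma_finite_measure set _ -> \bar R} of
           @dirac _ (Rn R 0) [tuple] R]
  | n.+1 => [the {sigma_finite_measure set _ -> \bar R} of
           lebesgue_succ (lebesgueRn R n)]
  end.

Section fractional_laplacian.
Context (R : realType) (N : nat).
Local Notation mu := (lebesgueRn R N).

Definition dot (x y : Rn R N) : R := \sum_(i < N) tnth x i * tnth y i.

Definition enorm (x : Rn R N) : R := Num.sqrt (dot x x).

(* Convergence to 0 of the L^2 distance between complex-valued functions. *)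
Definition cvg_L2C (f_ : (Rn R N -> R[i])^nat) (f : Rn R N -> R[i]) : Prop :=
  ('N[mu]_2%:E[EFin \o (fun x => ComplexField.Normc.normc (f_ n x - f x)%R)])%E
    @[n --> \oo] --> 0%E.

Definition LfunC (p : \bar R) (f : Rn R N -> R[i]) : Prop :=
  (fun x => complex.Re (f x)) \in Lfun mu p /\
  (fun x => complex.Im (f x)) \in Lfun mu p.

Definition integralC (f : Rn R N -> R[i]) : R[i] :=
  Complex (\int[mu]_x complex.Re (f x)) (\int[mu]_x complex.Im (f x)).

Definition expi (t : R) : R[i] := Complex (cos t) (sin t).

(* The Fourier integral, meaningful for f in L^1; the convention exp(-i x.xi)
   is the one for which |xi|^2 is the symbol of -Delta.  Multiplicative
   normalization constants are immaterial to (-Delta)^(beta/2). *)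
Definition fourier_integral (f : Rn R N -> R[i]) (xi : Rn R N) : R[i] :=
  integralC (fun x => f x * expi (- dot x xi)).

(* [fourier f g]: g represents F(f), for f in L^2, F being the continuous
   extension to L^2 of the Fourier integral on L^1 `&` L^2. *)
Definition fourier (f g : Rn R N -> R[i]) : Prop :=
  [/\ LfunC 2%:E f, LfunC 2%:E g &
    exists f_ : (Rn R N -> R[i])^nat,
      [/\ forall n, LfunC 1%:E (f_ n) /\ LfunC 2%:E (f_ n),
          cvg_L2C f_ f &
          cvg_L2C (fun n => fourier_integral (f_ n)) g]].

(* [fracLap beta v w]: v is in H^beta(R^N) and w in L^2(R^N) represents
   (-Delta)^(beta/2) v, i.e., w = F^-1(|xi|^beta F(v)). *)
Definition fracLap (beta : R) (v w : Rn R N -> R) : Prop :=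
  exists vhat : Rn R N -> R[i],
    fourier (fun x => (v x)%:C%C) vhat /\
    fourier (fun x => (w x)%:C%C) (fun xi => (enorm xi `^ beta)%:C%C * vhat xi).

End fractional_laplacian.

Section weak_solutions.
Context (R : realType) (N : nat).
Local Notation mu := (lebesgueRn R N).
Local Notation leb1 := (@lebesgue_measure R).

Definition eball (r : R) : set (Rn R N) := [set x | enorm x <= r].

Definition L1_loc (f : Rn R N -> R) : Prop :=
  measurable_fun setT f /\
  forall r : R, (\int[mu]_(x in eball r) `|(f x)%:E| < +oo)%E.

(* f is in C([0,T], L^p(R^N)) *)
Definition continuous_Lp (p : \bar R) (T : R) (f : R -> Rn R N -> R) : Prop :=
  forall t : R, t \in `[0, T] ->
    f t \in Lfun mu p /\
    ('N[mu]_p[EFin \o (f s \- f t)%R])%E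
      @[s --> within `[0, T] (nbhs t)] --> 0%E.

(* f is in C([0,T], H^beta(R^N)), for the norm
   ||v||_2 + ||(-Delta)^(beta/2) v||_2, with (-Delta)^(beta/2) f(t) = g(t). *)
Definition continuous_Hbeta (beta T : R) (f g : R -> Rn R N -> R) : Prop :=
  [/\ forall t : R, t \in `[0, T] -> fracLap beta (f t) (g t),
      continuous_Lp 2%:E T f & continuous_Lp 2%:E T g].

(* f is in C^1([0,T], L^p(R^N)), with derivative f'. *)
Definition C1_Lp (p : \bar R) (T : R) (f f' : R -> Rn R N -> R) : Prop :=
  [/\ continuous_Lp p T f, continuous_Lp p T f' &
      forall t : R, t \in `[0, T] ->
        ('N[mu]_p[EFin \o (fun x => (f s x - f t x) / (s - t) - f' t x)%R])%E
          @[s --> within `[0, T] t^'] --> 0%E].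

(* f vanishes outside a compact subset of R^N x [0,T]. *)
Definition compactly_supported (T : R) (f : R -> Rn R N -> R) : Prop :=
  exists r : R, forall t : R, t \in `[0, T] ->
    {ae mu, forall x, r < enorm x -> f t x = 0}.

(* The admissible test functions phi, given along with representatives
   Lphi of (-Delta)^(beta/2) phi and dphi of phi_t. *)
Definition test_function (beta T : R) (phi Lphi dphi : R -> Rn R N -> R)
    : Prop :=
  [/\ continuous_Hbeta beta T phi Lphi,
      C1_Lp +oo%E T phi dphi,
      compactly_supported T phi &
      {ae mu, forall x, phi T x = 0}].

Definition weak_solution (beta p q : R) (u0 : Rn R N -> R) (T : R)
    (u : R -> Rn R N -> R) : Prop :=
  [/\ measurable_fun (`]0, T[ `*` [set: Rn R N])
        (fun z : measurableTypeR R * Rn R N => u z.1 z.2),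
      (\int[leb1]_(t in `]0%R, T[)
          ('N[mu]_(2 * p)%:E[EFin \o u t] `^ p) < +oo)%E,
      forall r : R,
        (\int[leb1]_(t in `]0%R, T[)
          \int[mu]_(x in eball r) (`|u t x| `^ q)%R%:E < +oo)%E &
      forall phi Lphi dphi, test_function beta T phi Lphi dphi ->
        \int[mu]_x (u0 x * phi 0 x) +
        \int[leb1]_(t in `]0, T[) \int[mu]_x (`|u t x| `^ q * phi t x) =
        \int[leb1]_(t in `]0, T[) \int[mu]_x (`|u t x| `^ p * Lphi t x) -
        \int[leb1]_(t in `]0, T[) \int[mu]_x (u t x * dphi t x)].

Definition global_weak_solution (beta p q : R) (u0 : Rn R N -> R)
    (u : R -> Rn R N -> R) : Prop :=
  forall T : R, 0 < T -> weak_solution beta p q u0 T u.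

End weak_solutions.

(* Main.v *)
(* The test functions are phi (t, x) = (1 - t / T) ^ (k + 1) psi (x), where
   psi (x) = prod_i f (a x_i) and f (z) = max (0, 1 - z ^ 2) ^ 2.  The second
   differences of f satisfy f (x + y) + f (x - y) >= f (x) (2 - C y ^ 2), hence
   exp (s Delta) psi >= (1 - C' a ^ 2 s) psi, and the subordination formula
     (-Delta) ^ (beta / 2) psi
       = c * int_0^oo (psi - exp (s Delta) psi) s ^ (-1 - beta / 2) ds
   gives (-Delta) ^ (beta / 2) psi <= C a ^ beta psi pointwise.  This formula is
   taken as a definition, with s = exp r so that scaling in s is a translation
   in r, and identified with the Fourier multiplier by Fubini's theorem: the
   Gaussian and psi are tensor products, so everything reduces to dimension 1.

   In the weak formulation the terms in |u| ^ p and |u| are then absorbed by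
   |u| ^ q, and the masses of psi on both sides cancel:
     eps (1 + N / a ^ 2) ^ (- gamma / 2)
       <= C T (a ^ (beta q / (q - p)) + T ^ (- q / (q - 1))).
   With T = a ^ (- theta), gamma (q - 1) < theta < beta q / (q - p) - gamma, this
   fails for small a; such a theta exists because q < p + beta / gamma. *)
Require Import Defs.
From HB Require Import structures.
From mathcomp Require Import all_boot all_order all_algebra.
From mathcomp Require Import all_classical all_reals all_analysis.
From mathcomp Require Import measurable_realfun ess_sup_inf complex ring lra.

Set Implicit Arguments.
Unset Strict Implicit.
Unset Printing Implicit Defensive.

Import Order.TTheory GRing.Theory Num.Theory.
Import numFieldNormedType.Exports.

Local Open Scope classical_set_scope.
Local Open Scope ring_scope.

(** * Lebesgue measure on the line and the Gaussian *)

(** The fractional Laplacian of [psi] is not compactly supported, so the absolute value of the term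
    in [|u| ^ p] cannot be absorbed by [|u| ^ q psi]. A one-sided bound by a multiple of [psi]
    avoids this: [|u| ^ p >= 0], and far away, where [psi] vanishes, the term has the favourable
    sign. Such a bound asks that negative second differences of the profile be controlled by the
    profile itself. Near the edge of the support this forces convexity: the parabola
    [max (0, 1 - z ^ 2)] fails there and its square does not. The square also makes the
    one-dimensional transform decay like [|t| ^ (-3)], enough for [|xi| ^ beta] times the transform
    of [psi] to be square integrable when [beta < 2]. Absorbing [A |u| ^ p] costs a multiple of
    [A ^ (q / (q - p))] with [A = C a ^ beta]. For [T = a ^ (- theta)] the right-hand side is thus
    of order [a ^ (beta q / (q - p) - theta) + a ^ (theta / (q - 1))], to be compared with
    [a ^ gamma]; both exponents exceed [gamma] exactly on the stated interval for [theta], which is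
    nonempty iff [gamma (q - p) < beta]. *)

Section lebesgue_line.
Context {R : realType}.
Local Notation leb := (@lebesgue_measure R).
Local Notation line := (measurableTypeR R).

Definition shift_line (c : R) : line -> line := fun x => x + c.

Lemma measurable_shift_line c : measurable_fun setT (shift_line c).
Proof. exact: measurable_funD. Qed.

HB.instance Definition _ c :=
  isMeasurableFun.Build _ _ _ _ _ (measurable_shift_line c).

Lemma lebesgue_measure_shift c (A : set line) : measurable A ->
  pushforward leb (shift_line c) A = leb A.
Proof.
move=> mA; apply/esym/lebesgue_measure_unique => //= _ [[a b]] _ <-.
rewrite /pushforward (_ : _ @^-1` _ = `]a - c, b - c]%classic); last first.
  apply/seteqP; rewrite /shift_line.
  by split => x /=; rewrite !in_itv/= ltrBlDr lerBrDr.
rewrite !lebesgue_measure_itv/= !lte_fin ltrBlDr subrK.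
by case: ifP => // _; congr EFin; ring.
Qed.

Lemma ge0_integral_shift c (f : line -> \bar R) :
  measurable_fun setT f -> (forall x, 0 <= f x)%E ->
  (\int[leb]_x f (x + c)%R = \int[leb]_x f x)%E.
Proof.
move=> mf f0.
have := @ge0_integral_pushforward _ _ _ _ _ (shift_line c)
  (measurable_shift_line c) leb setT f measurableT mf (fun x _ => f0 x).
rewrite preimage_setT => /= <-.
apply: eq_measure_integral => A mA _; exact: lebesgue_measure_shift.
Qed.

Lemma le_integrable_EFin d (T : measurableType d)
    (mu : {measure set T -> \bar R}) (f g : T -> R) :
  measurable_fun setT f -> (forall x, `|f x| <= g x) ->
  mu.-integrable setT (EFin \o g) -> mu.-integrable setT (EFin \o f).
Proof.
move=> mf fg; apply: le_integrable => //; first exact/measurable_EFinP.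
by move=> x _ /=; rewrite lee_fin (le_trans (fg x))// ler_norm.
Qed.

Lemma integrable_shift (c : R) (f : line -> R) : measurable_fun setT f ->
  leb.-integrable setT (EFin \o f) ->
  leb.-integrable setT (fun x => (f (x + c))%:E).
Proof.
move=> mf /integrableP[_ fi]; apply/integrableP; split.
  by apply/measurable_EFinP/measurableT_comp => //; exact: measurable_funD.
rewrite (@ge0_integral_shift c (fun x => `|(f x)%:E|)%E)//.
by apply: measurableT_comp => //; exact/measurable_EFinP.
Qed.

Lemma Rintegral_shift (c : R) (f : line -> R) : measurable_fun setT f ->
  leb.-integrable setT (EFin \o f) ->
  \int[leb]_x f (x + c) = \int[leb]_x f x.
Proof.
move=> mf fi; rewrite /Rintegral; congr fine.
have mp : measurable_fun setT (EFin \o f) by exact/measurable_EFinP.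
have := integral_pushforward (measurable_shift_line c) mp
  (integrable_shift c mf fi) measurableT.
rewrite preimage_setT => /= <-.
by apply: eq_measure_integral => A mA _; exact: lebesgue_measure_shift.
Qed.

Lemma integrable_oneDsqrV : leb.-integrable setT (fun x => ((1 + x ^+
  2)^-1)%:E).
Proof.
have m : measurable_fun setT (fun x : R => (1 + x ^+ 2)^-1).
  by apply: continuous_measurable_fun => x; exact: continuous_oneDsqrV.
apply/integrableP; split; first exact/measurable_EFinP.
under eq_integral => x _ do
  rewrite gee0_abs ?lee_fin ?invr_ge0 ?addr_ge0 ?sqr_ge0 ?ler01//.
rewrite ge0_symfun_integralT//.
- by rewrite -set_itvcy integral0y_oneDsqr -EFinM ltry.
- by move=> x; rewrite invr_ge0 addr_ge0 ?sqr_ge0.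
- by move=> x; exact: continuous_oneDsqrV.
- by move=> x /=; rewrite sqrrN.
Qed.

(** A single majorant serves on the whole line: Gaussians, the cutoff and the truncated
    subordination weight are all compared with [1 / (1 + x ^+ 2)]. *)
Lemma integrable_le_oneDsqrV (C : R) (f : line -> R) : measurable_fun setT f ->
  (forall x, `|f x| <= C / (1 + x ^+ 2)) -> leb.-integrable setT (EFin \o f).
Proof.
move=> mf fC; apply: (le_integrable_EFin mf fC).
rewrite [X in integrable _ _ X](_ : _ = fun x => C%:E * ((1 + x ^+ 2)^-1)%:E)%E.
  exact/integrableZl/integrable_oneDsqrV.
by apply/funext => x /=; rewrite EFinM.
Qed.

Lemma expR_ge_sqr (y : R) : 0 <= y -> 1 + y ^+ 2 / 2 <= expR y.
Proof.
by move=> y0; exact: (@expR_ge1Dxn R y 1).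
Qed.

(** The fundamental theorem of calculus on growing symmetric intervals, then dominated convergence;
    limits of [K] along the integers suffice because the intervals have integer ends. *)
Lemma Rintegral_derive0 (K g : line -> R) :
  (forall x : R, is_derive x 1 K (g x)) -> continuous g ->
  leb.-integrable setT (EFin \o g) ->
  K n%:R @[n --> \oo] --> (0 : R) -> K (- n%:R) @[n --> \oo] --> (0 : R) ->
  \int[leb]_x g x = 0.
Proof.
move=> dK cg gi Kp Kn.
(* The successor keeps the two ends distinct at [n = 0], as the fundamental theorem requires. *)
pose D n : set R := `[- n.+1%:R, n.+1%:R]%classic.
pose g_ n : line -> \bar R := (EFin \o g) \_ (D n).
have mg : measurable_fun setT (EFin \o g) by exact: measurable_int gi.
have mD n : measurable (D n) by exact: measurable_itv.
have [||||_ _ cvi] := @dominated_convergence _ _ _ leb setT measurableT g_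
  (EFin \o g)
   (abse \o (EFin \o g)) _ mg.
- move=> n; have mgn : measurable_fun (D n) (EFin \o g) := measurable_funTS mg.
  exact: (measurable_restrictT _ (mD n)).1 mgn.
- apply/aeW => x _; apply: cvg_near_cst.
  near=> n; rewrite /g_ patchE ifT// inE /D/= in_itv/=.
  rewrite -ler_norml (@le_trans _ _ n%:R)//; last by rewrite ler_nat.
  by near: n; exact: nbhs_infty_ger.
- exact: integrable_abse.
- apply/aeW => x n _; rewrite /g_ patchE; case: ifP => //= _.
  by rewrite lee_fin normr0.
have e n : (\int[leb]_x g_ n x)%E = (K n.+1%:R - K (- n.+1%:R))%:E.
  rewrite /g_ -integral_mkcond.
  rewrite (@continuous_FTC2 _ g K)//.
  - by rewrite -subr_gt0 opprK -natrD ltr0n.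
  - exact: continuous_subspaceT.
  - split.
    + by move=> x _; exact: ex_derive.
    + apply: cvg_at_right_filter; apply: differentiable_continuous.
      by apply/derivable1_diffP; exact: ex_derive.
    + apply: cvg_at_left_filter; apply: differentiable_continuous.
      by apply/derivable1_diffP; exact: ex_derive.
  - by move=> x _; rewrite derive1E derive_val.
rewrite /Rintegral; suff -> : (\int[leb]_x (EFin \o g) x)%E = 0%E by [].
have cv0 : (\int[leb]_x g_ n x)%E @[n --> \oo] --> 0%E.
  rewrite (funext e); apply: cvg_EFin; first exact: nearW.
  rewrite /comp/= -(subr0 0); apply: cvgB.
    by rewrite (cvg_shiftS (fun n => K n%:R)).
  by rewrite (cvg_shiftS (fun n => K (- n%:R))).
exact: cvg_unique cvi cv0.
Unshelve. all: by end_near. Qed.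

Lemma cvg_gauss_nat : gauss_fun n%:R @[n --> \oo] --> (0 : R).
Proof.
exact: (cvg_comp _ _ (@cvgr_idn R) cvg_gauss_fun).
Qed.

(** With [y = x ^+ 2] this is [(1 + y) ^ 2 <= 4 (1 + y ^ 2 / 2) <= 4 exp y]. The factor [1 + x ^+ 2]
    leaves room for first and second moments. *)
Lemma gauss_fun_le (x : R) : gauss_fun x * (1 + x ^+ 2) <= 4 / (1 + x ^+ 2).
Proof.
have x2 := sqr_ge0 x; have e := expR_ge_sqr x2.
rewrite /gauss_fun expRN ler_pdivlMr ?ltr_pwDl// -mulrA.
rewrite ler_pdivrMl ?expR_gt0//; apply: le_trans (ler_wpM2r (ler0n _ 4) e).
by rewrite -subr_ge0; set y := x ^+ 2; nra.
Qed.

Lemma integrable_le_gauss (C : R) (f : line -> R) : measurable_fun setT f ->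
  (forall x, `|f x| <= C * (gauss_fun x * (1 + x ^+ 2))) ->
  leb.-integrable setT (EFin \o f).
Proof.
move=> mf fC; have C0 : 0 <= C.
  have := le_trans (normr_ge0 _) (fC 0).
  by rewrite /gauss_fun expr0n/= oppr0 expR0 addr0 !mulr1.
apply: (@integrable_le_oneDsqrV (C * 4)) => // x.
by rewrite (le_trans (fC x))// -mulrA ler_wpM2l// gauss_fun_le.
Qed.

Definition gauss_cos (t : R) : R := \int[leb]_x (gauss_fun x * cos (t * x)).

Lemma measurable_cos_line (t : R) :
  measurable_fun setT ((fun x => cos (t * x)) : line -> R).
Proof.
apply: measurableT_comp.
  by apply: continuous_measurable_fun; exact: continuous_cos.
exact: mulrl_measurable.
Qed.

Lemma measurable_sin_line (t : R) :
  measurable_fun setT ((fun x => sin (t * x)) : line -> R).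
Proof.
apply: measurableT_comp.
  by apply: continuous_measurable_fun; exact: continuous_sin.
exact: mulrl_measurable.
Qed.

Lemma is_derive_gauss_fun (x : R) :
  is_derive x (1 : R) gauss_fun (- (2 * x) * gauss_fun x).
Proof.
have d : is_derive x (1 : R) (fun y : R => - y ^+ 2) (- (2 * x)).
  by apply: is_derive_eq; rewrite /GRing.scale/=; ring.
have := @is_derive1_comp _ expR (fun y => - y ^+ 2) x _ _ (is_derive_expR _) d.
by rewrite mulrC.
Qed.

Lemma is_derive_sinZ (t x : R) :
  is_derive x (1 : R) (fun y => sin (t * y)) (t * cos (t * x)).
Proof. apply: is_derive_eq; rewrite /GRing.scale/=; ring. Qed.

Lemma is_derive_cosZ (t x : R) :
  is_derive x (1 : R) (fun y => cos (t * y)) (- t * sin (t * x)).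
Proof. apply: is_derive_eq; rewrite /GRing.scale/=; ring. Qed.

(** Differentiation under the integral sign, then integration by parts, since [x gauss_fun x] is
    itself a derivative up to a factor: the transform of the Gaussian solves a linear differential
    equation. *)
Lemma is_derive_gauss_cos (t : R) :
  is_derive t (1 : R) gauss_cos (- (t / 2) * gauss_cos t).
Proof.
pose f (t x : R) := gauss_fun x * cos (t * x).
pose df (t x : R) := - (x * gauss_fun x * sin (t * x)).
have d1 s x : is_derive s (1 : R) (f ^~ x) (df s x).
  rewrite /f /df; apply: is_derive_eq; rewrite !scaler1 /GRing.scale/=; ring.
have fE s x : partial1of2 f s x = df s x.
  by rewrite /partial1of2 derive1E derive_val.
have ms s := measurable_sin_line s.
have mf s : measurable_fun setT (f s : line -> R).
  apply: measurable_funM; first exact: measurable_gauss_fun.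
  exact: measurable_cos_line.
have mdf s : measurable_fun setT (df s : line -> R).
  apply: measurableT_comp => //; apply: measurable_funM => //.
  by apply: measurable_funM => //; exact: measurable_gauss_fun.
have fi s : leb.-integrable setT (EFin \o f s).
  apply: (@integrable_le_gauss 1) => // x.
  rewrite mul1r normrM (ger0_norm (gauss_fun_ge0 _)) ler_wpM2l ?gauss_fun_ge0//.
  by rewrite (le_trans (cos_max _))// lerDl sqr_ge0.
have dfG s x : `|df s x| <= gauss_fun x * (1 + x ^+ 2).
  rewrite normrN 2!normrM (ger0_norm (gauss_fun_ge0 _)) mulrAC mulrC.
  rewrite ler_wpM2l ?gauss_fun_ge0//.
  have [x0 s1] := (normr_ge0 x, sin_max (s * x)).
  rewrite -(real_normK (num_real x)); nra.
have dfi s : leb.-integrable setT (EFin \o df s).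
  by apply: (@integrable_le_gauss 1) => // x; rewrite mul1r.
have Gi : leb.-integrable setT (EFin \o (fun x : R => gauss_fun x * (1 + x ^+
  2))).
  apply: (@integrable_le_gauss 1).
    apply: measurable_funM; first exact: measurable_gauss_fun.
    by apply: measurable_funD => //.
  by move=> x; rewrite mul1r ger0_norm// mulr_ge0 ?gauss_fun_ge0 ?addr_ge0
    ?sqr_ge0.
have tI : `](t - 1), (t + 1)[%classic t.
  by rewrite /= in_itv/= ltrBlDr ltrDl ltr01.
have G0 x : 0 <= gauss_fun x * (1 + x ^+ 2) :> R.
  by rewrite mulr_ge0 ?gauss_fun_ge0 ?addr_ge0 ?sqr_ge0.
have df1 s x : `](t - 1), (t + 1)[%classic s -> [set: line] x ->
   derivable (f ^~ x) s 1 by move=> _ _; exact: ex_derive.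
have dfG1 s x : `](t - 1), (t + 1)[%classic s -> [set: line] x ->
  `|partial1of2 f s x| <= gauss_fun x * (1 + x ^+ 2).
  by move=> _ _; rewrite fE.
have D := differentiation_under_integral measurableT tI (fun s _ => fi s) df1
  G0 Gi dfG1.
have E := derivable_under_integral measurableT tI (fun s _ => fi s) df1 G0 Gi
  dfG1.
apply: DeriveDef => //.
rewrite -derive1E D.
under eq_Rintegral do rewrite fE.
(* The boundary term of the integration by parts: [K] vanishes at both infinities, so its derivative
   [2 df + t f] has integral 0. *)
pose K (x : R) := gauss_fun x * sin (t * x).
pose g (x : R) := 2 * df t x + t * f t x.
have dK x : is_derive x (1 : R) K (g x).
  have H := is_deriveM (is_derive_gauss_fun x) (is_derive_sinZ t x).
  by apply: (is_derive_eq H); rewrite /g /f /df /GRing.scale/=; ring.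
have cgauss := @continuous_gauss_fun R.
have csin : continuous (fun x : R => sin (t * x)).
  move=> x; apply: (@continuous_comp _ _ _ ( *%R t) sin).
    exact: mulrl_continuous.
  exact: continuous_sin.
have ccos : continuous (fun x : R => cos (t * x)).
  move=> x; apply: (@continuous_comp _ _ _ ( *%R t) cos).
    exact: mulrl_continuous.
  exact: continuous_cos.
have cg : continuous g.
  move=> x; apply: cvgD; (apply: cvgM; first exact: cvg_cst).
    apply: cvgN; apply: cvgM; last exact: csin.
    by apply: cvgM; [exact: cvg_id|exact: cgauss].
  by apply: cvgM; [exact: cgauss|exact: ccos].
have dfi2 := integrableZl measurableT 2 (dfi t).
have fit := integrableZl measurableT t (fi t).
have gi : leb.-integrable setT (EFin \o g).
  exact: (integrableD measurableT dfi2 fit).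
have Kle x : `|K x| <= gauss_fun x.
  rewrite normrM (ger0_norm (gauss_fun_ge0 _)).
  by rewrite ler_piMr ?gauss_fun_ge0// sin_max.
have Kcvg (s : R) : s ^+ 2 = 1 -> K (s * n%:R) @[n --> \oo] --> (0 : R).
  move=> s2; apply: norm_cvg0.
  apply: (squeeze_cvgr _ (cvg_cst 0) cvg_gauss_nat).
  apply: nearW => n /=; rewrite normr_ge0/= (le_trans (Kle _))//.
  by rewrite /gauss_fun exprMn s2 mul1r.
have K1 : K n%:R @[n --> \oo] --> (0 : R).
  by have := Kcvg 1 (expr1n _ _); under eq_fun do rewrite mul1r.
have K2 : K (- n%:R) @[n --> \oo] --> (0 : R).
  by have := Kcvg (-1) (etrans (sqrrN 1) (expr1n _ _)); under eq_fun do rewrite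
    mulN1r.
have := Rintegral_derive0 dK cg gi K1 K2.
rewrite /g RintegralD//.
rewrite RintegralZl// RintegralZl//.
rewrite -/(gauss_cos t).
move=> h; lra.
Qed.

(** The quotient by a solution of the same differential equation has derivative 0; the Gaussian
    integral fixes its value at 0. *)
Lemma gauss_cosE (t : R) :
  gauss_cos t = Num.sqrt pi * expR (- (t ^+ 2 / 4)).
Proof.
pose F (t : R) := gauss_cos t * expR (t ^+ 2 / 4).
have dF s : is_derive s (1 : R) F 0.
  have d : is_derive s (1 : R) (fun y : R => y ^+ 2 / 4) (s / 2).
    by apply: is_derive_eq; rewrite /GRing.scale/=; field.
  have de := @is_derive1_comp _ expR (fun y => y ^+ 2 / 4) s _ _
    (is_derive_expR _) d.
  have H := is_deriveM (is_derive_gauss_cos s) de.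
  by apply: (is_derive_eq H); rewrite /GRing.scale/=; ring.
have := is_derive_0_is_cst t 0 dF.
rewrite /F expr0n/= mul0r expR0 mulr1.
have -> : gauss_cos 0 = Num.sqrt pi.
  rewrite /gauss_cos; under eq_Rintegral do rewrite mul0r cos0 mulr1.
  by rewrite /Rintegral integralT_gauss.
by move=> <-; rewrite -mulrA -expRD subrr expR0 mulr1.
Qed.

End lebesgue_line.

(** * One-dimensional cutoff *)

Section cutoff.
Context {R : realType}.
Local Notation leb := (@lebesgue_measure R).
Local Notation line := (measurableTypeR R).

Definition cutoff1 (z : R) : R := (Num.max 0 (1 - z ^+ 2)) ^+ 2.

Lemma cutoff1_in z : z ^+ 2 <= 1 -> cutoff1 z = (1 - z ^+ 2) ^+ 2.
Proof. by move=> z1; rewrite /cutoff1 max_r// subr_ge0. Qed.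

Lemma cutoff1_out z : 1 <= z ^+ 2 -> cutoff1 z = 0.
Proof. by move=> z1; rewrite /cutoff1 max_l ?expr0n// subr_le0. Qed.

Lemma cutoff1_ge0 z : 0 <= cutoff1 z. Proof. exact: sqr_ge0. Qed.

Lemma cutoff1_le1 z : cutoff1 z <= 1.
Proof.
have [z1|/ltW z1] := leP (z ^+ 2) 1; last by rewrite cutoff1_out.
by rewrite cutoff1_in//; have := sqr_ge0 z; nra.
Qed.

Lemma cutoff1_le z : cutoff1 z <= (1 - z ^+ 2) ^+ 2.
Proof.
have [z1|/ltW z1] := leP (z ^+ 2) 1; first by rewrite cutoff1_in.
by rewrite cutoff1_out// sqr_ge0.
Qed.

Lemma cutoff1N z : cutoff1 (- z) = cutoff1 z.
Proof. by rewrite /cutoff1 sqrrN. Qed.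

(** The profile is even, so changing the sign of [x] or of [y] at most exchanges the two translates;
    inequalities symmetric in them need only be checked for [x, y >= 0]. *)
Lemma cutoff1_sym (P : R -> R -> R -> R -> Prop) :
  (forall x y, 0 <= x -> 0 <= y ->
    P (cutoff1 x) (y ^+ 2) (cutoff1 (x + y)) (cutoff1 (x - y))) ->
  (forall u v s t, P u v s t -> P u v t s) ->
  forall x y, P (cutoff1 x) (y ^+ 2) (cutoff1 (x + y)) (cutoff1 (x - y)).
Proof.
move=> H S x y.
have W x' y' : 0 <= x' -> P (cutoff1 x') (y' ^+ 2) (cutoff1 (x' + y')) (cutoff1
  (x' - y')).
  move=> x0; have [y0|/ltW y0] := leP 0 y'; first exact: H.
  have := S _ _ _ _ (H x' (- y') x0 _).
  by rewrite sqrrN opprK oppr_ge0; exact.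
have [x0|/ltW x0] := leP 0 x; first exact: W.
rewrite -(cutoff1N x) -(cutoff1N (x + y)) -(cutoff1N (x - y)).
rewrite (_ : - (x + y) = - x - y); last by ring.
rewrite (_ : - (x - y) = - x + y); last by ring.
by apply: S; apply: W; rewrite oppr_ge0.
Qed.

Lemma cutoff1_second_diff_ge x y :
  cutoff1 x * (2 - 32 * y ^+ 2) <= cutoff1 (x + y) + cutoff1 (x - y).
Proof.
apply: (cutoff1_sym (P := fun u v s t => u * (2 - 32 * v) <= s + t)); last
  first.
  by move=> u v s t; rewrite (addrC t).
move=> {}x {}y x0 y0.
have b1 := cutoff1_ge0 (x + y); have b2 := cutoff1_ge0 (x - y).
have b0 := cutoff1_ge0 x.
have [x1|x1] := leP 1 x.
  by rewrite (cutoff1_out (z := x)) ?mul0r ?addr_ge0//; nra.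
(* From [y = 1/4] on, [32 y ^ 2 >= 2] and the left-hand side is nonpositive. The constant 32 is
   chosen so that only small [y] remain. *)
have [y1|y1] := leP (1 / 4) y.
  apply: (@le_trans _ _ 0); last exact: addr_ge0.
  by rewrite mulr_ge0_le0//; nra.
rewrite (cutoff1_in (z := x)); last by nra.
rewrite (cutoff1_in (z := x - y)); last by nra.
have [xy|xy] := leP (x + y) 1.
  rewrite (cutoff1_in (z := x + y)); last by nra.
  rewrite -subr_ge0.
  (* The second difference of the quartic is exactly [y ^ 2 (12 x ^ 2 - 4 + 2 y ^ 2)]. With
     [u = 1 - x ^ 2] the whole bracket is [32 (u - 3/16) ^ 2 + 55/8 + 2 y ^ 2]. *)
  rewrite (_ : _ - _ = y ^+ 2 * (12 * x ^+ 2 - 4 + 2 * y ^+ 2 + 32 * (1 - x ^+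
    2) ^+ 2)); last by ring.
  rewrite mulr_ge0 ?sqr_ge0//.
  have := sqr_ge0 (1 - x ^+ 2 - 3 / 16); have := sqr_ge0 y; nra.
(* The right translate has left the support, so the left one alone must reach [2 u ^ 2]. As
   [u <= 2 y] and [2 x - y >= 5/4], it satisfies [1 - (x - y) ^ 2 >= 13/8 u], and
   [(13/8) ^ 2 > 2]. *)
rewrite (cutoff1_out (z := x + y)) ?add0r; last by nra.
set u := 1 - x ^+ 2.
have u0 : 0 <= u by rewrite /u; nra.
have uy : u <= 2 * y by rewrite /u; nra.
have v : 13 / 8 * u <= 1 - (x - y) ^+ 2.
  rewrite (_ : 1 - (x - y) ^+ 2 = u + y * (2 * x - y)); last by rewrite /u;
    ring.
  nra.
have : (13 / 8 * u) ^+ 2 <= (1 - (x - y) ^+ 2) ^+ 2.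
  by rewrite lerXn2r ?nnegrE//; [nra|lra].
have := sqr_ge0 y; have := sqr_ge0 u; nra.
Qed.

Lemma cutoff1_second_diff_le x y :
  cutoff1 (x + y) + cutoff1 (x - y) - 2 * cutoff1 x <= 32 * y ^+ 2.
Proof.
apply: (cutoff1_sym (P := fun u v s t => s + t - 2 * u <= 32 * v)); last first.
  by move=> u v s t; rewrite (addrC t).
move=> {}x {}y x0 y0.
have b0 := cutoff1_ge0 x.
have [y1|y1] := leP 1 y.
  by have := cutoff1_le1 (x + y); have := cutoff1_le1 (x - y); nra.
have [x1|x1] := leP 1 x.
  rewrite (cutoff1_out (z := x + y)); last by nra.
  have [xy|xy] := leP 1 (x - y).
    by rewrite (cutoff1_out (z := x - y)); [nra|nra].
  (* Only the left translate remains; it lies within [y] of the edge, where the profile is at most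
     [(2 y) ^ 2]. *)
  have := cutoff1_le (x - y).
  set z := x - y in xy *.
  have z0 : 0 <= z by rewrite /z; lra.
  have zy : 1 - z <= y by rewrite /z; lra.
  have : (1 - z ^+ 2) ^+ 2 <= 4 * y ^+ 2.
    rewrite (_ : 1 - z ^+ 2 = (1 - z) * (1 + z)); last by ring.
    rewrite (_ : 4 * y ^+ 2 = (y * 2) ^+ 2); last by ring.
    rewrite lerXn2r ?nnegrE ?mulr_ge0//; [lra|lra|].
    by rewrite ler_pM//; lra.
  nra.
(* [cutoff1_le] puts the quartic in place of both translates, whether or not they lie in the
   support. *)
rewrite (cutoff1_in (z := x)); last by nra.
have := cutoff1_le (x + y); have := cutoff1_le (x - y).
have e : (1 - (x + y) ^+ 2) ^+ 2 + (1 - (x - y) ^+ 2) ^+ 2 - 2 * (1 - x ^+ 2)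
  ^+ 2
  = y ^+ 2 * (12 * x ^+ 2 - 4 + 2 * y ^+ 2) by ring.
have : y ^+ 2 * (12 * x ^+ 2 - 4 + 2 * y ^+ 2) <= y ^+ 2 * 32.
  by rewrite ler_wpM2l ?sqr_ge0//; nra.
lra.
Qed.

Definition cutoff (a x : R) : R := cutoff1 (a * x).

Lemma cutoff_second_diff_ge a x y :
  cutoff a x * (2 - 32 * a ^+ 2 * y ^+ 2) <= cutoff a (x + y) + cutoff a (x -
    y).
Proof.
have := cutoff1_second_diff_ge (a * x) (a * y).
by rewrite exprMn mulrA -mulrDr -mulrBr.
Qed.

Lemma cutoff_second_diff_norm a x y :
  `|cutoff a (x + y) + cutoff a (x - y) - 2 * cutoff a x| <= 32 * a ^+ 2 * y ^+
    2.
Proof.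
rewrite ler_norml; apply/andP; split.
  have := cutoff_second_diff_ge a x y.
  have := cutoff1_le1 (a * x); have := cutoff1_ge0 (a * x); rewrite -/(cutoff a
    x).
  have := sqr_ge0 a; have := sqr_ge0 y => y2 a2.
  by have := mulr_ge0 a2 y2; nra.
rewrite /cutoff (mulrDr a) (mulrBr a).
by have := cutoff1_second_diff_le (a * x) (a * y); rewrite exprMn (mulrA 32).
Qed.

Lemma cutoff_ge0 a x : 0 <= cutoff a x. Proof. exact: cutoff1_ge0. Qed.
Lemma cutoff_le1 a x : cutoff a x <= 1. Proof. exact: cutoff1_le1. Qed.

Lemma continuous_cutoff1 : continuous cutoff1.
Proof.
move=> x; rewrite /cutoff1.
have c : continuous_at x (fun z : R => Num.max 0 (1 - z ^+ 2)).
  apply: (@continuous_max _ _ (fun=> 0) (fun z : R => 1 - z ^+ 2)); first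
    exact: cvg_cst.
  by apply: cvgB; [exact: cvg_cst|exact: exprn_continuous].
exact: (cvgM c c).
Qed.

Lemma measurable_cutoff a : measurable_fun setT (cutoff a : line -> R).
Proof.
apply: (@measurableT_comp _ _ _ _ _ _ cutoff1).
  exact: (continuous_measurable_fun continuous_cutoff1).
exact: mulrl_measurable.
Qed.

Lemma cutoff_out (a x : R) : 0 < a -> a^-1 <= `|x| -> cutoff a x = 0.
Proof.
move=> a0 x1; apply: cutoff1_out.
rewrite -(real_normK (num_real (a * x))) normrM (gtr0_norm a0).
by rewrite exprn_ege1// -(mulfV (lt0r_neq0 a0)) ler_wpM2l// ltW.
Qed.

Lemma integrable_cutoff (a : R) : 0 < a -> leb.-integrable setT (EFin \o cutoff
  a).
Proof.
move=> a0.
apply: (@integrable_le_oneDsqrV _ (1 + a^-1 ^+ 2)); first exact: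
  measurable_cutoff.
move=> x; rewrite ger0_norm ?cutoff_ge0//.
have q : 0 < 1 + x ^+ 2 by rewrite ltr_pwDl// sqr_ge0.
rewrite ler_pdivlMr//.
have [xa|ax] := leP a^-1 `|x|.
  by rewrite (cutoff_out a0 xa) mul0r addr_ge0// sqr_ge0.
have x2 : x ^+ 2 <= a^-1 ^+ 2.
  by rewrite -(real_normK (num_real x)) lerXn2r ?nnegrE ?invr_ge0// ltW.
have := cutoff_ge0 a x; have := cutoff_le1 a x; nra.
Qed.

Lemma Rintegral_odd (g : line -> R) : leb.-integrable setT (EFin \o g) ->
  (forall x, g (- x) = - g x) -> \int[leb]_x g x = 0.
Proof.
move=> gi godd.
have gNi : leb.-integrable setT (fun x : line => (g (- x))%:E).
  rewrite (_ : (fun _ => _) = fun x => (- (g x)%:E)%E).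
    exact: (integrableN gi).
  by apply/funext => x; rewrite godd.
have e : \int[leb]_x g x = \int[leb]_x g (- x).
  rewrite /Rintegral; congr fine.
  have mN : measurable_fun setT (-%R : line -> line) by [].
  have := integral_pushforward mN (measurable_int _ gi) gNi measurableT.
  rewrite preimage_setT => /= <-.
  by apply: eq_measure_integral => A mA _; exact/esym/lebesgue_measureN.
have : \int[leb]_x g (- x) = - \int[leb]_x g x.
  under eq_Rintegral do rewrite godd -mulN1r.
  by rewrite RintegralZl// mulN1r.
rewrite -e; move: (\int[leb]_x g x) => I {e gi gNi godd g} h; lra.
Qed.

Lemma integrable_mul_cos (g : line -> R) (t : R) :
  leb.-integrable setT (EFin \o g) ->
  leb.-integrable setT (EFin \o (fun x => g x * cos (t * x))).
Proof.
move=> gi; apply: (@le_integrable_EFin _ _ _ _ _ (fun x => `|g x|)).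
- apply: measurable_funM; last exact: measurable_cos_line.
  by apply/measurable_EFinP; exact: measurable_int gi.
- by move=> x; rewrite normrM ler_piMr// cos_max.
- exact: (integrable_abse gi).
Qed.

Lemma integrable_mul_sin (g : line -> R) (t : R) :
  leb.-integrable setT (EFin \o g) ->
  leb.-integrable setT (EFin \o (fun x => g x * sin (t * x))).
Proof.
move=> gi; apply: (@le_integrable_EFin _ _ _ _ _ (fun x => `|g x|)).
- apply: measurable_funM; last exact: measurable_sin_line.
  by apply/measurable_EFinP; exact: measurable_int gi.
- by move=> x; rewrite normrM ler_piMr// sin_max.
- exact: (integrable_abse gi).
Qed.

Definition cos_transform (g : line -> R) (t : R) : R :=
  \int[leb]_x (g x * cos (t * x)).

Definition sin_transform (g : line -> R) (t : R) : R :=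
  \int[leb]_x (g x * sin (t * x)).

Lemma sin_transform_cutoff (a t : R) : 0 < a -> sin_transform (cutoff a) t = 0.
Proof.
move=> a0; apply: Rintegral_odd.
  exact/integrable_mul_sin/integrable_cutoff.
by move=> x; rewrite /cutoff mulrN cutoff1N mulrN sinN mulrN.
Qed.

Lemma cos_transform_norm (g : line -> R) (t : R) :
  leb.-integrable setT (EFin \o g) ->
  `|cos_transform g t| <= \int[leb]_x `|g x|.
Proof.
move=> gi; have gc := integrable_mul_cos t gi.
apply: (le_trans (le_normr_Rintegral measurableT gc)).
apply: le_Rintegral => //; [exact: (integrable_abse gc)|exact: (integrable_abse
  gi)|].
by move=> x _; rewrite normrM ler_piMr// cos_max.
Qed.

(** The cutoff and its first derivative vanish at the ends of the support, so repeated integration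
    by parts leaves no boundary term before the one in the second derivative, which carries
    [t ^ (-3)]. *)
Lemma cos_transform_cutoff_decay (a : R) : 0 < a -> exists C, forall t,
  1 <= `|t| -> `|t ^+ 3 * cos_transform (cutoff a) t| <= C.
Proof.
move=> a0; pose b := a^-1.
have b0 : 0 < b by rewrite invr_gt0.
exists (2 * (8 * a ^+ 2 + 24 * a ^+ 3 + 24 * a ^+ 4)) => t t1.
pose P (x : R) := (1 - a ^+ 2 * x ^+ 2) ^+ 2.
have PE x : x \in `[- b, b]%classic -> cutoff a x = P x.
  rewrite inE/= in_itv/= -ler_norml => xb.
  rewrite /cutoff cutoff1_in ?exprMn// -exprMn.
  rewrite -(real_normK (num_real (a * x))) normrM (gtr0_norm a0).
  by rewrite exprn_ile1 ?mulr_ge0 ?(ltW a0)// -(mulfV (lt0r_neq0 a0))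
    ler_wpM2l// ltW.
(* The antiderivative given by integrating by parts until the quartic [P] is exhausted: [(t^4 P -
   t^2 P'' + P'''') sin + (t^3 P' - t P''') cos]. The factor [t ^ 5] clears the denominators. *)
pose F (x : R) := (t ^+ 4 * (1 - a ^+ 2 * x ^+ 2) ^+ 2
   - t ^+ 2 * (12 * a ^+ 4 * x ^+ 2 - 4 * a ^+ 2) + 24 * a ^+ 4) * sin (t * x)
  + (t ^+ 3 * (4 * a ^+ 4 * x ^+ 3 - 4 * a ^+ 2 * x) - t * (24 * a ^+ 4 * x)) *
      cos (t * x).
have dF (x : R) : is_derive x (1 : R) F (t ^+ 5 * P x * cos (t * x)).
  have d1 : is_derive x (1 : R) (fun x => t ^+ 4 * (1 - a ^+ 2 * x ^+ 2) ^+ 2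
   - t ^+ 2 * (12 * a ^+ 4 * x ^+ 2 - 4 * a ^+ 2) + 24 * a ^+ 4)
   (t ^+ 4 * (4 * a ^+ 4 * x ^+ 3 - 4 * a ^+ 2 * x) - t ^+ 2 * (24 * a ^+ 4 *
     x)).
    by apply: is_derive_eq; rewrite /GRing.scale/=; ring.
  have d2 : is_derive x (1 : R) (fun x => t ^+ 3 * (4 * a ^+ 4 * x ^+ 3 - 4 * a
    ^+ 2 * x) - t * (24 * a ^+ 4 * x))
   (t ^+ 3 * (12 * a ^+ 4 * x ^+ 2 - 4 * a ^+ 2) - t * (24 * a ^+ 4)).
    by apply: is_derive_eq; rewrite /GRing.scale/=; ring.
  have H := is_deriveD (is_deriveM d1 (is_derive_sinZ t x))
    (is_deriveM d2 (is_derive_cosZ t x)).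
  by apply: (is_derive_eq H); rewrite /P /GRing.scale/=; ring.
have E : t ^+ 5 * cos_transform (cutoff a) t = F b - F (- b).
  rewrite /cos_transform -RintegralZl//; last
    exact/integrable_mul_cos/integrable_cutoff.
  transitivity (\int[leb]_(x in `[- b, b]) (t ^+ 5 * P x * cos (t * x))).
    rewrite [RHS]Rintegral_mkcond; apply: eq_Rintegral => x _.
    rewrite patchE; case: ifPn => [xb|xb]; first by rewrite PE// mulrA.
    rewrite cutoff_out ?mul0r ?mulr0//.
    move: xb; rewrite notin_setE/= in_itv/= -ler_norml => /negP.
    by rewrite -ltNge => /ltW.
  rewrite /Rintegral (@continuous_FTC2 _ _ F)//.
  - by rewrite gtrN.
  - apply: continuous_subspaceT => x.
    apply: cvgM; last first.
      apply: (@continuous_comp _ _ _ ( *%R t) cos); first exact: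
        mulrl_continuous.
      exact: continuous_cos.
    apply: cvgM; first exact: cvg_cst.
    have c : continuous_at x (fun x : R => 1 - a ^+ 2 * x ^+ 2).
      apply: cvgB; first exact: cvg_cst.
      by apply: cvgM; [exact: cvg_cst|exact: exprn_continuous].
    exact: (cvgM c c).
  - split.
    + by move=> x _; exact: ex_derive.
    + apply: cvg_at_right_filter; apply: differentiable_continuous.
      by apply/derivable1_diffP; exact: ex_derive.
    + apply: cvg_at_left_filter; apply: differentiable_continuous.
      by apply/derivable1_diffP; exact: ex_derive.
  - by move=> x _; rewrite derive1E derive_val.
have ab : a * b = 1 by rewrite mulfV// lt0r_neq0.
(* At [b] the values of [P] and [P'] are 0, those of [P''] and [P'''] are [8 a ^ 2] and [24 a ^ 3].
   Since [|t| >= 1], every remaining term is then at most its coefficient times [t ^ 2]. *)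
have E2 : F b - F (- b) =
    2 * ((24 * a ^+ 4 - t ^+ 2 * (8 * a ^+ 2)) * sin (t * b) - t * (24 * a ^+
      3) * cos (t * b)).
  rewrite /F mulrN sinN cosN !sqrrN.
  by ring: ab.
have t0 : t != 0 by apply/eqP => t0; move: t1; rewrite t0 normr0 ler10.
have t2 : 1 <= t ^+ 2 by rewrite -(real_normK (num_real t)) exprn_ege1.
rewrite -(@ler_pM2l _ (t ^+ 2)); last by lra.
rewrite -{1}(ger0_norm (sqr_ge0 t)) -normrM mulrA -exprD E E2 normrM (ger0_norm
  (ler0n _ 2)).
rewrite (mulrCA (t ^+ 2) 2); apply: ler_wpM2l => //.
apply: le_trans (ler_normB _ _) _.
rewrite normrM (normrM _ (cos _)) normrM.
have tt : `|t| <= t ^+ 2 by rewrite -(real_normK (num_real t)); nra.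
have [s1 c1] := (sin_max (t * b), cos_max (t * b)).
have [a3 a4] := (exprn_gt0 3 a0, exprn_gt0 4 a0).
rewrite (gtr0_norm (_ : 0 < 24 * a ^+ 3)); last by lra.
have h1 : `|24 * a ^+ 4 - t ^+ 2 * (8 * a ^+ 2)| <= 24 * a ^+ 4 + t ^+ 2 * (8 *
  a ^+ 2).
  rewrite (le_trans (ler_normB _ _))// !ger0_norm//.
    by apply: mulr_ge0; [exact: sqr_ge0|apply: mulr_ge0 => //; exact: sqr_ge0].
  by lra.
apply: (@le_trans _ _ ((24 * a ^+ 4 + t ^+ 2 * (8 * a ^+ 2)) * 1 + t ^+ 2 * (24
  * a ^+ 3) * 1)).
  apply: lerD.
    by apply: ler_pM.
  apply: ler_pM => //; first by rewrite mulr_ge0//; lra.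
  by rewrite ler_wpM2r//; lra.
nra.
Qed.

End cutoff.

(** * Heat flow on the line *)

Section smoothing.
Context {R : realType}.
Local Notation leb := (@lebesgue_measure R).
Local Notation line := (measurableTypeR R).

Definition gauss_density (z : R) : R := (Num.sqrt pi)^-1 * gauss_fun z.

Lemma sqrt_pi_gt0 : 0 < Num.sqrt pi :> R.
Proof. by rewrite sqrtr_gt0 pi_gt0. Qed.

Lemma gauss_density_ge0 z : 0 <= gauss_density z.
Proof. by rewrite mulr_ge0 ?gauss_fun_ge0// invr_ge0 ltW// sqrt_pi_gt0. Qed.

Lemma measurable_gauss_density :
  measurable_fun setT (gauss_density : line -> R).
Proof. by apply: measurable_funM => //; exact: measurable_gauss_fun. Qed.

Lemma integrable_gauss_density_mul (C : R) (g : line -> R) :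
  measurable_fun setT g -> (forall z, `|g z| <= C * (1 + z ^+ 2)) ->
  leb.-integrable setT (EFin \o (fun z => gauss_density z * g z)).
Proof.
move=> mg gC; apply: (@integrable_le_gauss _ ((Num.sqrt pi)^-1 * C)).
  by apply: measurable_funM => //; exact: measurable_gauss_density.
move=> z; rewrite normrM (ger0_norm (gauss_density_ge0 _)) /gauss_density.
rewrite -!mulrA ler_wpM2l ?invr_ge0 ?(ltW sqrt_pi_gt0)//.
by rewrite mulrCA ler_wpM2l ?gauss_fun_ge0.
Qed.

Lemma integrable_gauss_density_mul_bounded (C : R) (g : line -> R) :
  measurable_fun setT g -> (forall z, `|g z| <= C) ->
  leb.-integrable setT (EFin \o (fun z => gauss_density z * g z)).
Proof.
move=> mg gC; apply: (@integrable_gauss_density_mul C) => // z.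
rewrite (le_trans (gC z))// ler_peMr//; first by rewrite (le_trans _ (gC z)).
by rewrite lerDl sqr_ge0.
Qed.

Lemma integral_gauss_density_cos (t : R) :
  \int[leb]_z (gauss_density z * cos (t * z)) = expR (- (t ^+ 2 / 4)).
Proof.
under eq_Rintegral do rewrite -mulrA.
rewrite RintegralZl//.
  rewrite -/(gauss_cos t) gauss_cosE mulrA mulVf ?mul1r//.
  by rewrite gt_eqF// sqrt_pi_gt0.
apply/integrable_mul_cos/integrableT_gauss.
Qed.

Lemma integral_gauss_density : \int[leb]_z gauss_density z = 1.
Proof.
rewrite -[RHS](_ : expR (- ((0 : R) ^+ 2 / 4)) = 1); last first.
  by rewrite expr0n/= mul0r oppr0 expR0.
rewrite -integral_gauss_density_cos.
by apply: eq_Rintegral => z _; rewrite mul0r cos0 mulr1.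
Qed.

Definition gauss_moment2 : R := \int[leb]_z (gauss_density z * z ^+ 2).

Lemma gauss_moment2_ge0 : 0 <= gauss_moment2.
Proof.
by apply: Rintegral_ge0 => z _; rewrite mulr_ge0 ?gauss_density_ge0 ?sqr_ge0.
Qed.

(* The heat kernel at time expR r is the centered Gaussian of variance
   2 expR r, i.e. the law of 2 expR (r / 2) z for z of density gauss_density;
   averaging over +z and -z makes second differences appear. *)
Definition heat_sd (r : R) : R := 2 * expR (r / 2).

Lemma heat_sd_sqr r : heat_sd r ^+ 2 = 4 * expR r.
Proof.
rewrite /heat_sd exprMn -expRM_natr (_ : r / 2 * 2%:R = r); last by field.
by ring.
Qed.

Definition heat_avg (f : line -> R) (r x z : R) : R :=
  (f (x + heat_sd r * z) + f (x - heat_sd r * z)) / 2.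

Definition heat (f : line -> R) (r x : R) : R :=
  \int[leb]_z (gauss_density z * heat_avg f r x z).

Lemma measurable_heat_sd : measurable_fun setT (heat_sd : line -> R).
Proof.
apply: measurable_funM => //.
apply: (measurableT_comp (@measurable_expR R)).
exact: mulrr_measurable.
Qed.

Section bounded.
Context (f : line -> R).
Hypotheses (mf : measurable_fun setT f) (f0 : forall x, 0 <= f x)
  (f1 : forall x, f x <= 1).

Lemma heat_avg_ge0 r x z : 0 <= heat_avg f r x z.
Proof. by rewrite divr_ge0 ?addr_ge0. Qed.

Lemma heat_avg_le1 r x z : heat_avg f r x z <= 1.
Proof.
rewrite /heat_avg ler_pdivrMr// mul1r -[2%:R](_ : 1 + 1 = 2) ?lerD//.
Qed.

Lemma measurable_heat_avg : measurable_fun setT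
  (fun w : (line * line) * line => heat_avg f w.1.1 w.1.2 w.2).
Proof.
have ms : measurable_fun setT
    (fun w : (line * line) * line => heat_sd w.1.1 * w.2).
  apply: measurable_funM => //.
  apply: (measurableT_comp measurable_heat_sd).
  exact: (measurableT_comp measurable_fst).
have mx : measurable_fun setT (fun w : (line * line) * line => w.1.2).
  exact: (measurableT_comp measurable_snd).
apply: measurable_funM => //; apply: measurable_funD.
  by apply: (measurableT_comp mf); exact: measurable_funD.
by apply: (measurableT_comp mf); exact: measurable_funB.
Qed.

Lemma measurable_heat_avg_z r x : measurable_fun setT (heat_avg f r x : line ->
  R).
Proof.
exact: (measurableT_comp measurable_heat_avg (pair1_measurable (r, x))).
Qed.

Lemma integrable_heat_avg r x :
  leb.-integrable setT (EFin \o (fun z => gauss_density z * heat_avg f r x z)).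
Proof.
apply: (@integrable_gauss_density_mul_bounded 1).
  exact: measurable_heat_avg_z.
by move=> z; rewrite ger0_norm ?heat_avg_ge0 ?heat_avg_le1.
Qed.

Lemma heat_ge0 r x : 0 <= heat f r x.
Proof.
by apply: Rintegral_ge0 => z _; rewrite mulr_ge0 ?gauss_density_ge0
  ?heat_avg_ge0.
Qed.

Lemma integrable_gauss_densityT :
  leb.-integrable setT (EFin \o (gauss_density : line -> R)).
Proof.
have := @integrable_gauss_density_mul_bounded 1 (fun=> 1) (measurable_cst _) _.
by under eq_fun do rewrite mulr1; apply => z; rewrite normr1.
Qed.

Lemma heat_le1 r x : heat f r x <= 1.
Proof.
rewrite -integral_gauss_density; apply: le_Rintegral => //.
- exact: integrable_heat_avg.
- exact: integrable_gauss_densityT.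
- by move=> z _; rewrite ler_piMr ?gauss_density_ge0 ?heat_avg_le1.
Qed.

Lemma measurable_heat : measurable_fun setT
  (fun w : line * line => heat f w.1 w.2).
Proof.
have m : measurable_fun setT (fun w : (line * line) * line =>
    (gauss_density w.2 * heat_avg f w.1.1 w.1.2 w.2)%:E).
  apply/measurable_EFinP/measurable_funM; last exact: measurable_heat_avg.
  exact: (measurableT_comp measurable_gauss_density).
have := measurable_fun_fubini_tonelli_F (m2 := leb) _ m _.
move=> /(_ (fun w => _)) H.
apply: (measurableT_comp (@fine_measurable R _ measurableT)); apply: H => w.
by rewrite lee_fin mulr_ge0 ?gauss_density_ge0 ?heat_avg_ge0.
Qed.

(* For k x = cos (t x) or sin (t x), averaging opposite translates multiplies
   the transform of f by a cosine, so that only the characteristic function of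
   the Gaussian remains after integrating in z. *)
Lemma Rintegral_heat (k : line -> R) (r c l : R) :
  measurable_fun setT k -> (forall x, `|k x| <= 1) ->
  leb.-integrable setT (EFin \o f) ->
  (forall z, \int[leb]_x (heat_avg f r x z * k x) = c * cos (l * z)) ->
  leb.-integrable setT (EFin \o (fun x => heat f r x * k x)) /\
  \int[leb]_x (heat f r x * k x) = c * expR (- (l ^+ 2 / 4)).
Proof.
move=> mk k1 fi H.
pose G (w : line * line) := gauss_density w.2 * heat_avg f r w.1 w.2 * k w.1.
have mG : measurable_fun setT G.
  apply: measurable_funM; last exact: (measurableT_comp mk).
  apply: measurable_funM; first exact: (measurableT_comp
    measurable_gauss_density).
  have mp : measurable_fun setT (fun w : line * line => ((r : line, w.1), w.2)).
    exact: measurable_fun_pair (measurable_fun_pair (measurable_cst _)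
      measurable_fst) measurable_snd.
  exact: (measurableT_comp measurable_heat_avg mp).
have fs s : leb.-integrable setT (fun x : line => (f (x + s))%:E).
  exact: integrable_shift.
have avgi z : leb.-integrable setT (EFin \o (fun x => heat_avg f r x z)).
  rewrite (_ : _ \o _ = (fun x : line => (2^-1)%:E * ((f (x + heat_sd r *
    z))%:E + (f (x - heat_sd r * z))%:E))%E).
    by apply: integrableZl => //; apply: integrableD.
  by apply/funext => x; rewrite /= /heat_avg mulrC.
have RavgI z : \int[leb]_x heat_avg f r x z = \int[leb]_x f x.
  rewrite /heat_avg; under eq_Rintegral do rewrite mulrC.
  rewrite RintegralZl//; last exact: (integrableD measurableT (fs _) (fs _)).
  set s := heat_sd r * z.
  have e := @RintegralD _ _ _ leb setT (fun x => f (x + s)) (fun x => f (x -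
    s)) measurableT (fs s) (fs (- s)).
  rewrite e.
  rewrite (Rintegral_shift s mf fi).
  by rewrite (Rintegral_shift (- s) mf fi); field.
have avgI z : (\int[leb]_x (heat_avg f r x z)%:E = (\int[leb]_x f x)%:E)%E.
  by rewrite -(RavgI z) /Rintegral fineK//; exact: (integrable_fin_num
    measurableT (avgi z)).
(* Translations preserve the mass of [f], so at fixed [z] the integral of [|G|] in [x] is at most
   that mass times [gauss_density z]. *)
have iG : (leb \x leb)%E.-integrable setT (EFin \o G).
  apply/integrable21ltyP; first exact/measurable_EFinP.
  apply: (@le_lt_trans _ _ (\int[leb]_z ((\int[leb]_x f x)%:E * (gauss_density
    z)%:E))%E).
    apply: ge0_le_integral => //.
    - by move=> z _; exact: integral_ge0.
    - apply: (measurable_fun_fubini_tonelli_G (m1 := leb) (abse \o (EFin \o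
        G))) => //=.
      by apply: measurableT_comp => //; exact/measurable_EFinP.
    - apply: (measurable_funeM (\int[leb]_x f x)%:E).
      apply/measurable_EFinP; exact: measurable_gauss_density.
    - move=> z _.
      rewrite -(avgI z) muleC -ge0_integralZl//; last 3 first.
        exact: measurable_int (avgi z).
        by move=> x _; rewrite lee_fin heat_avg_ge0.
        by rewrite lee_fin gauss_density_ge0.
      apply: ge0_le_integral => //.
      + apply: measurableT_comp => //; apply/measurable_EFinP.
        exact: (measurableT_comp mG (pair2_measurable z)).
      + apply: measurable_funeM; exact: measurable_int (avgi z).
      + move=> x _; rewrite /G/= lee_fin.
        have g0 : 0 <= gauss_density z * heat_avg f r x z.
          by rewrite mulr_ge0 ?gauss_density_ge0 ?heat_avg_ge0.
        by rewrite normrM (ger0_norm g0) ler_piMr.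
  rewrite integralZl//; last exact: integrable_gauss_densityT.
  have := integrable_fin_num measurableT integrable_gauss_densityT.
  by move=> /fineK <-; rewrite -EFinM ltry.
have iz x : leb.-integrable setT (fun z => (EFin \o G) (x, z)).
  have := integrableZr measurableT (k x) (integrable_heat_avg r x).
  by apply: eq_integrable.
have E x : (\int[leb]_z (EFin \o G) (x, z) = (heat f r x * k x)%:E)%E.
  rewrite -(fineK (integrable_fin_num measurableT (iz x))); congr EFin.
  by rewrite /heat -RintegralZr//; exact: integrable_heat_avg.
have F := integrable_fubini_F iG.
rewrite /fubini_F in F.
have FE : (fun x => \int[leb]_z (EFin \o G) (x, z))%E = (EFin \o (fun x => heat
  f r x * k x)).
  by apply/funext => x; rewrite E.
split; first by rewrite -FE.
have ix z : leb.-integrable setT (EFin \o (fun x => heat_avg f r x z * k x)).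
  have m : measurable_fun setT ((fun x => heat_avg f r x z * k x) : line -> R).
    apply: measurable_funM => //; apply/measurable_EFinP.
    exact: measurable_int (avgi z).
  apply: (le_integrable_EFin m _ (avgi z)) => x.
  by rewrite normrM ger0_norm ?heat_avg_ge0// ler_piMr ?heat_avg_ge0.
have := Fubini iG; rewrite /fubini_F /fubini_G FE /Rintegral => ->.
rewrite -integral_gauss_density_cos -RintegralZl//; last first.
  apply: (@integrable_gauss_density_mul_bounded 1); last by move=> z; exact:
    cos_max.
  exact: measurable_cos_line.
rewrite /Rintegral; congr fine; apply: eq_integral => z _.
rewrite mulrCA -H EFinM.
rewrite (fineK (integrable_fin_num measurableT (ix z))) -integralZl//.
by apply: eq_integral => x _; rewrite /G /= -mulrA.
Qed.

(** Translating by [s] adds, by the addition formula, a sine transform with coefficient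
    [sin (t * s)]; this coefficient is odd in [s] and cancels between the two opposite
    translates. *)
Lemma Rintegral_heat_avg_cos (r t z : R) : leb.-integrable setT (EFin \o f) ->
  \int[leb]_x (heat_avg f r x z * cos (t * x)) =
  cos_transform f t * cos (t * heat_sd r * z).
Proof.
move=> fi; set s := heat_sd r * z.
have sh (c : R) : leb.-integrable setT (EFin \o (fun x => f (x + c) * cos (t *
  x)))
    /\ \int[leb]_x (f (x + c) * cos (t * x)) =
    cos (t * c) * cos_transform f t + sin (t * c) * sin_transform f t.
  pose g (x : line) : R := cos (t * c) * (f x * cos (t * x)) + sin (t * c) * (f
    x * sin (t * x)).
  have i1 := integrableZl measurableT (cos (t * c)) (integrable_mul_cos t fi).
  have i2 := integrableZl measurableT (sin (t * c)) (integrable_mul_sin t fi).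
  have gi : leb.-integrable setT (EFin \o g) := integrableD measurableT i1 i2.
  have mg : measurable_fun setT g by apply/measurable_EFinP; exact:
    measurable_int gi.
  have gE : (fun x => f (x + c) * cos (t * x)) = (fun x => g (x + c)).
    apply/funext => x; rewrite /g -{2}(addrK c x) mulrBr cosB; ring.
  rewrite gE; split; first exact: (integrable_shift c mg gi).
  rewrite Rintegral_shift// /g RintegralD//.
  rewrite RintegralZl//; last exact: integrable_mul_cos.
  by rewrite RintegralZl//; exact: integrable_mul_sin.
have [i1 e1] := sh s; have [i2 e2] := sh (- s).
transitivity (\int[leb]_x (2^-1 * (f (x + s) * cos (t * x) + f (x - s) * cos (t
  * x)))).
  by apply: eq_Rintegral => x _; rewrite /heat_avg -/s; ring.
rewrite RintegralZl//; last exact: (integrableD measurableT i1 i2).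
by rewrite RintegralD// e1 e2 mulrN cosN sinN -mulrA -/s; field.
Qed.

Lemma Rintegral_heat_avg_sin (r t z : R) : leb.-integrable setT (EFin \o f) ->
  \int[leb]_x (heat_avg f r x z * sin (t * x)) =
  sin_transform f t * cos (t * heat_sd r * z).
Proof.
move=> fi; set s := heat_sd r * z.
have sh (c : R) : leb.-integrable setT (EFin \o (fun x => f (x + c) * sin (t *
  x)))
    /\ \int[leb]_x (f (x + c) * sin (t * x)) =
    cos (t * c) * sin_transform f t - sin (t * c) * cos_transform f t.
  pose g (x : line) : R := cos (t * c) * (f x * sin (t * x)) + - sin (t * c) *
    (f x * cos (t * x)).
  have i1 := integrableZl measurableT (cos (t * c)) (integrable_mul_sin t fi).
  have i2 := integrableZl measurableT (- sin (t * c)) (integrable_mul_cos t fi).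
  have gi : leb.-integrable setT (EFin \o g) := integrableD measurableT i1 i2.
  have mg : measurable_fun setT g by apply/measurable_EFinP; exact:
    measurable_int gi.
  have gE : (fun x => f (x + c) * sin (t * x)) = (fun x => g (x + c)).
    apply/funext => x; rewrite /g -{2}(addrK c x) mulrBr sinB; ring.
  rewrite gE; split; first exact: (integrable_shift c mg gi).
  rewrite Rintegral_shift// /g RintegralD//.
  rewrite RintegralZl//; last exact: integrable_mul_sin.
  by rewrite RintegralZl// ?mulNr//; exact: integrable_mul_cos.
have [i1 e1] := sh s; have [i2 e2] := sh (- s).
transitivity (\int[leb]_x (2^-1 * (f (x + s) * sin (t * x) + f (x - s) * sin (t
  * x)))).
  by apply: eq_Rintegral => x _; rewrite /heat_avg -/s; ring.
rewrite RintegralZl//; last exact: (integrableD measurableT i1 i2).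
by rewrite RintegralD// e1 e2 mulrN cosN sinN -mulrA -/s; field.
Qed.

Lemma heat_exponent (r t : R) : (t * heat_sd r) ^+ 2 / 4 = expR r * t ^+ 2.
Proof. by rewrite exprMn heat_sd_sqr; field. Qed.

Lemma cos_transform_heat (r t : R) : leb.-integrable setT (EFin \o f) ->
  cos_transform (heat f r) t = cos_transform f t * expR (- (expR r * t ^+ 2)).
Proof.
move=> fi; rewrite -heat_exponent.
apply: (proj2 (Rintegral_heat (measurable_cos_line t) _ fi _)).
  by move=> x; exact: cos_max.
by move=> z; exact: Rintegral_heat_avg_cos.
Qed.

Lemma sin_transform_heat (r t : R) : leb.-integrable setT (EFin \o f) ->
  sin_transform (heat f r) t = sin_transform f t * expR (- (expR r * t ^+ 2)).
Proof.
move=> fi; rewrite -heat_exponent.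
apply: (proj2 (Rintegral_heat (measurable_sin_line t) _ fi _)).
  by move=> x; exact: sin_max.
by move=> z; exact: Rintegral_heat_avg_sin.
Qed.

Lemma cos_transform0 (g : line -> R) : cos_transform g 0 = \int[leb]_x g x.
Proof. by apply: eq_Rintegral => x _; rewrite mul0r cos0 mulr1. Qed.

Lemma integrable_heat (r : R) : leb.-integrable setT (EFin \o f) ->
  leb.-integrable setT (EFin \o heat f r).
Proof.
move=> fi; have [|i _] := Rintegral_heat (measurable_cos_line 0) _ fi
  (fun z => Rintegral_heat_avg_cos r 0 z fi).
  by move=> x; exact: cos_max.
by apply: eq_integrable i => // x _ /=; rewrite mul0r cos0 mulr1.
Qed.

(** Conservation of mass is the transform identity at frequency 0. *)
Lemma Rintegral_heatE (r : R) : leb.-integrable setT (EFin \o f) ->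
  \int[leb]_x heat f r x = \int[leb]_x f x.
Proof.
move=> fi; rewrite -!cos_transform0 cos_transform_heat//.
by rewrite expr0n/= mulr0 oppr0 expR0 mulr1.
Qed.

Section second_difference.
Context (D : R).
Hypotheses (D0 : 0 <= D)
  (fge : forall x y, f x * (2 - D * y ^+ 2) <= f (x + y) + f (x - y))
  (fle : forall x y, `|f (x + y) + f (x - y) - 2 * f x| <= D * y ^+ 2).

(** The squared displacement is [4 expR r z ^ 2] and averaging over the two signs divides by 2,
    hence the factor 2. *)
Let K : R := 2 * D * gauss_moment2.

Let gi1 : leb.-integrable setT (EFin \o (fun z : line => gauss_density z * 1)).
Proof.
by apply: (@integrable_gauss_density_mul_bounded 1) => // z; rewrite normr1.
Qed.

Let gi2 : leb.-integrable setT (EFin \o (fun z : line => gauss_density z * z ^+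
  2)).
Proof.
apply: (@integrable_gauss_density_mul 1) => // z.
by rewrite mul1r ger0_norm ?sqr_ge0// lerDr.
Qed.

Let linear_moment (c d : R) :
  leb.-integrable setT (EFin \o (fun z : line => gauss_density z * (c + d * z
    ^+ 2)))
  /\ \int[leb]_z (gauss_density z * (c + d * z ^+ 2)) = c + d * gauss_moment2.
Proof.
have i1 := integrableZl measurableT c gi1.
have i2 := integrableZl measurableT d gi2.
have i := integrableD measurableT i1 i2.
have e : (fun z : line => gauss_density z * (c + d * z ^+ 2)) =
  (fun z => c * (gauss_density z * 1) + d * (gauss_density z * z ^+ 2)).
  by apply/funext => z; ring.
rewrite e; split; first exact: i.
rewrite RintegralD// !RintegralZl//.
under eq_Rintegral do rewrite mulr1.
by rewrite integral_gauss_density mulr1.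
Qed.

(** The lower bound on second differences is proportional to [f x], and so is its average against
    the Gaussian, in which only the second moment enters. *)
Lemma heat_ge (r x : R) : (1 - K * expR r) * f x <= heat f r x.
Proof.
have [i e] := linear_moment (f x) (- (2 * D * expR r * f x)).
apply: (@le_trans _ _ (\int[leb]_z (gauss_density z * (f x + - (2 * D * expR r
  * f x) * z ^+ 2)))).
  by rewrite e /K le_eqVlt; apply/orP; left; apply/eqP; ring.
apply: le_Rintegral => //; first exact: integrable_heat_avg.
move=> z _; rewrite ler_wpM2l ?gauss_density_ge0//.
rewrite /heat_avg ler_pdivlMr//.
apply: le_trans (fge x (heat_sd r * z)).
by rewrite exprMn heat_sd_sqr le_eqVlt; apply/orP; left; apply/eqP; ring.
Qed.

Lemma heat_dist (r x : R) : `|f x - heat f r x| <= K * expR r.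
Proof.
have [i0 e0] := linear_moment (f x) 0.
have [i e] := linear_moment 0 (2 * D * expR r).
have -> : f x - heat f r x =
   \int[leb]_z (gauss_density z * (f x - heat_avg f r x z)).
  rewrite -[LHS](_ : f x + 0 * gauss_moment2 - heat f r x = _); last by ring.
  rewrite -e0 -RintegralB//; last exact: integrable_heat_avg.
  by apply: eq_Rintegral => z _; ring.
have i1 : leb.-integrable setT (EFin \o (fun z => gauss_density z * (f x -
  heat_avg f r x z))).
  have := integrableB measurableT i0 (integrable_heat_avg r x).
  by apply: eq_integrable => // z _; rewrite /= -EFinB; congr EFin; ring.
apply: le_trans (le_normr_Rintegral measurableT i1) _.
apply: (@le_trans _ _ (\int[leb]_z (gauss_density z * (0 + 2 * D * expR r * z
  ^+ 2)))); last first.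
  by rewrite e /K le_eqVlt; apply/orP; left; apply/eqP; ring.
apply: le_Rintegral => //; first exact: (integrable_abse i1).
move=> z _; rewrite normrM (ger0_norm (gauss_density_ge0 _)).
rewrite ler_wpM2l ?gauss_density_ge0//.
rewrite distrC (_ : heat_avg f r x z - f x =
  (f (x + heat_sd r * z) + f (x - heat_sd r * z) - 2 * f x) / 2); last first.
  by rewrite /heat_avg; field.
rewrite normrM (ger0_norm (_ : 0 <= 2^-1)) ?invr_ge0// ler_pdivrMr//.
apply: le_trans (fle x (heat_sd r * z)) _.
by rewrite exprMn heat_sd_sqr le_eqVlt; apply/orP; left; apply/eqP; ring.
Qed.

End second_difference.
End bounded.
End smoothing.

(** * Tensor products on R^N *)

Section Rn.
Context {R : realType}.
Local Notation leb := (@lebesgue_measure R).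
Local Notation line := (measurableTypeR R).

Definition Rn_uncons n (x : Rn R n.+1) : line * Rn R n :=
  (thead x, [tuple of behead x]).

Lemma Rn_unconsK n : cancel (@Rn_uncons n) (@Rn_cons R n).
Proof. by move=> x; rewrite /Rn_uncons /Rn_cons /= [RHS]tuple_eta. Qed.

Lemma measurable_Rn_uncons n : measurable_fun setT (@Rn_uncons n).
Proof.
apply: measurable_fun_pair; first exact: measurable_tnth.
exact: measurable_behead.
Qed.

Lemma ge0_integral_Rn_cons n (F : Rn R n.+1 -> \bar R) :
  measurable_fun setT F -> (forall x, 0 <= F x)%E ->
  (\int[lebesgueRn R n.+1]_x F x =
   \int[leb]_a \int[lebesgueRn R n]_x F (Rn_cons (a, x)))%E.
Proof.
move=> mF F0.
have := @ge0_integral_pushforward _ _ _ _ _ (@Rn_cons R n) (@measurable_Rn_cons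
  R n)
  (leb \x lebesgueRn R n)%E setT F measurableT mF (fun x _ => F0 x).
rewrite preimage_setT => e; transitivity (\int[pushforward (leb \x lebesgueRn R
  n) (@Rn_cons R n)]_y F y)%E.
  by [].
rewrite e fubini_tonelli1//; last by move=> z; exact: F0.
exact: (measurableT_comp mF (@measurable_Rn_cons R n)).
Qed.

Lemma integrable_Rn_cons n (F : Rn R n.+1 -> \bar R) :
  (leb \x lebesgueRn R n)%E.-integrable setT (F \o @Rn_cons R n) ->
  measurable_fun setT F ->
  (lebesgueRn R n.+1).-integrable setT F /\
  (\int[lebesgueRn R n.+1]_x F x =
   \int[leb]_a \int[lebesgueRn R n]_x F (Rn_cons (a, x)))%E.
Proof.
move=> Fi mF.
have e1 : (lebesgueRn R n.+1).-integrable setT F.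
  apply/integrableP; split => //; rewrite ge0_integral_Rn_cons//.
    by have /integrable12ltyP := Fi; apply; exact: measurable_int Fi.
  exact: measurableT_comp.
split => //.
have := integral_pushforward (@measurable_Rn_cons R n) mF Fi measurableT.
rewrite preimage_setT => e.
transitivity (\int[pushforward (leb \x lebesgueRn R n) (@Rn_cons R n)]_y F y)%E.
  by [].
by rewrite e -integral12_prod_meas1.
Qed.

(** The induction step for tensor products: Fubini for a function that splits after the first
    coordinate. *)
Lemma Rintegral_Rn_cons_mul n (A : line -> R) (B : Rn R n -> R)
    (F : Rn R n.+1 -> R) :
  leb.-integrable setT (EFin \o A) ->
  (lebesgueRn R n).-integrable setT (EFin \o B) ->
  (forall a x, F (Rn_cons (a, x)) = A a * B x) ->
  (lebesgueRn R n.+1).-integrable setT (EFin \o F) /\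
  \int[lebesgueRn R n.+1]_x F x =
    (\int[leb]_a A a) * (\int[lebesgueRn R n]_x B x).
Proof.
move=> Ai Bi FE.
have mA : measurable_fun setT A by apply/measurable_EFinP; exact:
  measurable_int Ai.
have mB : measurable_fun setT B by apply/measurable_EFinP; exact:
  measurable_int Bi.
have mAB : measurable_fun setT (fun z : line * Rn R n => A z.1 * B z.2).
  apply: measurable_funM; first exact: (measurableT_comp mA).
  exact: (measurableT_comp mB).
have mF : measurable_fun setT F.
  rewrite (_ : F = (fun z : line * Rn R n => A z.1 * B z.2) \o @Rn_uncons n).
    exact: (measurableT_comp mAB (@measurable_Rn_uncons n)).
  by apply/funext => x /=; rewrite -{1}(Rn_unconsK x) FE.
have inner a : (\int[lebesgueRn R n]_x (A a * B x)%:E =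
    (A a)%:E * (\int[lebesgueRn R n]_x B x)%:E)%E.
  under eq_integral do rewrite EFinM.
  rewrite integralZl//; congr (_ * _)%E.
  by rewrite fineK//; exact: integrable_fin_num.
have Pi : (leb \x lebesgueRn R n)%E.-integrable setT
    ((EFin \o F) \o @Rn_cons R n).
  rewrite (_ : _ \o _ = EFin \o (fun z : line * Rn R n => A z.1 * B z.2)); last
    first.
    by apply/funext => -[a x]; rewrite /comp FE.
  apply/integrable12ltyP; first exact/measurable_EFinP.
  have nB := integrable_fin_num measurableT (integrable_abse Bi).
  have nA := integrable_fin_num measurableT (integrable_abse Ai).
  rewrite (_ : (\int[leb]_a _)%E = (\int[leb]_a (`|(A a)%:E| * \int[lebesgueRn
    R n]_x `|(B x)%:E|))%E); last first.
    apply: eq_integral => a _; rewrite -ge0_integralZl//.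
    - by apply: eq_integral => x _; rewrite /= normrM EFinM.
    - by apply: measurableT_comp => //; exact/measurable_EFinP.
  rewrite ge0_integralZr//.
  - by rewrite -(fineK nA) -(fineK nB) -EFinM ltry.
  - by apply: measurableT_comp => //; exact/measurable_EFinP.
  - exact: integral_ge0.
have mF' : measurable_fun setT (EFin \o F) by exact/measurable_EFinP.
have [i e] := integrable_Rn_cons Pi mF'.
split => //; rewrite {1}/Rintegral e.
rewrite (_ : (\int[leb]_a _)%E = (\int[leb]_a ((A a)%:E * (\int[lebesgueRn R
  n]_x B x)%:E))%E).
  rewrite integralZr// fineM//; exact: integrable_fin_num.
by apply: eq_integral => a _; rewrite -inner; apply: eq_integral => x _;
  rewrite /= FE.
Qed.

Definition prodRn n (g : R -> R) (x : Rn R n) : R := \prod_(i < n) g (tnth x i).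

Lemma tnth_Rn_consS n (a : line) (x : Rn R n) i :
  tnth (Rn_cons (a, x)) (lift ord0 i) = tnth x i.
Proof. by rewrite !(tnth_nth 0). Qed.

Lemma prodRn_cons n g a (x : Rn R n) : prodRn g (Rn_cons (a, x)) = g a * prodRn
  g x.
Proof.
rewrite /prodRn big_ord_recl; congr (_ * _).
by apply: eq_bigr => i _; rewrite tnth_Rn_consS.
Qed.

Lemma dot_cons n a b (x y : Rn R n) :
  dot (Rn_cons (a, x)) (Rn_cons (b, y)) = a * b + dot x y.
Proof.
rewrite /dot big_ord_recl; congr (_ + _).
by apply: eq_bigr => i _; rewrite !tnth_Rn_consS.
Qed.

Lemma Rintegral_Rn0 (F : Rn R 0 -> R) :
  (lebesgueRn R 0).-integrable setT (EFin \o F) /\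
  \int[lebesgueRn R 0]_x F x = F [tuple].
Proof.
have mF : measurable_fun setT F.
  rewrite (_ : F = cst (F [tuple])); first exact: measurable_cst.
  by apply/funext => x; rewrite tuple0.
split.
  apply/integrableP; split; first exact/measurable_EFinP.
  rewrite integral_dirac//; last by apply: measurableT_comp => //;
    exact/measurable_EFinP.
  by rewrite diracE in_setT mul1e ltry.
rewrite /Rintegral integral_dirac//; last exact/measurable_EFinP.
by rewrite diracE in_setT mul1e.
Qed.

Lemma Rintegral_prodRn n (g : line -> R) : leb.-integrable setT (EFin \o g) ->
  (lebesgueRn R n).-integrable setT (EFin \o @prodRn n g) /\
  \int[lebesgueRn R n]_x prodRn g x = (\int[leb]_a g a) ^+ n.
Proof.
move=> gi; elim: n => [|n [i e]].
  by have [i ->] := Rintegral_Rn0 (@prodRn 0 g); rewrite /prodRn big_ord0 expr0.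
have [i' ->] := Rintegral_Rn_cons_mul gi i (@prodRn_cons n g).
by rewrite e exprS.
Qed.

Lemma prodRn_ge0 n g (x : Rn R n) : (forall a, 0 <= g a) -> 0 <= prodRn g x.
Proof. by move=> g0; apply: prodr_ge0. Qed.

Lemma prodRn_le1 n g (x : Rn R n) : (forall a, 0 <= g a) -> (forall a, g a <=
  1) ->
  prodRn g x <= 1.
Proof. move=> g0 g1; apply: (@le_trans _ _ (\prod_(i < n) 1)); last by rewrite
  big1.
by apply: ler_prod => i _; rewrite g0 g1.
Qed.

Lemma measurable_prodRn n (g : line -> R) : measurable_fun setT g ->
  measurable_fun setT (@prodRn n g).
Proof.
move=> mg; apply: measurable_prod => i _.
by apply: (measurableT_comp mg); exact: measurable_tnth.
Qed.

Lemma measurable_dot n (xi : Rn R n) : measurable_fun setT (fun x : Rn R n =>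
  dot x xi).
Proof.
apply: measurable_sum => i; apply: measurable_funM => //.
exact: measurable_tnth.
Qed.

(** The addition formulas mix cosine and sine integrals from one dimension to the next, so both are
    carried through the induction; the vanishing one-dimensional sine transform removes all mixed
    terms. *)
Lemma fourier_prodRn n (f : line -> R) : leb.-integrable setT (EFin \o f) ->
  (forall t, sin_transform f t = 0) ->
  forall xi : Rn R n,
  [/\ (lebesgueRn R n).-integrable setT (EFin \o (fun x => prodRn f x * cos
    (dot x xi))),
      (lebesgueRn R n).-integrable setT (EFin \o (fun x => prodRn f x * sin
        (dot x xi))),
      \int[lebesgueRn R n]_x (prodRn f x * cos (dot x xi)) = prodRn
        (cos_transform f) xi &
      \int[lebesgueRn R n]_x (prodRn f x * sin (dot x xi)) = 0].
Proof.
move=> fi s0; elim: n => [|n IH] xi.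
  have [i1 e1] := Rintegral_Rn0 (fun x => prodRn f x * cos (dot x xi)).
  have [i2 e2] := Rintegral_Rn0 (fun x => prodRn f x * sin (dot x xi)).
  split => //.
    by rewrite e1 /prodRn /dot !big_ord0 cos0 mulr1.
  by rewrite e2 /dot !big_ord0 sin0 mulr0.
rewrite -(Rn_unconsK xi); case: (Rn_uncons xi) => b y.
have [ic is_ ec es] := IH y.
have [fc fs] := (integrable_mul_cos b fi, integrable_mul_sin b fi).
pose unF (A : line -> R) (B : Rn R n -> R) (x : Rn R n.+1) := A (Rn_uncons x).1
  * B (Rn_uncons x).2.
have unE A B a (x : Rn R n) : unF A B (Rn_cons (a, x)) = A a * B x.
  by rewrite /unF /=; congr (A _ * B _); apply: val_inj.
have [icc ecc] := Rintegral_Rn_cons_mul fc ic (unE _ _).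
have [icss ess] := Rintegral_Rn_cons_mul fs is_ (unE _ _).
have [ics ecs] := Rintegral_Rn_cons_mul fc is_ (unE _ _).
have [isc esc] := Rintegral_Rn_cons_mul fs ic (unE _ _).
have cE : (fun x => prodRn f x * cos (dot x (Rn_cons (b, y)))) =
  (fun x => unF (fun a => f a * cos (b * a)) (fun x => prodRn f x * cos (dot x
    y)) x -
   unF (fun a => f a * sin (b * a)) (fun x => prodRn f x * sin (dot x y)) x).
  apply/funext => x; rewrite -(Rn_unconsK x); case: (Rn_uncons x) => a z.
  by rewrite !unE prodRn_cons dot_cons cosD (mulrC a b); ring.
have sE : (fun x => prodRn f x * sin (dot x (Rn_cons (b, y)))) =
  (fun x => unF (fun a => f a * sin (b * a)) (fun x => prodRn f x * cos (dot x
    y)) x +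
   unF (fun a => f a * cos (b * a)) (fun x => prodRn f x * sin (dot x y)) x).
  apply/funext => x; rewrite -(Rn_unconsK x); case: (Rn_uncons x) => a z.
  by rewrite !unE prodRn_cons dot_cons sinD (mulrC a b); ring.
rewrite cE sE; split.
- exact: (integrableB measurableT icc icss).
- exact: (integrableD measurableT isc ics).
- rewrite RintegralB// ecc ess ec es mulr0 subr0 prodRn_cons.
  by rewrite -/(cos_transform f b).
- rewrite RintegralD// esc ecs es ec.
  by rewrite -/(sin_transform f b) s0 mul0r mulr0 addr0.
Qed.

End Rn.

(** * Subordination *)

Section subordination.
Context {R : realType}.
Local Notation leb := (@lebesgue_measure R).
Local Notation line := (measurableTypeR R).
Variable al : R.
Hypotheses (al0 : 0 < al) (al1 : al < 1).

(** The measure [s ^ (-1 - al) ds] for [s = expR r], the factor [s] of [ds = s dr] included; [al]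
    stands for [beta / 2]. *)
Definition sub_weight (r : R) : R := expR (- (al * r)).

Lemma sub_weight_ge0 r : 0 <= sub_weight r. Proof. exact: expR_ge0. Qed.

Lemma measurable_sub_weight : measurable_fun setT (sub_weight : line -> R).
Proof.
apply: (measurableT_comp (@measurable_expR R)).
by apply: measurableT_comp => //; exact: mulrl_measurable.
Qed.

(** The common majorant of the integrands of subordination: the cap 1 makes it integrable for large
    times because [0 < al], the slope [l] for small times because [al < 1]. *)
Definition sub_tail (l r : R) : R := Num.min 1 (l * expR r) * sub_weight r.

Lemma sub_tail_ge0 l r : 0 <= l -> 0 <= sub_tail l r.
Proof.
by move=> l0; rewrite mulr_ge0 ?sub_weight_ge0// le_min ler01 mulr_ge0
  ?expR_ge0.
Qed.

Lemma measurable_sub_tail l : measurable_fun setT (sub_tail l : line -> R).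
Proof.
apply: measurable_funM; last exact: measurable_sub_weight.
by apply: measurable_minr => //; apply: measurable_funM.
Qed.

(** The decay is exponential, at rate [al] towards [+oo] and [1 - al] towards [-oo]; [d] is the
    smaller rate, and [exp y >= 1 + y ^ 2 / 2] turns it into the standard majorant. *)
Lemma sub_tail1_le r :
  sub_tail 1 r <= (1 + 2 / (Num.min al (1 - al)) ^+ 2) / (1 + r ^+ 2).
Proof.
set d := Num.min al (1 - al).
have d0 : 0 < d by rewrite lt_min al0 subr_gt0.
have [dal dal1] : d <= al /\ d <= 1 - al by rewrite !ge_min !lexx orbT.
have r0 := normr_ge0 r.
apply: (@le_trans _ _ (expR (- (d * `|r|)))).
  rewrite /sub_tail /sub_weight mul1r.
  have [r0'|r0'] := leP 0 r.
    apply: (@le_trans _ _ (1 * expR (- (al * r)))).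
      by rewrite ler_wpM2r ?expR_ge0// ge_min lexx.
    by rewrite mul1r ler_expR lerN2 ger0_norm//; apply: ler_wpM2r.
  apply: (@le_trans _ _ (expR r * expR (- (al * r)))).
    by rewrite ler_wpM2r ?expR_ge0// ge_min lexx orbT.
  by rewrite -expRD ler_expR ltr0_norm//; nra.
have e := expR_ge_sqr (mulr_ge0 (ltW d0) r0).
rewrite ler_pdivlMr; last by rewrite ltr_pwDl// sqr_ge0.
rewrite expRN ler_pdivrMl ?expR_gt0//.
rewrite exprMn real_normK ?num_real// in e.
apply: (@le_trans _ _ ((1 + d ^+ 2 * r ^+ 2 / 2) * (1 + 2 / d ^+ 2))).
  have -> : (1 + d ^+ 2 * r ^+ 2 / 2) * (1 + 2 / d ^+ 2) =
    1 + r ^+ 2 + d ^+ 2 * r ^+ 2 / 2 + 2 / d ^+ 2 by field; rewrite gt_eqF.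
  rewrite -addrA lerDl addr_ge0//; first by rewrite divr_ge0// mulr_ge0
    ?sqr_ge0.
  by rewrite divr_ge0// sqr_ge0.
by rewrite ler_wpM2r// addr_ge0// divr_ge0// sqr_ge0.
Qed.

Lemma integrable_sub_tail1 : leb.-integrable setT (EFin \o sub_tail 1).
Proof.
apply: integrable_le_oneDsqrV; first exact: measurable_sub_tail.
by move=> r; rewrite ger0_norm ?sub_tail_ge0//; exact: sub_tail1_le.
Qed.

(* Translating r by ln l turns expR r into l expR r. *)
Lemma sub_shift (g : R -> R) l : 0 < l ->
  measurable_fun setT (g : line -> R) ->
  leb.-integrable setT (EFin \o (fun r : line => g (expR r) * sub_weight r)) ->
  leb.-integrable setT (EFin \o (fun r : line => g (l * expR r) * sub_weight
    r)) /\
  \int[leb]_r (g (l * expR r) * sub_weight r) =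
    l `^ al * \int[leb]_r (g (expR r) * sub_weight r).
Proof.
move=> l0 mg gi.
have mG : measurable_fun setT (fun r : line => g (expR r) * sub_weight r).
  by apply/measurable_EFinP; exact: measurable_int gi.
have e : (fun r => g (l * expR r) * sub_weight r) =
  (fun r => l `^ al * (g (expR (r + ln l)) * sub_weight (r + ln l))).
  apply/funext => r; rewrite expRD lnK ?posrE// (mulrC (expR r)).
  rewrite /sub_weight mulrDr opprD expRD /powR gt_eqF// mulrCA; congr (_ * _).
  by rewrite mulrCA -expRD addrN expR0 mulr1.
have i := integrable_shift (ln l) mG gi.
rewrite e; split; first exact: (integrableZl measurableT (l `^ al) i).
by rewrite RintegralZl// (Rintegral_shift (ln l) mG gi).
Qed.

Lemma sub_tail_integral l : 0 < l ->
  leb.-integrable setT (EFin \o sub_tail l) /\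
  \int[leb]_r sub_tail l r = l `^ al * \int[leb]_r sub_tail 1 r.
Proof.
move=> l0.
have e1 : sub_tail 1 = fun r => Num.min 1 (expR r) * sub_weight r.
  by apply/funext => r; rewrite /sub_tail mul1r.
have := @sub_shift (fun y => Num.min 1 y) l l0.
rewrite -e1; apply.
  exact: measurable_minr.
exact: integrable_sub_tail1.
Qed.

(** The normalizing constant of subordination, equal to [Gamma (1 - al) / al]. *)
Definition sub_const : R := \int[leb]_r ((1 - expR (- expR r)) * sub_weight r).

Lemma one_sub_exp_bounds (y : R) : 0 <= y -> 0 <= 1 - expR (- y) <= Num.min 1 y.
Proof.
move=> y0; rewrite subr_ge0 expR_le1 oppr_le0 y0 /= le_min.
rewrite gerBl expR_ge0 /= lerBlDr -lerBlDl.
by have := expR_ge1Dx (- y).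
Qed.

Lemma integrable_sub_const : leb.-integrable setT
  (EFin \o (fun r : line => (1 - expR (- expR r)) * sub_weight r)).
Proof.
apply: le_integrable_EFin integrable_sub_tail1.
  apply: measurable_funM; last exact: measurable_sub_weight.
  apply: measurable_funB => //; apply: (measurableT_comp (@measurable_expR R)).
  by apply: measurableT_comp => //; exact: measurable_expR.
move=> r; have /andP[h1 h2] := one_sub_exp_bounds (expR_ge0 r).
rewrite ger0_norm ?mulr_ge0 ?sub_weight_ge0//.
by rewrite /sub_tail mul1r ler_wpM2r ?sub_weight_ge0.
Qed.

Lemma sub_const_gt0 : 0 < sub_const.
Proof.
have h0 r : 0 <= (1 - expR (- expR r)) * sub_weight r.
  have /andP[h1 _] := one_sub_exp_bounds (expR_ge0 r).
  by rewrite mulr_ge0 ?sub_weight_ge0.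
rewrite lt_neqAle Rintegral_ge0// andbT eq_sym; apply/eqP => c0.
(* On [[0, 1]] the first factor is smallest at [r = 0] and the weight at [r = 1]; the product of
   these two values bounds the integrand from below. *)
pose m : R := (1 - expR (- 1)) * expR (- al).
have m0 : 0 < m by rewrite mulr_gt0 ?expR_gt0// subr_gt0 expR_lt1 oppr_lt0.
have : (\int[leb]_(r in `[0%R, 1%R]) m%:E <= 0)%E.
  have <- : (\int[leb]_r ((1 - expR (- expR r)) * sub_weight r)%:E = 0)%E.
    rewrite -(fineK (integrable_fin_num measurableT integrable_sub_const)).
    by rewrite -[fine _]/sub_const c0.
  rewrite integral_mkcond; apply: ge0_le_integral => //.
  - by move=> r _; rewrite patchE; case: ifP => // _; rewrite lee_fin ltW.
  - by apply/(measurable_restrictT _ _).1 => //.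
  - exact: (measurable_int _ integrable_sub_const).
  - move=> r _; rewrite patchE; case: ifPn => [|_]; last by rewrite lee_fin.
    rewrite inE/= in_itv/= => /andP[r0 r1]; rewrite lee_fin /m.
    have m1 : 0 <= 1 - expR (- 1) :> R by rewrite subr_ge0 expR_le1 lerNl oppr0.
    apply: ler_pM; [exact: m1|exact: expR_ge0| |].
    + by rewrite lerB// ler_expR lerN2 -expR0 ler_expR.
    + by rewrite ler_expR lerN2 ler_piMr// ltW.
rewrite integral_cst//= lebesgue_measure_itv/= lte_fin ltr01 sube0 mule1.
by rewrite lee_fin leNgt m0.
Qed.

(** The scalar form of subordination, to be applied with [l = |xi| ^ 2]. The frequency 0 is treated
    apart because the translation by [ln l] makes sense only for [l > 0]. *)
Lemma sub_const_scale (l : R) : 0 <= l ->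
  leb.-integrable setT
    (EFin \o (fun r : line => (1 - expR (- (expR r * l))) * sub_weight r)) /\
  \int[leb]_r ((1 - expR (- (expR r * l))) * sub_weight r) = l `^ al *
    sub_const.
Proof.
rewrite le_eqVlt => /predU1P[<-|l0].
  rewrite powR0 ?gt_eqF// mul0r.
  have e : (fun r : line => (1 - expR (- (expR r * 0))) * sub_weight r) = fun=>
    0.
    by apply/funext => r; rewrite mulr0 oppr0 expR0 subrr mul0r.
  by rewrite e; split; [exact: integrable0|rewrite Rintegral_cst// mul0r].
have mg : measurable_fun setT ((fun y => 1 - expR (- y)) : line -> R).
  apply: measurable_funB => //; apply: (measurableT_comp (@measurable_expR R)).
  exact: oppr_measurable.
have := sub_shift l0 mg integrable_sub_const.
rewrite (_ : (fun r => (1 - expR (- (l * expR r))) * sub_weight r) =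
  (fun r => (1 - expR (- (expR r * l))) * sub_weight r)) //.
by apply/funext => r; rewrite (mulrC l).
Qed.

End subordination.

(** * Fractional Laplacian of the cutoff *)

Section frac_cutoff.
Context {R : realType}.
Local Notation leb := (@lebesgue_measure R).
Local Notation line := (measurableTypeR R).

(** Bernoulli's inequality [(1 - c) ^ n >= 1 - n c], with weights. Once [1 - n c] is nonpositive the
    claim is trivial; before that all factors are nonnegative and the bounds can be multiplied. *)
Lemma prodRn_bernoulli n (c : R) (g h : R -> R) (x : Rn R n) : 0 <= c ->
  (forall y, 0 <= g y) -> (forall y, 0 <= h y) ->
  (forall y, (1 - c) * g y <= h y) ->
  (1 - n%:R * c) * prodRn g x <= prodRn h x.
Proof.
move=> c0 g0 h0 gh; elim: n x => [|n IH] x.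
  by rewrite /prodRn !big_ord0 mul0r subr0 mulr1.
rewrite -(Rn_unconsK x); case: (Rn_uncons x) => a y; rewrite !prodRn_cons.
have [n1|n1] := leP (1 - n.+1%:R * c) 0.
  apply: (@le_trans _ _ 0); last by rewrite mulr_ge0 ?prodRn_ge0.
  by rewrite mulr_le0_ge0// mulr_ge0 ?prodRn_ge0.
have nc : 0 <= n%:R * c by rewrite mulr_ge0.
have e : n.+1%:R * c = n%:R * c + c by rewrite -natr1 mulrDl mul1r.
rewrite e in n1 *.
apply: (@le_trans _ _ (((1 - c) * g a) * ((1 - n%:R * c) * prodRn g y))).
  rewrite mulrACA ler_wpM2r ?mulr_ge0 ?prodRn_ge0//; nra.
apply: ler_pM => //.
  by rewrite mulr_ge0//; lra.
by rewrite mulr_ge0 ?prodRn_ge0//; lra.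
Qed.

(** The products are compared by changing one factor at a time, the others lying in [[0, 1]]. *)
Lemma prodRn_dist n (d : R) (g h : R -> R) (x : Rn R n) :
  (forall y, 0 <= g y) -> (forall y, g y <= 1) ->
  (forall y, 0 <= h y) -> (forall y, h y <= 1) ->
  (forall y, `|g y - h y| <= d) ->
  `|prodRn g x - prodRn h x| <= n%:R * d.
Proof.
move=> g0 g1 h0 h1 gh; elim: n x => [|n IH] x.
  by rewrite /prodRn !big_ord0 subrr normr0 mul0r.
rewrite -(Rn_unconsK x); case: (Rn_uncons x) => a y; rewrite !prodRn_cons.
have -> : g a * prodRn g y - h a * prodRn h y =
  g a * (prodRn g y - prodRn h y) + (g a - h a) * prodRn h y by ring.
have -> : n.+1%:R * d = n%:R * d + d by rewrite -(natr1 n) mulrDl mul1r.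
apply: le_trans (ler_normD _ _) _; rewrite !normrM; apply: lerD.
  by rewrite (ger0_norm (g0 a)) (le_trans _ (IH y))// ler_piMl.
rewrite (ger0_norm (prodRn_ge0 _ h0)) (le_trans _ (gh a))// ler_piMr//.
exact: prodRn_le1.
Qed.

Variables (n : nat) (al a : R).
Hypotheses (al0 : 0 < al) (al1 : al < 1) (a0 : 0 < a).
Local Notation mu := (lebesgueRn R n).

Definition cutoffRn : Rn R n -> R := prodRn (cutoff a).
Definition heat_cutoffRn (r : R) : Rn R n -> R := prodRn (heat (cutoff a) r).

(* An upper bound, up to the factor a ^ 2, for n times the constant of
   heat_dist; the term 1 only makes it positive. *)
Definition frac_const : R := n%:R * (64 * gauss_moment2) + 1.
Definition frac_rate : R := a ^+ 2 * frac_const.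

Lemma frac_const_gt0 : 0 < frac_const.
Proof.
by rewrite ltr_wpDl// mulr_ge0// mulr_ge0// gauss_moment2_ge0.
Qed.

Lemma frac_rate_gt0 : 0 < frac_rate.
Proof. by rewrite mulr_gt0 ?exprn_gt0 ?frac_const_gt0. Qed.

Let D : R := 32 * a ^+ 2.
Let mf := measurable_cutoff (R := R) a.
Let f0 := cutoff_ge0 (R := R) a.
Let f1 := cutoff_le1 (R := R) a.
Let fi := integrable_cutoff a0.
Let h0 := heat_ge0 f0.
Let h1 := heat_le1 mf f0 f1.
Let D0 : 0 <= D. Proof. by rewrite mulr_ge0 ?sqr_ge0. Qed.

Let KE r : n%:R * (2 * D * gauss_moment2 * expR r) <= frac_rate * expR r.
Proof.
rewrite mulrA ler_wpM2r ?expR_ge0// /frac_rate /frac_const /D.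
by rewrite -subr_ge0 (_ : _ - _ = a ^+ 2) ?sqr_ge0//; ring.
Qed.

Lemma cutoffRn_ge0 x : 0 <= cutoffRn x. Proof. exact: prodRn_ge0. Qed.
Lemma cutoffRn_le1 x : cutoffRn x <= 1. Proof. exact: prodRn_le1. Qed.
Lemma heat_cutoffRn_ge0 r x : 0 <= heat_cutoffRn r x.
Proof. by apply: prodRn_ge0; exact: h0. Qed.
Lemma heat_cutoffRn_le1 r x : heat_cutoffRn r x <= 1.
Proof. by apply: prodRn_le1; [exact: h0|exact: h1]. Qed.

Lemma heat_cutoffRn_ge r x : (1 - frac_rate * expR r) * cutoffRn x <=
  heat_cutoffRn r x.
Proof.
have c0 : 0 <= 2 * D * gauss_moment2 * expR r.
  apply: mulr_ge0; last exact: expR_ge0.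
  by apply: mulr_ge0; [exact: mulr_ge0|exact: gauss_moment2_ge0].
apply: le_trans (prodRn_bernoulli x c0 f0 (h0 r) _).
  by rewrite ler_wpM2r ?cutoffRn_ge0// lerD2l lerN2.
by move=> y; exact: (heat_ge mf f0 f1 (cutoff_second_diff_ge a)).
Qed.

Lemma heat_cutoffRn_dist r x : `|cutoffRn x - heat_cutoffRn r x| <= Num.min 1
  (frac_rate * expR r).
Proof.
rewrite le_min; apply/andP; split.
  have := cutoffRn_ge0 x; have := cutoffRn_le1 x.
  have := heat_cutoffRn_ge0 r x; have := heat_cutoffRn_le1 r x.
  by move=> *; rewrite ler_norml; lra.
apply: le_trans (KE r).
apply: prodRn_dist => //; by move=> y; exact: (heat_dist mf f0 f1
  (cutoff_second_diff_norm a)).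
Qed.

(** The cap 1 expresses that the heat flow stays nonnegative, the other bound is [heat_cutoffRn_ge].
    The factor [cutoffRn x] on the right is what the final absorption relies on;
    [heat_cutoffRn_dist] does not provide it. *)
Lemma heat_cutoffRn_decr r x :
  cutoffRn x - heat_cutoffRn r x <= Num.min 1 (frac_rate * expR r) * cutoffRn x.
Proof.
have := heat_cutoffRn_ge r x; have := heat_cutoffRn_ge0 r x; have :=
  cutoffRn_ge0 x.
by case: (leP 1 (frac_rate * expR r)) => *; lra.
Qed.

Lemma integrable_cutoffRn : mu.-integrable setT (EFin \o cutoffRn).
Proof. exact: (Rintegral_prodRn n fi).1. Qed.

Lemma integrable_heat_cutoffRn r : mu.-integrable setT (EFin \o heat_cutoffRn
  r).
Proof. exact: (Rintegral_prodRn n (integrable_heat mf f0 f1 r fi)).1. Qed.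

Lemma Rintegral_heat_cutoffRn r : \int[mu]_x heat_cutoffRn r x = \int[mu]_x
  cutoffRn x.
Proof.
rewrite (Rintegral_prodRn n (integrable_heat mf f0 f1 r fi)).2.
by rewrite (Rintegral_prodRn n fi).2 (Rintegral_heatE mf f0 f1 r fi).
Qed.

(* The heat flow preserves mass, so the L^1 norm of cutoffRn - heat_cutoffRn r is
   twice the integral of its positive part. *)
Lemma heat_cutoffRn_L1 r : \int[mu]_x `|cutoffRn x - heat_cutoffRn r x| <=
  2 * Num.min 1 (frac_rate * expR r) * \int[mu]_x cutoffRn x.
Proof.
have i0 := integrable_cutoffRn; have ir := integrable_heat_cutoffRn r.
set m := Num.min _ _.
have idiff : mu.-integrable setT (EFin \o (fun x => heat_cutoffRn r x -
  cutoffRn x)).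
  exact: (integrableB measurableT ir i0).
have idiff' : mu.-integrable setT (EFin \o (fun x => cutoffRn x - heat_cutoffRn
  r x)).
  exact: (integrableB measurableT i0 ir).
have iZ : mu.-integrable setT (EFin \o (fun x => 2 * m * cutoffRn x)).
  exact: (integrableZl measurableT _ i0).
have -> : 2 * m * \int[mu]_x cutoffRn x =
  \int[mu]_x (heat_cutoffRn r x - cutoffRn x + 2 * m * cutoffRn x).
  rewrite RintegralD// RintegralB// Rintegral_heat_cutoffRn subrr add0r.
  by rewrite RintegralZl.
apply: le_Rintegral => //.
- exact: (integrable_abse idiff').
- exact: (integrableD measurableT idiff iZ).
- move=> x _; rewrite -/m.
  have := heat_cutoffRn_decr r x; rewrite -/m => h.
  have m0 : 0 <= m * cutoffRn x.
    by rewrite mulr_ge0 ?cutoffRn_ge0// /m le_min ler01 mulr_ge0 ?expR_ge0//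
      ltW// frac_rate_gt0.
  by rewrite ler_norml; apply/andP; split; lra.
Qed.

Lemma measurable_heat_cutoffRn : measurable_fun setT
  (fun z : Rn R n * line => heat_cutoffRn z.2 z.1).
Proof.
apply: measurable_prod => i _.
have m : measurable_fun setT (fun z : Rn R n * line => (z.2, tnth z.1 i)).
  apply: measurable_fun_pair => //.
  exact: (measurableT_comp (measurable_tnth _)).
exact: (measurableT_comp (measurable_heat mf f0) m).
Qed.

Lemma measurable_cutoffRn : measurable_fun setT cutoffRn.
Proof. exact: measurable_prodRn. Qed.

Definition frac_cutoff (x : Rn R n) : R :=
  (sub_const al)^-1 *
  \int[leb]_r ((cutoffRn x - heat_cutoffRn r x) * sub_weight al r).

Let Phi (k : Rn R n -> R) (z : Rn R n * line) : R :=
  (cutoffRn z.1 - heat_cutoffRn z.2 z.1) * sub_weight al z.2 * k z.1.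

Let mPhi k : measurable_fun setT k -> measurable_fun setT (Phi k).
Proof.
move=> mk; apply: measurable_funM; last exact: (measurableT_comp mk).
apply: measurable_funM; last exact: (measurableT_comp (measurable_sub_weight
  al)).
apply: measurable_funB; last exact: measurable_heat_cutoffRn.
exact: (measurableT_comp measurable_cutoffRn).
Qed.

Let Phi1_le x r : `|(cutoffRn x - heat_cutoffRn r x) * sub_weight al r| <=
  sub_tail al frac_rate r.
Proof.
rewrite normrM (ger0_norm (sub_weight_ge0 _ _)) ler_wpM2r ?sub_weight_ge0//.
exact: heat_cutoffRn_dist.
Qed.

Let Phi1_int x : leb.-integrable setT
  (EFin \o (fun r : line => (cutoffRn x - heat_cutoffRn r x) * sub_weight al
    r)).
Proof.
have [i _] := sub_tail_integral al0 al1 frac_rate_gt0.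
have m : measurable_fun setT (fun r : line => (cutoffRn x - heat_cutoffRn r x)
  * sub_weight al r).
  apply: measurable_funM; last exact: measurable_sub_weight.
  apply: measurable_funB => //.
  exact: (measurableT_comp measurable_heat_cutoffRn (pair1_measurable x)).
exact: (le_integrable_EFin m (Phi1_le x) i).
Qed.

Lemma frac_cutoff_norm x :
  `|frac_cutoff x| <= (sub_const al)^-1 * \int[leb]_r sub_tail al frac_rate r.
Proof.
have c0 := sub_const_gt0 al0 al1.
rewrite normrM ger0_norm ?invr_ge0 ?(ltW c0)// ler_wpM2l ?invr_ge0 ?(ltW c0)//.
apply: (le_trans (le_normr_Rintegral measurableT (Phi1_int x))).
apply: le_Rintegral => //; first exact: (integrable_abse (Phi1_int x)).
exact: (sub_tail_integral al0 al1 frac_rate_gt0).1.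
Qed.

Definition frac_cutoff_const : R :=
  (sub_const al)^-1 * (frac_const `^ al * \int[leb]_r sub_tail al 1 r).

Lemma frac_cutoff_const_ge0 : 0 <= frac_cutoff_const.
Proof.
have c0 := sub_const_gt0 al0 al1.
rewrite mulr_ge0 ?invr_ge0 ?(ltW c0)// mulr_ge0 ?powR_ge0// Rintegral_ge0// =>
  r _.
exact: sub_tail_ge0.
Qed.

(** [heat_cutoffRn_decr] is integrated in [r]. The rate [a ^ 2 * frac_const] enters through its
    power [al], which produces [a ^ beta]. *)
Lemma frac_cutoff_le x : frac_cutoff x <= frac_cutoff_const * a `^ (2 * al) *
  cutoffRn x.
Proof.
have c0 := sub_const_gt0 al0 al1.
have [i e] := sub_tail_integral al0 al1 frac_rate_gt0.
rewrite /frac_cutoff /frac_cutoff_const -!mulrA ler_wpM2l ?invr_ge0 ?(ltW c0)//.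
apply: (@le_trans _ _ (\int[leb]_r (cutoffRn x * sub_tail al frac_rate r))).
  have iZ : leb.-integrable setT (EFin \o (fun r : line => cutoffRn x *
    sub_tail al frac_rate r)).
    exact: (integrableZl measurableT (cutoffRn x) i).
  apply: (le_Rintegral measurableT (Phi1_int x) iZ) => r _.
  rewrite /sub_tail mulrA ler_wpM2r ?sub_weight_ge0// mulrC.
  exact: heat_cutoffRn_decr.
rewrite RintegralZl// e /frac_rate powRM ?sqr_ge0 ?(ltW frac_const_gt0)//.
rewrite -powR_mulrn ?(ltW a0)// -powRrM.
by rewrite le_eqVlt; apply/orP; left; apply/eqP; ring.
Qed.

(** Fubini in [x] and [r]. The pointwise majorant [sub_tail] is uniform in [x] and does not give
    joint integrability, which comes from the L^1 bound [heat_cutoffRn_L1]. The multiplier [k] will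
    be 1, a cosine or a sine. *)
Lemma Rintegral_frac_cutoff (k : Rn R n -> R) : measurable_fun setT k ->
  (forall x, `|k x| <= 1) ->
  mu.-integrable setT (EFin \o (fun x => frac_cutoff x * k x)) /\
  \int[mu]_x (frac_cutoff x * k x) = (sub_const al)^-1 *
   \int[leb]_r ((\int[mu]_x ((cutoffRn x - heat_cutoffRn r x) * k x)) *
     sub_weight al r).
Proof.
move=> mk k1.
have mP := mPhi mk.
have idiff r : mu.-integrable setT (EFin \o (fun x => cutoffRn x -
  heat_cutoffRn r x)).
  exact: (integrableB measurableT integrable_cutoffRn (integrable_heat_cutoffRn
    r)).
have I0 : 0 <= \int[mu]_x cutoffRn x by apply: Rintegral_ge0 => x _; exact:
  cutoffRn_ge0.
have [it _] := sub_tail_integral al0 al1 frac_rate_gt0.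
have itZ : leb.-integrable setT (EFin \o (fun r : line => 2 * (\int[mu]_x
  cutoffRn x) * sub_tail al frac_rate r)).
  exact: (integrableZl measurableT _ it).
have iP : (mu \x leb)%E.-integrable setT (EFin \o Phi k).
  apply/integrable21ltyP; first exact/measurable_EFinP.
  apply: (@le_lt_trans _ _ (\int[leb]_r (2 * (\int[mu]_x cutoffRn x) * sub_tail
    al frac_rate r)%:E)%E); last first.
    by rewrite -(fineK (integrable_fin_num measurableT itZ)) ltry.
  apply: ge0_le_integral => //.
  - by move=> r _; exact: integral_ge0.
  - apply: (measurable_fun_fubini_tonelli_G (m1 := mu) (abse \o (EFin \o Phi
      k))) => //=.
    by apply: measurableT_comp => //; exact/measurable_EFinP.
  - exact: (measurable_int _ itZ).
  - move=> r _.
    apply: (@le_trans _ _ (\int[mu]_x ((sub_weight al r)%:E * `|(cutoffRn x -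
      heat_cutoffRn r x)%:E|))%E).
      apply: ge0_le_integral => //.
      + apply: measurableT_comp => //; apply/measurable_EFinP.
        exact: (measurableT_comp mP (pair2_measurable r)).
      + apply: measurable_funeM; apply: measurableT_comp => //.
        exact: (measurable_int _ (idiff r)).
      + move=> x _; rewrite /Phi/= lee_fin.
        rewrite normrM normrM (ger0_norm (sub_weight_ge0 _ _)) mulrAC mulrC.
        by rewrite ler_wpM2l ?sub_weight_ge0// ler_piMr.
    rewrite ge0_integralZl//; last 2 first.
      by apply: measurableT_comp => //; exact: (measurable_int _ (idiff r)).
      by rewrite lee_fin sub_weight_ge0.
    rewrite -(fineK (integrable_fin_num measurableT (integrable_abse (idiff
      r)))).
    rewrite -EFinM lee_fin /sub_tail mulrC mulrA ler_wpM2r ?sub_weight_ge0//.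
    by rewrite mulrAC; exact: heat_cutoffRn_L1.
have E x : (\int[leb]_r (EFin \o Phi k) (x, r) =
    ((\int[leb]_r ((cutoffRn x - heat_cutoffRn r x) * sub_weight al r)) * k
      x)%:E)%E.
  have i := integrableZr measurableT (k x) (Phi1_int x).
  rewrite -RintegralZr//; rewrite /Rintegral.
  by rewrite [RHS](fineK (integrable_fin_num measurableT i)).
have F := integrable_fubini_F iP.
rewrite /fubini_F in F.
have FE : (fun x => \int[leb]_r (EFin \o Phi k) (x, r))%E =
    EFin \o (fun x => (\int[leb]_r ((cutoffRn x - heat_cutoffRn r x) *
      sub_weight al r)) * k x).
  by apply/funext => x; rewrite E.
rewrite FE in F.
have -> : (fun x => frac_cutoff x * k x) =
  (fun x => (sub_const al)^-1 * ((\int[leb]_r ((cutoffRn x - heat_cutoffRn r x)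
    * sub_weight al r)) * k x)).
  by apply/funext => x; rewrite /frac_cutoff mulrA.
split; first exact: (integrableZl measurableT _ F).
rewrite RintegralZl//; congr (_ * _).
have := Fubini iP; rewrite /fubini_F /fubini_G FE /Rintegral => ->.
congr fine; apply: eq_integral => r _.
have ik : mu.-integrable setT (EFin \o (fun x => (cutoffRn x - heat_cutoffRn r
  x) * k x)).
  have m : measurable_fun setT (fun x => (cutoffRn x - heat_cutoffRn r x) * k
    x).
    apply: measurable_funM => //; apply/measurable_EFinP.
    exact: (measurable_int _ (idiff r)).
  apply: (le_integrable_EFin m _ (integrable_abse (idiff r))) => x.
  by rewrite normrM ler_piMr.
rewrite [X in _ = X%:E]mulrC EFinM (fineK (integrable_fin_num measurableT ik))
  -integralZl//.
by apply: eq_integral => x _; rewrite /Phi /= -EFinM; congr EFin; ring.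
Qed.

Lemma integrable_frac_cutoff : mu.-integrable setT (EFin \o frac_cutoff).
Proof.
have [|i _] := Rintegral_frac_cutoff (measurable_cst (1 : R)) => [x|].
  by rewrite normr1.
by apply: eq_integrable i => // x _; rewrite /= mulr1.
Qed.

Lemma prodRn_exp (c : R) (xi : Rn R n) :
  prodRn (fun t => expR (- (c * t ^+ 2))) xi = expR (- (c * dot xi xi)).
Proof.
rewrite /prodRn /dot mulr_sumr -sumrN expR_sum.
by apply: eq_bigr => i _; rewrite expr2.
Qed.

(** The heat flow multiplies the transform by [exp (- expR r |xi| ^ 2)]; integrating 1 minus this
    factor against the weight gives the power [al] of [|xi| ^ 2], and the constant cancels. *)
Lemma cos_frac_cutoff (xi : Rn R n) :
  \int[mu]_x (frac_cutoff x * cos (dot x xi)) =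
  (dot xi xi) `^ al * prodRn (cos_transform (cutoff a)) xi.
Proof.
have sz t := sin_transform_cutoff t a0.
have hs r t : sin_transform (heat (cutoff a) r) t = 0.
  by rewrite sin_transform_heat// sz mul0r.
have mc : measurable_fun setT (fun x : Rn R n => cos (dot x xi)).
  apply: measurableT_comp; last exact: measurable_dot.
  by apply: continuous_measurable_fun; exact: continuous_cos.
have [|_ ->] := Rintegral_frac_cutoff mc; first by move=> x; exact: cos_max.
have [ic _ ec _] := fourier_prodRn fi sz xi.
have inner r : \int[mu]_x ((cutoffRn x - heat_cutoffRn r x) * cos (dot x xi)) =
  prodRn (cos_transform (cutoff a)) xi * (1 - expR (- (expR r * dot xi xi))).
  have [ih _ eh _] := fourier_prodRn (integrable_heat mf f0 f1 r fi) (hs r) xi.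
  transitivity (\int[mu]_x (cutoffRn x * cos (dot x xi) - heat_cutoffRn r x *
    cos (dot x xi))).
    by apply: eq_Rintegral => x _; rewrite mulrBl.
  rewrite RintegralB// ec eh mulrBr mulr1; congr (_ - _).
  rewrite -prodRn_exp /prodRn -big_split; apply: eq_bigr => i _.
  by rewrite cos_transform_heat.
under eq_Rintegral do rewrite inner -mulrA.
have d0 : 0 <= dot xi xi.
  by apply: sumr_ge0 => i _; rewrite -expr2 sqr_ge0.
have [i e] := sub_const_scale al0 al1 d0.
rewrite RintegralZl// e; have := sub_const_gt0 al0 al1 => c0.
by field; rewrite gt_eqF.
Qed.

Lemma sin_frac_cutoff (xi : Rn R n) :
  \int[mu]_x (frac_cutoff x * sin (dot x xi)) = 0.
Proof.
have sz t := sin_transform_cutoff t a0.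
have hs r t : sin_transform (heat (cutoff a) r) t = 0.
  by rewrite sin_transform_heat// sz mul0r.
have mc : measurable_fun setT (fun x : Rn R n => sin (dot x xi)).
  apply: measurableT_comp; last exact: measurable_dot.
  by apply: continuous_measurable_fun; exact: continuous_sin.
have [|_ ->] := Rintegral_frac_cutoff mc; first by move=> x; exact: sin_max.
have [_ ic _ ec] := fourier_prodRn fi sz xi.
have inner r : \int[mu]_x ((cutoffRn x - heat_cutoffRn r x) * sin (dot x xi)) =
  0.
  have [_ ih _ eh] := fourier_prodRn (integrable_heat mf f0 f1 r fi) (hs r) xi.
  transitivity (\int[mu]_x (cutoffRn x * sin (dot x xi) - heat_cutoffRn r x *
    sin (dot x xi))).
    by apply: eq_Rintegral => x _; rewrite mulrBl.
  by rewrite RintegralB// ec eh subrr.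
under eq_Rintegral do rewrite inner mul0r.
by rewrite Rintegral_cst// mul0r mulr0.
Qed.

End frac_cutoff.

(** * Square integrability and the Fourier multiplier *)

Section fractional_laplacian_cutoff.
Context {R : realType}.
Local Notation leb := (@lebesgue_measure R).
Local Notation line := (measurableTypeR R).

Lemma Lfun2_of_sqr d (T : measurableType d) (mu : {measure set T -> \bar R})
    (f : T -> R) : measurable_fun setT f ->
  mu.-integrable setT (EFin \o (fun x => f x ^+ 2)) -> f \in Lfun mu 2%:E.
Proof.
move=> mf fi; rewrite inE; apply/andP; split; rewrite inE//=.
rewrite /finite_norm unlock /=; apply: poweR_lty.
rewrite (_ : (\int[mu]_x _)%E = (\int[mu]_x (f x ^+ 2)%:E)%E).
  by rewrite -(fineK (integrable_fin_num measurableT fi)) ltry.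
apply: eq_integral => x _.
by rewrite /= powR_mulrn// real_normK// num_real.
Qed.

Lemma Lfun2_bounded d (T : measurableType d) (mu : {measure set T -> \bar R})
    (C : R) (f : T -> R) : mu.-integrable setT (EFin \o f) ->
  (forall x, `|f x| <= C) -> f \in Lfun mu 2%:E.
Proof.
move=> fi fC.
have mf : measurable_fun setT f by apply/measurable_EFinP; exact:
  measurable_int fi.
apply: Lfun2_of_sqr => //.
have iC : mu.-integrable setT (EFin \o (fun x => C * `|f x|)).
  exact: (integrableZl measurableT C (integrable_abse fi)).
apply: (le_integrable_EFin _ _ iC); first exact: measurable_funX.
by move=> x; rewrite normrX expr2 ler_wpM2r.
Qed.

(** Adding 1 to the cosine makes the integrand nonnegative, so Tonelli's theorem gives measurability
    in [t]; the integral of [g] is subtracted afterwards. *)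
Lemma measurable_cos_transform (g : line -> R) : (forall x, 0 <= g x) ->
  leb.-integrable setT (EFin \o g) ->
  measurable_fun setT (cos_transform g : line -> R).
Proof.
move=> g0 gi.
have mg : measurable_fun setT g by apply/measurable_EFinP; exact:
  measurable_int gi.
pose G (z : line * line) := g z.2 * (1 + cos (z.1 * z.2)).
have mG : measurable_fun setT G.
  apply: measurable_funM; first exact: (measurableT_comp mg).
  apply: measurable_funD => //.
  have mc : measurable_fun setT (cos : line -> R).
    by apply: continuous_measurable_fun; exact: continuous_cos.
  by apply: (measurableT_comp mc); exact: measurable_funM.
have G0 z : (0 <= (EFin \o G) z)%E.
  rewrite lee_fin mulr_ge0//; have := cos_geN1 (z.1 * z.2); lra.
have mG' : measurable_fun setT (EFin \o G) by exact/measurable_EFinP.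
have := measurable_fun_fubini_tonelli_F (m2 := leb) (EFin \o G) mG' G0.
rewrite /fubini_F => m.
have e : (cos_transform g : line -> R) =
    (fun t => fine (\int[leb]_x (EFin \o G) (t, x))%E - \int[leb]_x g x).
  apply/funext => t; rewrite -[fine _]/(\int[leb]_x G (t, x)).
  transitivity (\int[leb]_x (g x + g x * cos (t * x)) - \int[leb]_x g x).
    rewrite RintegralD//; first by rewrite addrAC subrr add0r.
    exact: integrable_mul_cos.
  by congr (_ - _); apply: eq_Rintegral => x _; rewrite /G/= mulrDr mulr1.
rewrite e; apply: measurable_funB => //.
exact: (measurableT_comp (@fine_measurable R _ measurableT) m).
Qed.

(** For [v] in both L^1 and L^2 the constant sequence [v] is an admissible approximation, and the
    vanishing sine integrals make the transform real. *)
Lemma fourier_real n (v g : Rn R n -> R) :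
  (lebesgueRn R n).-integrable setT (EFin \o v) -> v \in Lfun (lebesgueRn R n)
    2%:E ->
  g \in Lfun (lebesgueRn R n) 2%:E ->
  (forall xi, \int[lebesgueRn R n]_x (v x * cos (dot x xi)) = g xi) ->
  (forall xi, \int[lebesgueRn R n]_x (v x * sin (dot x xi)) = 0) ->
  fourier (fun x => (v x)%:C%C) (fun xi => (g xi)%:C%C).
Proof.
move=> vi v2 g2 vc vs.
have v1 : v \in Lfun (lebesgueRn R n) 1%:E by exact/Lfun1_integrable.
have z1 : (fun=> 0 : R) \in Lfun (lebesgueRn R n) 1%:E.
  by apply/Lfun1_integrable; exact: integrable0.
have z2 : (fun=> 0 : R) \in Lfun (lebesgueRn R n) 2%:E.
  apply: (Lfun2_bounded (C := 0)); first exact: integrable0.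
  by move=> x; rewrite normr0.
have F : fourier_integral (fun x => (v x)%:C%C) = (fun xi => (g xi)%:C%C).
  apply/funext => xi; rewrite /fourier_integral /integralC /expi.
  congr Complex.
    rewrite -vc; apply: eq_Rintegral => x _.
    by rewrite /= mul0r subr0 cosN.
  transitivity (\int[lebesgueRn R n]_x ((-1) * (v x * sin (dot x xi)))).
    by apply: eq_Rintegral => x _; rewrite /= mul0r addr0 sinN mulrN mulN1r.
  have is_ : (lebesgueRn R n).-integrable setT (EFin \o (fun x => v x * sin
    (dot x xi))).
    have m : measurable_fun setT (fun x => v x * sin (dot x xi)).
      apply: measurable_funM; first by apply/measurable_EFinP; exact:
        measurable_int vi.
      apply: measurableT_comp; last exact: measurable_dot.
      by apply: continuous_measurable_fun; exact: continuous_sin.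
    apply: (le_integrable_EFin m _ (integrable_abse vi)) => x.
    by rewrite normrM ler_piMr// sin_max.
  by rewrite RintegralZl// vs mulr0.
have N0 (h : Rn R n -> R[i]) : cvg_L2C (fun=> h) h.
  rewrite /cvg_L2C.
  have -> : (EFin \o (fun x => ComplexField.Normc.normc (h x - h x))) = cst 0%E.
    by apply/funext => x; rewrite /= subrr ComplexField.Normc.normc0.
  by rewrite Lnorm0//; exact: cvg_cst.
split.
- by split.
- by split.
- exists (fun=> (fun x => (v x)%:C%C)); split.
  + by move=> _; split; split.
  + exact: N0.
  + by rewrite F; exact: N0.
Qed.

Variables (n : nat) (al a : R).
Hypotheses (al0 : 0 < al) (al1 : al < 1) (a0 : 0 < a).
Local Notation mu := (lebesgueRn R n).

Lemma dot_ge0 (x : Rn R n) : 0 <= dot x x.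
Proof. by apply: sumr_ge0 => i _; rewrite -expr2 sqr_ge0. Qed.

Lemma enorm_powR (x : Rn R n) : enorm x `^ (2 * al) = dot x x `^ al.
Proof.
rewrite /enorm -powR12_sqrt ?dot_ge0// -powRrM; congr (_ `^ _).
by field.
Qed.

(** The factor 8 is [2 ^ 3]: [1 + t ^ 2] is at most [2 t ^ 2] when [|t| >= 1], where the decay
    estimate applies, and at most 2 otherwise, where the L^1 norm bounds the transform. *)
Lemma cos_transform_cutoff_le : exists2 B, 0 <= B & forall t,
  (1 + t ^+ 2) ^+ 3 * cos_transform (cutoff a) t ^+ 2 <= B.
Proof.
have [C HC] := cos_transform_cutoff_decay a0.
pose M := \int[leb]_x `|cutoff a x|.
exists (8 * (M ^+ 2 + C ^+ 2)); first by rewrite mulr_ge0// addr_ge0 ?sqr_ge0.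
move=> t; have tM := cos_transform_norm t (integrable_cutoff a0).
rewrite -/M in tM; set c := cos_transform _ t in tM *.
have cM : c ^+ 2 <= M ^+ 2.
  by rewrite -(real_normK (num_real c)) lerXn2r ?nnegrE// (le_trans _ tM).
have c0 := sqr_ge0 c; have C0 := sqr_ge0 C; have M0 := sqr_ge0 M.
have t0 := sqr_ge0 t.
have [t1|t1] := leP 1 `|t|.
  have h := HC t t1; rewrite -/c in h.
  have {}h : (t ^+ 3 * c) ^+ 2 <= C ^+ 2.
    by rewrite -(real_normK (num_real (t ^+ 3 * c))) lerXn2r ?nnegrE//
      (le_trans _ h).
  have t2 : 1 <= t ^+ 2 by rewrite -(real_normK (num_real t)) exprn_ege1.
  apply: (@le_trans _ _ ((2 * t ^+ 2) ^+ 3 * c ^+ 2)).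
    by apply: ler_wpM2r => //; rewrite lerXn2r ?nnegrE//; lra.
  rewrite (_ : (2 * t ^+ 2) ^+ 3 * c ^+ 2 = 8 * (t ^+ 3 * c) ^+ 2); last by
    ring.
  lra.
have t2 : t ^+ 2 <= 1 by rewrite -(real_normK (num_real t)) exprn_ile1// ltW.
apply: (@le_trans _ _ (2 ^+ 3 * c ^+ 2)).
  by apply: ler_wpM2r => //; rewrite lerXn2r ?nnegrE//; lra.
rewrite (_ : 2 ^+ 3 = 8 :> R); last by ring.
lra.
Qed.

Let chat : Rn R n -> R := prodRn (cos_transform (cutoff a)).

Let mchat : measurable_fun setT chat.
Proof.
apply: measurable_prodRn; apply: measurable_cos_transform.
  exact: cutoff_ge0.
exact: integrable_cutoff.
Qed.

Lemma one_add_dot_le (x : Rn R n) : 1 + dot x x <= prodRn (fun t => 1 + t ^+ 2)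
  x.
Proof.
move: n x; elim=> [|m IH] x; first by rewrite /prodRn /dot !big_ord0 addr0.
rewrite -(Rn_unconsK x); case: (Rn_uncons x) => b y.
rewrite prodRn_cons dot_cons -expr2; have := IH y.
have : 0 <= dot y y by apply: sumr_ge0 => i _; rewrite -expr2 sqr_ge0.
have := sqr_ge0 b; nra.
Qed.

(* The weight (1 + |xi|^2)^2 dominates both 1 and |xi|^(4 al). *)
Lemma chat_weight_L2 (m : Rn R n -> R) : measurable_fun setT m ->
  (forall xi, `|m xi| <= 1 + dot xi xi) ->
  (fun xi => m xi * chat xi) \in Lfun mu 2%:E.
Proof.
move=> mm m1; have [B B0 HB] := cos_transform_cutoff_le.
have ig : leb.-integrable setT (EFin \o (fun t : line => B / (1 + t ^+ 2))).
  exact: (integrableZl measurableT B integrable_oneDsqrV).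
have [iP _] := Rintegral_prodRn n ig.
have mh : measurable_fun setT (fun xi => m xi * chat xi) by exact:
  measurable_funM.
apply: Lfun2_of_sqr => //.
apply: (le_integrable_EFin _ _ iP); first exact: measurable_funX.
move=> xi; rewrite ger0_norm ?sqr_ge0// exprMn.
(* Of the three powers of [1 + t ^ 2] available in each coordinate, two pay for the weight and the
   third makes the bound integrable. *)
apply: (@le_trans _ _ (prodRn (fun t => (1 + t ^+ 2) ^+ 2 * cos_transform
  (cutoff a) t ^+ 2) xi)).
  rewrite /prodRn big_split/= !prodrXl -/(chat xi) ler_wpM2r ?sqr_ge0//.
  rewrite -(real_normK (num_real (m xi))).
  have d0 := dot_ge0 xi; have h := one_add_dot_le xi.
  have h' := le_trans (m1 xi) h.
  by rewrite lerXn2r ?nnegrE// (le_trans _ h').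
apply: ler_prod => i _; set t := tnth xi i.
have t0 : 0 < 1 + t ^+ 2 by rewrite ltr_pwDl// sqr_ge0.
rewrite mulr_ge0 ?sqr_ge0//= ler_pdivlMr// mulrC mulrA -exprS; exact: HB.
Qed.

(** [c] will be the value of the time factor at a fixed time. Evenness of the cutoff makes both
    transforms real, so [fourier_real] applies twice. *)
Lemma fracLap_cutoff (c : R) :
  fracLap (2 * al) (fun x => c * cutoffRn a x) (fun x : Rn R n => c *
    frac_cutoff al a x).
Proof.
have ip := integrable_cutoffRn n a0.
have iw := integrable_frac_cutoff n al0 al1 a0.
have icp : mu.-integrable setT (EFin \o (fun x => c * cutoffRn a x)).
  exact: (integrableZl measurableT c ip).
have icw : mu.-integrable setT (EFin \o (fun x => c * frac_cutoff al a x)).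
  exact: (integrableZl measurableT c iw).
have sz t := sin_transform_cutoff t a0.
have e xi : (enorm xi `^ (2 * al))%:C%C * (c * chat xi)%:C%C =
   (c * (dot xi xi `^ al * chat xi))%:C%C.
  by rewrite enorm_powR -rmorphM/= mulrCA.
have mdd : measurable_fun setT (fun xi : Rn R n => dot xi xi).
  by apply: measurable_sum => i; apply: measurable_funM; exact: measurable_tnth.
have cc (m : Rn R n -> R) : measurable_fun setT m ->
    (forall xi, `|m xi| <= 1 + dot xi xi) ->
    (fun xi => c * (m xi * chat xi)) \in Lfun mu 2%:E.
  move=> mm m1; have l2 : (1 : R) <= 2 by rewrite ler1n.
  rewrite (_ : (fun xi => _) = c \o* (fun xi => m xi * chat xi)); last first.
    by apply/funext => xi /=; rewrite mulrC.
  exact: (Lfun_scale _ l2 (chat_weight_L2 mm m1)).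
exists (fun xi => (c * chat xi)%:C%C); split.
  apply: fourier_real => //.
  - apply: (Lfun2_bounded icp (C := `|c|)) => x.
    by rewrite normrM ler_piMr// ger0_norm ?cutoffRn_ge0// cutoffRn_le1.
  - have := cc (fun=> 1) (measurable_cst _).
    under eq_fun do rewrite mul1r; apply => xi.
    by rewrite normr1 lerDl dot_ge0.
  - move=> xi; have [ic _ ec _] := fourier_prodRn (integrable_cutoff a0) sz xi.
    under eq_Rintegral do rewrite -mulrA.
    by rewrite RintegralZl// ec.
  - move=> xi; have [_ ic _ ec] := fourier_prodRn (integrable_cutoff a0) sz xi.
    under eq_Rintegral do rewrite -mulrA.
    by rewrite RintegralZl// ec mulr0.
have -> : (fun xi => (enorm xi `^ (2 * al))%:C%C * (c * chat xi)%:C%C) =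
   (fun xi => (c * (dot xi xi `^ al * chat xi))%:C%C) by apply/funext.
have mtr (k : R -> R) : continuous k -> (forall x, `|k x| <= 1) -> forall xi,
    mu.-integrable setT (EFin \o (fun x => frac_cutoff al a x * k (dot x xi))).
  move=> ck k1 xi.
  have mk : measurable_fun setT (fun x : Rn R n => k (dot x xi)).
    apply: measurableT_comp; last exact: measurable_dot.
    exact: continuous_measurable_fun.
  by have [] := Rintegral_frac_cutoff al0 al1 a0 mk (fun x => k1 _).
apply: fourier_real => //.
- have := @frac_cutoff_norm _ n _ _ al0 al1 a0.
  set C := (_ * _) => hC.
  apply: (Lfun2_bounded icw (C := `|c| * C)) => x.
  by rewrite normrM ler_wpM2l.
- apply: cc; first exact: (measurableT_comp (measurable_powR _)).
  move=> xi; rewrite ger0_norm ?powR_ge0//.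
  have d0 := dot_ge0 xi.
  (* The base is raised above 1 so that [al < 1] allows the exponent to be replaced by 1. *)
  apply: (@le_trans _ _ ((1 + dot xi xi) `^ al)).
    by rewrite ge0_ler_powR ?nnegrE ?addr_ge0 ?(ltW al0)// lerDr.
  rewrite -[leRHS]powRr1 ?addr_ge0//.
  by rewrite ler_powR ?lerDl// ltW.
- move=> xi; under eq_Rintegral do rewrite -mulrA.
  rewrite RintegralZl//; last by apply: mtr; [exact: continuous_cos|exact:
    cos_max].
  by rewrite cos_frac_cutoff.
- move=> xi; under eq_Rintegral do rewrite -mulrA.
  rewrite RintegralZl//; last by apply: mtr; [exact: continuous_sin|exact:
    sin_max].
  by rewrite sin_frac_cutoff// mulr0.
Qed.

(** The support is the cube of half-side [1 / a], contained in the ball of radius [sqrt n / a]. *)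
Lemma cutoffRn_support (x : Rn R n) : cutoffRn a x != 0 ->
  dot x x <= n%:R * a^-1 ^+ 2.
Proof.
move=> x0.
have h i : tnth x i * tnth x i <= a^-1 ^+ 2.
  have [h|h] := leP a^-1 `|tnth x i|.
    by move: x0; rewrite /cutoffRn /prodRn (bigD1 i)//= (cutoff_out a0 h) mul0r
      eqxx.
  rewrite -expr2 -(real_normK (num_real (tnth x i))) lerXn2r ?nnegrE
    ?invr_ge0//.
    exact: ltW.
  exact: ltW.
rewrite /dot (le_trans (ler_sum _ (fun i _ => h i)))//.
by rewrite sumr_const card_ord mulr_natl.
Qed.

End fractional_laplacian_cutoff.

(** * Test functions *)

Section separated_test_function.
Context {R : realType}.
Local Notation leb := (@lebesgue_measure R).
Local Notation line := (measurableTypeR R).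

Section Lp.
Context d (T : measurableType d) (mu : {measure set T -> \bar R}).
Variables (p : \bar R) (g : T -> R).
Hypotheses (p1 : (1 <= p)%E) (gp : g \in Lfun mu p).

Lemma Lfun_scalel (c : R) : (fun x => c * g x) \in Lfun mu p.
Proof.
have [h0 hlin] := Lfun_submod_closed mu p1.
have := hlin c g 0 gp h0.
rewrite (_ : c *: g + 0 = (fun x => c * g x))//.
by apply/funext => x /=; rewrite addr0.
Qed.

Lemma Lnorm_scalel (c : R) :
  ('N[mu]_p[EFin \o (fun x => (c * g x)%R)] =
   (`|c| * fine 'N[mu]_p[EFin \o g])%:E)%E.
Proof.
have := LnormZ (Lfun_Sub p1 gp) c; rewrite Lfun_valP EFinM => e.
rewrite fineK; last first.
  move: gp; rewrite inE => /andP[_]; rewrite inE/= => h.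
  by rewrite ge0_fin_numE ?Lnorm_ge0.
exact: e.
Qed.

(** With separated variables, every convergence in time required of a test function becomes a scalar
    limit of the time factor. *)
Lemma cvg_Lnorm_scalel (I : Type) (F : set_system I) (FF : Filter F) (c : I ->
  R) :
  c s @[s --> F] --> (0 : R) ->
  ('N[mu]_p[EFin \o (fun x => (c s * g x)%R)])%E @[s --> F] --> 0%E.
Proof.
move=> c0; under eq_fun do rewrite Lnorm_scalel.
apply: cvg_EFin; first exact: nearW.
rewrite /comp/= -(mul0r (fine 'N[mu]_p[EFin \o g]%E)).
apply: cvgM; last exact: cvg_cst.
by rewrite -(normr0 R); apply: cvg_norm.
Qed.

End Lp.

Section separated.
Variables (n : nat) (al a T : R) (tau tau' : R -> R).
Hypotheses (al0 : 0 < al) (al1 : al < 1) (a0 : 0 < a).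
Hypotheses (dtau : forall t : R, is_derive t (1 : R) tau (tau' t)) (ctau' :
  continuous tau')
  (tauT : tau T = 0).
Local Notation mu := (lebesgueRn R n).

Let ctau : continuous tau.
Proof.
move=> t; apply: differentiable_continuous.
by apply/derivable1_diffP; exact: ex_derive.
Qed.

Lemma continuous_Lp_separated (p : \bar R) (g : Rn R n -> R) (s : R -> R) :
  (1 <= p)%E -> g \in Lfun mu p -> continuous s ->
  continuous_Lp p T (fun t x => s t * g x).
Proof.
move=> p1 gp cs t _; split; first exact: Lfun_scalel.
apply: cvg_within_filter.
rewrite [X in X @ _ --> _](_ : _ =
  (fun r => 'N[mu]_p[EFin \o (fun x => ((s r - s t) * g x)%R)]%E)); last first.
  by apply/funext => r; apply: eq_Lnorm => x /=; rewrite mulrBl.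
apply: cvg_Lnorm_scalel => //.
by apply/subr_cvg0; exact: cs.
Qed.

Lemma Lfuny_bounded (g : Rn R n -> R) (C : R) : measurable_fun setT g ->
  (forall x, `|g x| <= C) -> g \in Lfun mu +oo%E.
Proof.
move=> mg gC; rewrite inE; apply/andP; split; rewrite inE//=.
rewrite /finite_norm unlock /=; case: ifPn => _; last exact: ltry.
apply: (@le_lt_trans _ _ C%:E); last exact: ltry.
by apply/ess_supP/nearW => x /=; rewrite lee_fin.
Qed.

Lemma test_function_separated :
  test_function (2 * al) T (fun t x => tau t * cutoffRn a x)
    (fun t (x : Rn R n) => tau t * frac_cutoff al a x)
    (fun t x => tau' t * cutoffRn a x).
Proof.
have l12 : (1 <= (2%:E : \bar R))%E by rewrite lee_fin ler1n.
have l1y : (1 <= (+oo : \bar R))%E by rewrite leey.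
have ip := integrable_cutoffRn n a0.
have iw := integrable_frac_cutoff n al0 al1 a0.
have pb (x : Rn R n) : `|cutoffRn a x| <= 1 by rewrite ger0_norm
  ?cutoffRn_ge0// cutoffRn_le1.
have p2 : (cutoffRn a : Rn R n -> R) \in Lfun mu 2%:E := Lfun2_bounded ip pb.
have w2 : (frac_cutoff al a : Rn R n -> R) \in Lfun mu 2%:E.
  exact: (Lfun2_bounded iw (@frac_cutoff_norm _ n _ _ al0 al1 a0)).
have py : (cutoffRn a : Rn R n -> R) \in Lfun mu +oo%E.
  by apply: (Lfuny_bounded (C := 1)) => //; exact: measurable_cutoffRn.
split.
- split.
  + by move=> t _; exact: fracLap_cutoff.
  + exact: continuous_Lp_separated.
  + exact: continuous_Lp_separated.
- split.
  + exact: continuous_Lp_separated.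
  + exact: continuous_Lp_separated.
  + move=> t _; apply: cvg_within_filter.
    rewrite [X in X @ _ --> _](_ : _ =
      (fun r => 'N[mu]_(+oo)[EFin \o (fun x => (((tau r - tau t) / (r - t) -
        tau' t) * cutoffRn a x)%R)]%E)); last first.
      apply/funext => r; apply: eq_Lnorm => x /=; congr EFin.
      by rewrite [RHS]mulrBl -[X in X / _]mulrBl mulrAC.
    apply: cvg_Lnorm_scalel => //.
    apply/subr_cvg0.
    have [/cvg_ex[l hl] dE] := dtau t.
    have lE : l = tau' t by rewrite -dE; apply/esym/cvg_lim.
    (* The derivative is a limit in the increment at 0, the required one a limit at [t]; sequences
       carry the one to the other. *)
    rewrite -lE; apply/cvgr_dnbhsP => v [vt vcvg].
    have v0 : (forall m, v m - t != 0) /\ v m - t @[m --> \oo] --> 0.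
      by split=> [m|]; [rewrite subr_eq0|exact/subr_cvg0].
    have := (cvgr_dnbhsP _ _ _).1 hl _ v0.
    rewrite [X in X @ _ --> _](_ : _ = fun m => (tau (v m) - tau t) / (v m -
      t))//.
    by apply/funext => m; rewrite /= scaler1 subrK mulrC.
- exists (Num.sqrt (n%:R * a^-1 ^+ 2)) => t _; apply/aeW => x rx.
  suff -> : cutoffRn a x = 0 by rewrite mulr0.
  apply/eqP/negP => /negP /(cutoffRn_support a0) h.
  by move: rx; rewrite ltNge /enorm ler_wsqrtr.
- by apply/aeW => x; rewrite tauT mul0r.
Qed.

End separated.
End separated_test_function.

(** * Weak solutions against the test functions *)

Section integrability.
Context {R : realType}.
Local Notation leb := (@lebesgue_measure R).
Local Notation line := (measurableTypeR R).

(** The iterated real integral truncates infinite inner integrals to a default value; integrability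
    confines this to a negligible set of times. *)
Lemma Rintegral_prod d (Y : measurableType d)
    (mu : {sigma_finite_measure set Y -> \bar R}) (G : line * Y -> R) :
  (leb \x mu)%E.-integrable setT (EFin \o G) ->
  \int[leb]_t \int[mu]_x G (t, x) = \int[(leb \x mu)%E]_z G z.
Proof.
move=> iG; rewrite /Rintegral; congr fine.
rewrite -integral12_prod_meas1//; apply: ae_eq_integral => //.
- have m := measurable_fubini_F iG; apply/measurable_EFinP.
  exact: (measurableT_comp (@fine_measurable R _ measurableT) m).
- exact: measurable_fubini_F iG.
- have := ae_integrable1 iG; apply: filterS => t it _.
  by rewrite /fubini_F fineK//; exact: (integrable_fin_num measurableT it).
Qed.

Lemma ae_le_Rintegral d (Y : measurableType d) (mu : {measure set Y -> \bar R})
    (f g : Y -> R) : mu.-integrable setT (EFin \o f) ->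
  mu.-integrable setT (EFin \o g) -> {ae mu, forall x, f x <= g x} ->
  \int[mu]_x f x <= \int[mu]_x g x.
Proof.
move=> fi gi fg; rewrite -subr_ge0 -RintegralB//.
have i : mu.-integrable setT (EFin \o (fun x => g x - f x)) := integrableB
  measurableT gi fi.
(* The positive part of [g - f] equals it almost everywhere and is nonnegative everywhere. *)
apply: fine_ge0; rewrite -(@ae_eq_integral _ _ _ mu setT (EFin \o (fun x => g x
  - f x)) (fun x => (Num.max 0 (g x - f x))%:E) measurableT).
- by apply: integral_ge0 => x _; rewrite lee_fin le_max lexx.
- apply/measurable_EFinP; apply: measurable_maxr => //.
  by apply/measurable_EFinP; exact: (measurable_int _ i).
- exact: (measurable_int _ i).
- by move: fg; apply: filterS => x fgx _; rewrite max_r// subr_ge0.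
Qed.

Lemma measurable_enorm n : measurable_fun setT (@enorm R n).
Proof.
have ms : measurable_fun setT (Num.sqrt : line -> R).
  by apply: continuous_measurable_fun; exact: sqrt_continuous.
apply: (measurableT_comp ms).
by apply: measurable_sum => i; apply: measurable_funM; exact: measurable_tnth.
Qed.

Lemma measurable_eball n (r : R) : measurable (@eball R n r).
Proof.
have := @measurable_fun_ler _ _ R setT _ _ (@measurable_enorm n)
  (measurable_cst r).
move=> /(_ measurableT [set true] I).
by rewrite setTI (_ : _ @^-1` _ = eball r).
Qed.

Variables (n : nat) (al a T p q : R) (u0 : Rn R n -> R) (u : R -> Rn R n -> R).
Hypotheses (al0 : 0 < al) (al1 : al < 1) (a0 : 0 < a) (T0 : 0 < T)
  (p0 : 0 < p) (q0 : 1 < q).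
Local Notation mu := (lebesgueRn R n).
Local Notation psi := (cutoffRn a : Rn R n -> R).
Local Notation w := (frac_cutoff al a : Rn R n -> R).
Local Notation rad := (Num.sqrt (n%:R * a^-1 ^+ 2)).

Lemma cutoffRn_out (x : Rn R n) : ~ eball rad x -> psi x = 0.
Proof.
move=> nx; apply/eqP/negP => /negP /(cutoffRn_support a0) h.
by apply: nx; rewrite /eball/= /enorm ler_wsqrtr.
Qed.

Lemma integrable_loc_cutoff : L1_loc u0 ->
  mu.-integrable setT (EFin \o (fun x => u0 x * psi x)).
Proof.
move=> [mu0 /(_ rad) lu0].
have m : measurable_fun setT (fun x => u0 x * psi x).
  by apply: measurable_funM => //; exact: measurable_cutoffRn.
apply/integrableP; split; first exact/measurable_EFinP.
apply: le_lt_trans lu0; rewrite [leRHS]integral_mkcond.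
apply: ge0_le_integral => //.
- by apply: measurableT_comp => //; exact/measurable_EFinP.
- apply: (measurable_restrictT _ (@measurable_eball n rad)).1 _.
  have mn : measurable_fun setT (fun x => `|(u0 x)%:E|%E).
    by apply: measurableT_comp => //; exact/measurable_EFinP.
  exact: (measurable_funTS mn).
- move=> x _; rewrite patchE; case: ifPn => [_|]; rewrite /= lee_fin.
    by rewrite normrM ler_piMr// ger0_norm ?cutoffRn_ge0 ?cutoffRn_le1.
  by rewrite notin_setE => /cutoffRn_out ->; rewrite mulr0 normr0.
Qed.

Hypothesis (mu_ : measurable_fun (`]0, T[ `*` [set: Rn R n])
        (fun z : measurableTypeR R * Rn R n => u z.1 z.2)).

(** Measurability of [u] is given only on the strip; extension by 0 allows Fubini's theorem on the
    whole product space. *)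
Definition zero_ext (z : line * Rn R n) : R := if z.1 \in `]0, T[ then u z.1
  z.2 else 0.

Lemma measurable_zero_ext : measurable_fun setT zero_ext.
Proof.
have mD : measurable (`]0, T[ `*` [set: Rn R n] : set (line * Rn R n)).
  by apply: measurableX => //; exact: measurable_itv.
have := (measurable_restrictT _ mD).1 mu_.
rewrite (_ : _ \_ _ = zero_ext)//; apply/funext => z.
rewrite patchE /zero_ext; case: ifPn.
  by rewrite inE => -[/= zT _]; rewrite zT.
by rewrite notin_setE; case: ifPn => // zT []; split.
Qed.

Lemma Rintegral_zero_ext (F G : R -> Rn R n -> R) :
  (forall t x, t \in `]0, T[ -> F t x = G t x) ->
  (forall t x, t \notin `]0, T[ -> G t x = 0) ->
  \int[leb]_(t in `]0, T[) \int[mu]_x F t x = \int[leb]_t \int[mu]_x G t x.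
Proof.
move=> FG G0; rewrite Rintegral_mkcond; apply: eq_Rintegral => t _.
rewrite patchE; case: ifPn => tT.
  by apply: eq_Rintegral => x _; rewrite FG//; move: tT; rewrite inE.
have tT' : t \notin `]0, T[ by apply/negP => h; move: tT; rewrite notin_setE;
  exact.
transitivity (\int[mu]_x (0 : R)); first by rewrite Rintegral_cst// mul0r.
by apply: eq_Rintegral => x _; rewrite G0.
Qed.

Lemma integrable_pow_q :
  (\int[leb]_(t in `]0%R, T[) \int[mu]_(x in eball rad) (`|u t x| `^ q)%R%:E <
    +oo)%E ->
  (leb \x mu)%E.-integrable setT (EFin \o (fun z => `|zero_ext z| `^ q * psi
    z.2)).
Proof.
move=> uq.
have mz := measurable_zero_ext.
have m1 : measurable_fun setT (fun z => `|zero_ext z| `^ q).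
  by apply: (measurableT_comp (measurable_powR _)); exact: measurableT_comp.
have mpsi : measurable_fun setT (fun z : line * Rn R n => psi z.2).
  exact: (measurableT_comp (@measurable_cutoffRn R n a)).
have mball : measurable_fun setT (fun z : line * Rn R n => \1_(eball rad) z.2 :
  R).
  exact: (measurableT_comp (measurable_indic (@measurable_eball n rad))).
have m2 : measurable_fun setT (fun z => `|zero_ext z| `^ q * psi z.2).
  exact: measurable_funM.
apply/integrable12ltyP; first exact/measurable_EFinP.
apply: le_lt_trans uq; rewrite [leRHS]integral_mkcond.
(* The indicator of the ball dominates [psi] and turns the local hypothesis into an integral over
   the whole space. *)
rewrite [leRHS](_ : _ = \int[leb]_t \int[mu]_x (`|zero_ext (t, x)| `^ q *
  \1_(eball rad) x)%:E)%E; last first.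
  apply: eq_integral => t _; rewrite patchE; case: ifPn => tT.
    have tT' : t \in `]0, T[ by move: tT; rewrite inE.
    rewrite integral_mkcond; apply: eq_integral => x _.
    have -> : zero_ext (t, x) = u t x by rewrite /zero_ext/= tT'.
    by rewrite patchE indicE; case: ifPn => _; rewrite ?mulr1 ?mulr0.
  rewrite integral0_eq// => x _; rewrite /zero_ext/= ifF ?normr0 ?powR0
    ?mul0r//.
    by rewrite gt_eqF// (lt_trans ltr01).
  by apply/negP => h; move: tT; rewrite notin_setE; exact.
apply: ge0_le_integral => //.
- by move=> t _; exact: integral_ge0.
- apply: (measurable_fun_fubini_tonelli_F (m2 := mu) (abse \o (EFin \o (fun z
    => `|zero_ext z| `^ q * psi z.2)))) => //=.
  by apply: measurableT_comp => //; exact/measurable_EFinP.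
- apply: (measurable_fun_fubini_tonelli_F (m2 := mu) (EFin \o (fun z =>
    `|zero_ext z| `^ q * \1_(eball rad) z.2))) => //=.
    by apply/measurable_EFinP; exact: measurable_funM.
- move=> t _; apply: ge0_le_integral => //.
  + apply: measurableT_comp => //; apply/measurable_EFinP.
    exact: (measurableT_comp m2 (pair1_measurable t)).
  + apply/measurable_EFinP.
    apply: measurable_funM; first exact: (measurableT_comp m1 (pair1_measurable
      t)).
    exact: measurable_indic (@measurable_eball n rad).
  + move=> x _; rewrite /= lee_fin ger0_norm ?mulr_ge0 ?powR_ge0
      ?cutoffRn_ge0//.
    rewrite ler_wpM2l ?powR_ge0// indicE.
    case: (boolP (x \in eball rad)) => xb; first by rewrite cutoffRn_le1.
    by rewrite cutoffRn_out//; move: xb; rewrite notin_setE.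
Qed.

Lemma integrable_cutoff_strip :
  (leb \x mu)%E.-integrable setT
    (EFin \o (fun z : line * Rn R n => \1_(`]0, T[%classic) z.1 * psi z.2)) /\
  \int[(leb \x mu)%E]_z (\1_(`]0, T[%classic) z.1 * psi z.2) = T * \int[mu]_x
    psi x.
Proof.
have mT : measurable (`]0, T[%classic : set line) by exact: measurable_itv.
have i1 : leb.-integrable setT (EFin \o (\1_(`]0, T[%classic) : line -> R)).
  exact: integrable_indic_itv.
have i2 := integrable_cutoffRn n a0.
have iP : (leb \x mu)%E.-integrable setT
    (EFin \o (fun z : line * Rn R n => \1_(`]0, T[%classic) z.1 * psi z.2)).
  have m : measurable_fun setT (fun z : line * Rn R n => (\1_(`]0, T[%classic)
    z.1 : R) * psi z.2).
    apply: measurable_funM.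
      exact: (measurableT_comp (measurable_indic mT)).
    exact: (measurableT_comp (@measurable_cutoffRn R n a)).
  apply/integrable12ltyP; first exact/measurable_EFinP.
  rewrite (_ : (\int[leb]_t _)%E = (\int[leb]_t ((\int[mu]_x psi x)%:E *
    (\1_(`]0, T[%classic) t)%:E))%E).
    by rewrite integralZl// -(fineK (integrable_fin_num measurableT i1)) -EFinM
      ltry.
  apply: eq_integral => t _.
  transitivity (\int[mu]_x ((\1_(`]0, T[%classic) t : R)%:E * (psi x)%:E))%E.
    apply: eq_integral => x _.
    by rewrite /= ger0_norm ?mulr_ge0 ?cutoffRn_ge0// EFinM.
  rewrite muleC integralZl//; congr (_ * _)%E.
  by rewrite /Rintegral (fineK (integrable_fin_num measurableT i2)).
split => //; rewrite -Rintegral_prod//.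
transitivity (\int[leb]_t (\1_(`]0, T[%classic) t * \int[mu]_x psi x)).
  by apply: eq_Rintegral => t _; rewrite /= RintegralZl.
rewrite RintegralZr//; congr (_ * _).
have L : leb (`]0, T[%classic : set line) = T%:E.
  by rewrite lebesgue_measure_itv/= lte_fin T0 sube0.
by rewrite /Rintegral integral_indic// setIT; exact: (congr1 fine L).
Qed.

(** Local integrability cannot suffice, as [w] is not compactly supported. The condition on [u] in
    [L^p(L^(2p))] is made for Hoelder's inequality with exponents 2 and 2: the L^2 norm of [|u| ^ p]
    is the [p]-th power of the L^(2p) norm of [u]. *)
Lemma integrable_pow_p :
  (\int[leb]_(t in `]0%R, T[)
          ('N[mu]_(2 * p)%:E[EFin \o u t] `^ p) < +oo)%E ->
  (leb \x mu)%E.-integrable setT (EFin \o (fun z => `|zero_ext z| `^ p * w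
    z.2)).
Proof.
move=> up.
have mz := measurable_zero_ext.
have iw := integrable_frac_cutoff n al0 al1 a0.
have mw : measurable_fun setT w by apply/measurable_EFinP; exact:
  measurable_int iw.
have w2 : w \in Lfun mu 2%:E.
  exact: (Lfun2_bounded iw (@frac_cutoff_norm _ n _ _ al0 al1 a0)).
have m1 : measurable_fun setT (fun z => `|zero_ext z| `^ p).
  by apply: (measurableT_comp (measurable_powR _)); exact: measurableT_comp.
have m2 : measurable_fun setT (fun z => `|zero_ext z| `^ p * w z.2).
  apply: measurable_funM; first exact: m1.
  exact: (measurableT_comp mw (@measurable_snd _ _ line (Rn R n))).
have m3 : measurable_fun setT (fun z => `|zero_ext z| `^ (2 * p)).
  by apply: (measurableT_comp (measurable_powR _)); exact: measurableT_comp.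
pose M := fine ('N[mu]_2%:E[EFin \o w])%E.
have ME : ('N[mu]_2%:E[EFin \o w] = M%:E)%E.
  rewrite /M fineK//; move: w2; rewrite inE => /andP[_]; rewrite inE/= => h.
  by rewrite ge0_fin_numE ?Lnorm_ge0.
have M0 : 0 <= M by apply: fine_ge0; exact: Lnorm_ge0.
(* [S t] is that [p]-th power on the strip and 0 elsewhere; written with [zero_ext], it is
   measurable in [t] by Tonelli's theorem. *)
pose S t : \bar R := ((\int[mu]_x (`|zero_ext (t, x)| `^ (2 * p))%:E) `^
  2^-1)%E.
have mS : measurable_fun setT (S : line -> _).
  apply: (@measurableT_comp _ _ _ _ _ _ (fun x => x `^ 2^-1)%E); first exact:
    measurable_poweR.
  apply: (measurable_fun_fubini_tonelli_F (m2 := mu) (EFin \o (fun z =>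
    `|zero_ext z| `^ (2 * p)))).
    exact/measurable_EFinP.
  by move=> z; rewrite lee_fin powR_ge0.
have SE t : t \in `]0, T[ -> ('N[mu]_(2 * p)%:E[EFin \o u t] `^ p = S t)%E.
  move=> tT; rewrite unlock /= -poweRrM /S.
  rewrite (_ : (2 * p)^-1 * p = 2^-1); last by field; rewrite gt_eqF.
  congr (_ `^ _)%E; apply: eq_integral => x _.
  by rewrite /zero_ext/= tT.
have S0 t : (0 <= S t)%E by exact: poweR_ge0.
apply/integrable12ltyP; first exact/measurable_EFinP.
apply: (@le_lt_trans _ _ (\int[leb]_t (M%:E * S t))%E); last first.
  rewrite ge0_integralZl//; apply: lte_mul_pinfty => //.
  apply: le_lt_trans up; rewrite [leRHS]integral_mkcond.
  apply: ge0_le_integral => //.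
  - rewrite (_ : _ \_ _ = S \_ `]0%R, T[)//.
      apply/(measurable_restrictT _ _).1; first exact: measurable_itv.
      exact: measurable_funTS.
    by apply/funext => t; rewrite !patchE; case: ifPn => // tT; rewrite SE//;
      move: tT; rewrite inE.
  - move=> t _; rewrite patchE; case: ifPn => tT.
      by rewrite SE//; move: tT; rewrite inE.
    rewrite /S integral0_eq ?poweR0r//.
    move=> x _; rewrite /zero_ext/= ifF ?normr0 ?powR0//.
      by rewrite mulf_neq0// gt_eqF.
    by apply/negP => h; move: tT; rewrite notin_setE; exact.
apply: ge0_le_integral => //.
- by move=> t _; exact: integral_ge0.
- apply: (measurable_fun_fubini_tonelli_F (m2 := mu) (abse \o (EFin \o (fun z
    => `|zero_ext z| `^ p * w z.2)))) => //=.
  by apply: measurableT_comp => //; exact/measurable_EFinP.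
- exact: measurable_funeM.
- move=> t _.
  have mt : measurable_fun setT (fun x => `|zero_ext (t, x)| `^ p).
    exact: (measurableT_comp m1 (pair1_measurable t)).
  have := @hoelder _ _ _ mu (fun x => `|zero_ext (t, x)| `^ p) w 2 2 mt mw.
  rewrite Lnorm1 ME => h; apply: le_trans (h _ _ _) _ => //.
    by rewrite [RHS]splitr !div1r.
  rewrite muleC lee_wpmul2l// unlock /=.
  rewrite /S le_eqVlt; apply/orP; left; apply/eqP; congr (_ `^ _)%E.
  apply: eq_integral => x _; rewrite /= ger0_norm ?powR_ge0//.
  by rewrite -powRrM mulrC.
Qed.

End integrability.

(** * Absorption and scaling *)

Section absorption.
Context {R : realType}.
Local Notation leb := (@lebesgue_measure R).
Local Notation line := (measurableTypeR R).

(** Young's inequality, with a constant obtained by dichotomy: if [A v ^ p] exceeds [v ^ q / 2],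
    then [v ^ (q - p) <= 2 A], which bounds [v ^ p]. *)
Lemma absorb_power (p q A v : R) : 0 < p -> p < q -> 0 <= A -> 0 <= v ->
  A * v `^ p <= v `^ q / 2 + A * (2 * A) `^ (p / (q - p)).
Proof.
move=> p0 pq A0 v0.
have r0 : 0 <= A * (2 * A) `^ (p / (q - p)) by rewrite mulr_ge0 ?powR_ge0.
have [h|h] := leP (A * v `^ p) (v `^ q / 2); first by rewrite (le_trans h)//
  lerDl.
apply: (@le_trans _ _ (A * (2 * A) `^ (p / (q - p)))); last by rewrite lerDr
  divr_ge0 ?powR_ge0.
rewrite ler_wpM2l//.
have qp : 0 < q - p by rewrite subr_gt0.
have v1 : 0 < v.
  rewrite lt_neqAle v0 andbT eq_sym; apply/eqP => v00; move: h.
  by rewrite v00 (powR0 (lt0r_neq0 p0)) (powR0 (lt0r_neq0 (lt_trans p0 pq)))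
    mulr0 mul0r ltxx.
have vD x y : v `^ (x + y) = v `^ x * v `^ y by rewrite powRD// (gt_eqF v1)
  implybT.
have vp : 0 < v `^ p by exact: powR_gt0.
have e : v `^ q = v `^ p * v `^ (q - p).
  by rewrite -vD; congr (_ `^ _); ring.
have h2 : v `^ (q - p) <= 2 * A.
  rewrite -(ler_pM2l vp) -e; move: h; set X := v `^ p; set Y := v `^ q; lra.
have -> : v `^ p = (v `^ (q - p)) `^ (p / (q - p)).
  by rewrite -powRrM; congr (_ `^ _); field; rewrite gt_eqF.
by rewrite ge0_ler_powR ?nnegrE ?powR_ge0 ?divr_ge0 ?(ltW p0) ?(ltW qp)//
  mulr_ge0.
Qed.

(* For 1 <= k (q - 1), s ^ (k (q - 1)) <= s, so (v s ^ k) ^ (q - 1) is at most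
   v ^ (q - 1) s, which is small unless the right-hand side dominates. *)
Lemma absorb_linear (q c v s : R) (k : nat) : 1 < q -> 0 <= c -> 0 <= v ->
  0 <= s <= 1 -> 1 <= k%:R * (q - 1) ->
  v * (c * s ^+ k) <= v `^ q * s ^+ k.+1 / 2 + c * (2 * c) `^ (q - 1)^-1.
Proof.
move=> q1 c0 v0 /andP[s0 s1] kq.
have r0 : 0 <= c * (2 * c) `^ (q - 1)^-1 by rewrite mulr_ge0 ?powR_ge0.
have q10 : 0 < q - 1 by rewrite subr_gt0.
have l0 : 0 <= v `^ q * s ^+ k.+1 / 2 by rewrite divr_ge0// mulr_ge0 ?powR_ge0
  ?exprn_ge0.
have [h|h] := leP (v * (c * s ^+ k)) (v `^ q * s ^+ k.+1 / 2).
  by rewrite (le_trans h)// lerDl.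
apply: (@le_trans _ _ (c * (2 * c) `^ (q - 1)^-1)); last by rewrite lerDr.
rewrite mulrCA ler_wpM2l//.
have sk0 : 0 <= s ^+ k by rewrite exprn_ge0.
have vs : 0 < v * s ^+ k.
  rewrite lt_neqAle mulr_ge0// andbT eq_sym; apply/eqP => vs0.
  by move: h; rewrite mulrCA vs0 mulr0 ltNge l0.
have v1 : 0 < v.
  rewrite lt_neqAle v0 andbT eq_sym; apply/eqP => v00.
  by move: vs; rewrite v00 mul0r ltxx.
have vD x y : v `^ (x + y) = v `^ x * v `^ y by rewrite powRD// (gt_eqF v1)
  implybT.
have e : v `^ q = v * v `^ (q - 1).
  rewrite {1}(_ : q = 1 + (q - 1)); last by ring.
  by rewrite (vD 1 (q - 1)) powRr1.
have h2 : v `^ (q - 1) * s <= 2 * c.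
  rewrite -(ler_pM2l vs); move: h; rewrite e exprS.
  set X := v `^ (q - 1); set Y := s ^+ k; move: (v) => V.
  by move=> h; rewrite (_ : V * Y * (X * s) = V * X * (s * Y)); [lra|ring].
have h3 : (v * s ^+ k) `^ (q - 1) <= 2 * c.
  apply: le_trans h2; rewrite powRM// ler_wpM2l ?powR_ge0//.
  rewrite -powR_mulrn// -powRrM.
  have [->|sn0] := eqVneq s 0.
    by rewrite powR0// gt_eqF// (lt_le_trans ltr01).
  have sp : 0 < s by rewrite lt_neqAle eq_sym sn0.
  by rewrite -[leRHS]powRr1// ger_powR// sp.
have -> : v * s ^+ k = ((v * s ^+ k) `^ (q - 1)) `^ (q - 1)^-1.
  by rewrite -powRrM mulfV ?gt_eqF// powRr1// ltW.
by rewrite ge0_ler_powR ?nnegrE ?powR_ge0 ?invr_ge0 ?(ltW q10)// mulr_ge0.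
Qed.

Lemma Rintegral_cutoff_gt0 (a : R) : 0 < a -> 0 < \int[leb]_x cutoff a x.
Proof.
(* On [[0, b]] the argument [a x] is at most 1/2, so the cutoff is at least [(3/4) ^ 2 = 9/16]. *)
move=> a0; pose b := (2 * a)^-1.
have b0 : 0 < b by rewrite invr_gt0 mulr_gt0.
rewrite lt_neqAle Rintegral_ge0 ?andbT; last by move=> x _; exact: cutoff_ge0.
rewrite eq_sym; apply/eqP => c0.
have : (\int[leb]_(r in `[0%R, b]) (9 / 16)%:E <= 0)%E.
  have <- : (\int[leb]_x (cutoff a x)%:E = 0)%E.
    have := fineK (integrable_fin_num measurableT (integrable_cutoff a0)).
    by rewrite -[fine _]/(\int[leb]_x cutoff a x) c0 => <-.
  rewrite integral_mkcond; apply: ge0_le_integral => //.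
  - by move=> r _; rewrite patchE; case: ifP => // _; rewrite lee_fin; lra.
  - by apply/(measurable_restrictT _ _).1 => //.
  - exact: (measurable_int _ (integrable_cutoff a0)).
  - move=> r _; rewrite patchE; case: ifPn => [|_]; last by rewrite lee_fin
      cutoff_ge0.
    rewrite inE/= in_itv/= => /andP[r0 r1]; rewrite lee_fin /cutoff.
    have ar : 0 <= a * r <= 1 / 2.
      rewrite mulr_ge0 ?(ltW a0)//= (le_trans (ler_wpM2l (ltW a0) r1))//.
      by rewrite /b le_eqVlt; apply/orP; left; apply/eqP; field; rewrite gt_eqF.
    move: ar; set z := a * r => ar.
    have z2 : z ^+ 2 <= 1 / 4 by nra.
    by rewrite cutoff1_in; [nra|lra].
rewrite integral_cst//= lebesgue_measure_itv/= lte_fin b0 sube0 -EFinM.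
rewrite lee_fin leNgt mulr_gt0//; lra.
Qed.

Lemma no_uniform_bound (N : nat) (beta p q gamma eps C k : R) :
  0 < eps -> 0 < beta -> 0 < p -> 1 < q -> 0 < gamma -> 0 <= C -> 0 <= k ->
  p < q < p + beta / gamma ->
  (forall a T, 0 < a -> 0 < T ->
    eps * (1 + N%:R * a^-1 ^+ 2) `^ (- gamma / 2) <=
    T * (C * a `^ beta * (2 * (C * a `^ beta)) `^ (p / (q - p)) +
         k / T * (2 * (k / T)) `^ (q - 1)^-1)) -> False.
Proof.
move=> eps0 beta0 p0 q1 gamma0 C0 k0 /andP[pq qp] H.
have qp0 : 0 < q - p by rewrite subr_gt0.
have q10 : 0 < q - 1 by rewrite subr_gt0.
have q0 : 0 < q by rewrite (lt_trans ltr01).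
pose r := p / (q - p); pose s := (q - 1)^-1.
(* The midpoint of the admissible interval for [theta], as [1 + r = q / (q - p)]. *)
pose th := (gamma * (q - 1) + beta * (1 + r) - gamma) / 2.
have r1 : 1 + r = q / (q - p) by rewrite /r; field; rewrite gt_eqF.
have key : gamma * q < beta * (1 + r).
  have h : gamma * (q - p) < beta.
    by rewrite mulrC -ltr_pdivlMr// ltrBlDl.
  by rewrite r1 mulrA ltr_pdivlMr//; nra.
(* [d1] and [d2] are the amounts by which the exponents of [a] in the two terms on the right exceed
   [gamma]. *)
pose d1 := beta * (1 + r) - th - gamma.
pose d2 := th * s - gamma.
have d10 : 0 < d1 by rewrite /d1 /th; lra.
have d20 : 0 < d2.
  rewrite /d2 /s subr_gt0 ltr_pdivlMr// /th; lra.
have [d [d0 dd1 dd2]] : exists d, [/\ 0 < d, d <= d1 & d <= d2].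
  by exists (Num.min d1 d2); rewrite lt_min d10 d20 !ge_min !lexx orbT.
(* For [a <= 1], [1 + N / a ^ 2 <= (1 + N) / a ^ 2], so the left-hand side is at least
   [e' * a ^ gamma]. *)
pose e' := eps * (1 + N%:R) `^ (- gamma / 2).
have N1 : 0 < 1 + N%:R :> R by rewrite ltr_pwDl.
have e'0 : 0 < e' by rewrite mulr_gt0 ?powR_gt0.
pose C1 := C * (2 * C) `^ r; pose C2 := k * (2 * k) `^ s.
have C10 : 0 <= C1 by rewrite mulr_ge0 ?powR_ge0.
have C20 : 0 <= C2 by rewrite mulr_ge0 ?powR_ge0.
(* With [a = exp (- y)] all powers become exponentials. After multiplication by
   [exp ((gamma + d) y)], the two terms on the right have the nonpositive exponents [(d - d1) y] and
   [(d - d2) y]. *)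
have main y : 0 <= y -> e' * expR (d * y) <= C1 + C2.
  move=> y0; have := H (expR (- y)) (expR (th * y)) (expR_gt0 _) (expR_gt0 _).
  rewrite -/r -/s.
  have L : e' * expR (- gamma * y) <= eps * (1 + N%:R * (expR (- y))^-1 ^+ 2)
    `^ (- gamma / 2).
    rewrite /e' -mulrA ler_wpM2l ?(ltW eps0)//.
    have -> : expR (- gamma * y) = (expR (2 * y)) `^ (- gamma / 2).
      by rewrite -expRM; congr expR; field.
    rewrite -powRM ?expR_ge0 ?(ltW N1)// mulNr !powRN lef_pV2 ?posrE ?powR_gt0
      ?mulr_gt0 ?expR_gt0//.
    rewrite ge0_ler_powR ?nnegrE ?divr_ge0 ?(ltW gamma0)// ?mulr_ge0 ?expR_ge0
      ?(ltW N1)//.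
    have -> : (expR (- y))^-1 ^+ 2 = expR (2 * y).
      by rewrite -expRN opprK -expRM_natl.
    have : 1 <= expR (2 * y) by rewrite -expR0 ler_expR mulr_ge0.
    by set E := expR _ => E1; rewrite mulrDl; lra.
  move=> /(le_trans L){L}.
  have Ab : (expR (- y)) `^ beta = expR (- (beta * y)).
    by rewrite -expRM; congr expR; ring.
  rewrite Ab (mulrA 2 C) (powRM _ (_ : 0 <= 2 * C)) ?mulr_ge0 ?expR_ge0//.
  rewrite -expRM (mulrA 2 k) -expRN (powRM _ (_ : 0 <= 2 * k)) ?mulr_ge0
    ?expR_ge0// -expRM.
  rewrite mulrDr.
  rewrite [X in _ <= X + _](_ : _ = C1 * expR ((th - beta * (1 + r)) * y));
    last first.
    rewrite /C1 (_ : (th - beta * (1 + r)) * y = th * y + - (beta * y) + -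
      (beta * y) * r); last by ring.
    by rewrite !expRD; ring.
  rewrite [X in _ <= _ + X](_ : _ = C2 * expR (- (th * s * y))); last first.
    rewrite /C2 (_ : - (th * s * y) = th * y + - (th * y) + - (th * y) * s);
      last by ring.
    by rewrite !expRD; ring.
  move=> h.
  pose X := expR ((gamma + d) * y).
  have h1 := ler_wpM2r (expR_ge0 ((gamma + d) * y)) h.
  have E0 : expR (- gamma * y) * X = expR (d * y).
    by rewrite /X -expRD; congr expR; ring.
  have E1 : expR ((th - beta * (1 + r)) * y) * X = expR ((d - d1) * y).
    by rewrite /X -expRD; congr expR; rewrite /d1; ring.
  have E2 : expR (- (th * s * y)) * X = expR ((d - d2) * y).
    by rewrite /X -expRD; congr expR; rewrite /d2; ring.
  rewrite -/X mulrDl -(mulrA e') E0 -(mulrA C1) E1 -(mulrA C2) E2 in h1.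
  apply: (le_trans h1); apply: lerD.
    by rewrite ler_piMr// expR_le1 mulr_le0_ge0// subr_le0.
  by rewrite ler_piMr// expR_le1 mulr_le0_ge0// subr_le0.
(* Chosen so that [exp (d y) >= 1 + d y] already yields [e' + C1 + C2] on the left. *)
pose y := (C1 + C2) / (e' * d).
have y0 : 0 <= y by rewrite divr_ge0 ?addr_ge0// mulr_ge0 ?ltW.
have := main y y0; apply/negP; rewrite -ltNge.
apply: (@lt_le_trans _ _ (e' * (1 + d * y))); last by rewrite ler_wpM2l ?(ltW
  e'0)// expR_ge1Dx.
rewrite (_ : e' * (1 + d * y) = e' + (C1 + C2)); first by rewrite ltrDr.
by rewrite /y; field; rewrite !gt_eqF.
Qed.

End absorption.

(** * The a priori inequality at spatial scale [1 / a] up to time [T] *)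

Section main_inequality.
Context {R : realType}.
Local Notation leb := (@lebesgue_measure R).
Local Notation line := (measurableTypeR R).

Variables (n : nat) (al a T p q gamma eps : R) (k : nat)
  (u0 : Rn R n -> R) (u : R -> Rn R n -> R).
Hypotheses (al0 : 0 < al) (al1 : al < 1) (a0 : 0 < a) (T0 : 0 < T)
  (p0 : 0 < p) (pq : p < q) (q1 : 1 < q) (gamma0 : 0 < gamma) (eps0 : 0 < eps)
  (kq : 1 <= k%:R * (q - 1)).
Local Notation mu := (lebesgueRn R n).
Local Notation psi := (cutoffRn a : Rn R n -> R).
Local Notation w := (frac_cutoff al a : Rn R n -> R).
Local Notation U := (zero_ext T u).

(** Its derivative vanishes at [T] to order [k] only; [kq] is what still lets [|u|] times this
    derivative be absorbed by [|u| ^ q] times [decay]. *)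
Definition decay (t : R) : R := (1 - t / T) ^+ k.+1.
Definition decay' (t : R) : R := - (k.+1%:R / T * (1 - t / T) ^+ k).

Lemma is_derive_decay (t : R) : is_derive t (1 : R) decay (decay' t).
Proof.
have d : is_derive t (1 : R) (fun s : R => 1 - s / T) (- T^-1).
  by apply: is_derive_eq; rewrite /GRing.scale/=; ring.
have H := is_deriveX k.+1 d.
have -> : decay = (fun s : R => 1 - s / T) ^+ k.+1.
  by apply/funext => s; rewrite /decay exprfctE.
by apply: (is_derive_eq H); rewrite /decay' /GRing.scale/= -mulr_natl; ring.
Qed.

Lemma continuous_decay' : continuous decay'.
Proof.
move=> t; apply: cvgN; apply: cvgM; first exact: cvg_cst.
apply: (@continuous_comp _ _ _ (fun s : R => 1 - s / T) (fun y : R => y ^+ k)).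
  apply: cvgB; first exact: cvg_cst.
  exact: mulrr_continuous.
exact: exprn_continuous.
Qed.

Lemma decay_T : decay T = 0.
Proof. by rewrite /decay mulfV ?gt_eqF// subrr expr0n. Qed.

Lemma decay_0 : decay 0 = 1.
Proof. by rewrite /decay mul0r subr0 expr1n. Qed.

Lemma one_sub_itv t : t \in `]0, T[ -> 0 <= 1 - t / T <= 1.
Proof.
rewrite in_itv/= => /andP[t0 tT]; rewrite subr_ge0 ler_pdivrMr// mul1r (ltW
  tT)/=.
by rewrite gerBl divr_ge0// ltW.
Qed.

Lemma integrable_time_factor (s : line -> R) (C : R) (H : line * Rn R n -> R) :
  measurable_fun setT s -> (forall t, t \in `]0, T[ -> `|s t| <= C) ->
  (forall z, z.1 \notin `]0, T[ -> H z = 0) ->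
  (leb \x mu)%E.-integrable setT (EFin \o H) ->
  (leb \x mu)%E.-integrable setT (EFin \o (fun z => s z.1 * H z)).
Proof.
move=> ms sC H0 iH.
have mH : measurable_fun setT H by apply/measurable_EFinP; exact:
  measurable_int iH.
have m : measurable_fun setT (fun z => s z.1 * H z).
  apply: measurable_funM => //.
  exact: (measurableT_comp ms (@measurable_fst _ _ line (Rn R n))).
have iC : (leb \x mu)%E.-integrable setT (EFin \o (fun z => C * `|H z|)).
  exact: (integrableZl measurableT C (integrable_abse iH)).
apply: (le_integrable_EFin m _ iC) => z.
rewrite normrM; case: (boolP (z.1 \in `]0, T[)) => zT.
  by rewrite ler_wpM2r// sC.
by rewrite (H0 _ zT) normr0 !mulr0.
Qed.

Lemma le_one_add_powR (v : R) : 0 <= v -> v <= 1 + v `^ q.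
Proof.
move=> v0; have [v1|v1] := leP v 1; first by rewrite (le_trans v1)// lerDl
  powR_ge0.
rewrite (@le_trans _ _ (v `^ q))// ?lerDr//.
by rewrite -[leLHS]powRr1// ler_powR// ltW.
Qed.

(** On the support of [psi] one has [|x| ^ 2 <= n / a ^ 2], and the lower bound on [u0] decreases
    with [|x|]. *)
Lemma cutoff_mass_ge : L1_loc u0 ->
  {ae mu, forall x, eps * (1 + enorm x ^+ 2) `^ (- gamma / 2) <= u0 x} ->
  eps * (1 + n%:R * a^-1 ^+ 2) `^ (- gamma / 2) * \int[mu]_x psi x <=
  \int[mu]_x (u0 x * psi x).
Proof.
move=> lu0 uge; rewrite -RintegralZl//; last exact: integrable_cutoffRn.
apply: ae_le_Rintegral.
- exact: (integrableZl measurableT _ (integrable_cutoffRn n a0)).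
- exact: integrable_loc_cutoff.
- move: uge; apply: filterS => x ux.
  have [->|px] := eqVneq (psi x) 0; first by rewrite !mulr0.
  rewrite ler_wpM2r ?cutoffRn_ge0//; apply: le_trans ux.
  rewrite ler_wpM2l ?(ltW eps0)//.
  have e2 : enorm x ^+ 2 = dot x x by rewrite /enorm sqr_sqrtr ?dot_ge0.
  have d := cutoffRn_support a0 px; have d0 := dot_ge0 x.
  rewrite e2 mulNr !powRN lef_pV2 ?posrE ?powR_gt0 ?ltr_pwDl//; last first.
    by rewrite (le_trans d0).
  by rewrite ge0_ler_powR ?nnegrE ?divr_ge0 ?(ltW gamma0)// ?addr_ge0 ?lerD2l//
    (le_trans d0).
Qed.

Lemma main_inequality : L1_loc u0 ->
  {ae mu, forall x, eps * (1 + enorm x ^+ 2) `^ (- gamma / 2) <= u0 x} ->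
  weak_solution (2 * al) p q u0 T u ->
  eps * (1 + n%:R * a^-1 ^+ 2) `^ (- gamma / 2) <=
  T * (frac_cutoff_const n al * a `^ (2 * al) *
         (2 * (frac_cutoff_const n al * a `^ (2 * al))) `^ (p / (q - p)) +
       k.+1%:R / T * (2 * (k.+1%:R / T)) `^ (q - 1)^-1).
Proof.
move=> lu0 uge [mu_ up uq ident].
have tf : test_function (2 * al) T (fun t x => decay t * psi x)
    (fun t x => decay t * w x) (fun t x => decay' t * psi x).
  apply: test_function_separated => //; first exact: is_derive_decay.
    exact: continuous_decay'.
  exact: decay_T.
have identity := ident _ _ _ tf.
set A := frac_cutoff_const n al * _; set c := k.+1%:R / T.
have A0 : 0 <= A by rewrite mulr_ge0 ?powR_ge0 ?frac_cutoff_const_ge0.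
have c0 : 0 <= c by rewrite divr_ge0 ?ltW.
set K1 := A * _; set K2 := c * _.
pose I := \int[mu]_x psi x.
have I0 : 0 < I.
  rewrite /I (Rintegral_prodRn n (integrable_cutoff a0)).2.
  by rewrite exprn_gt0 ?Rintegral_cutoff_gt0.
pose H1 (z : line * Rn R n) := `|U z| `^ q * psi z.2.
pose H2 (z : line * Rn R n) := `|U z| `^ p * w z.2.
pose H3 (z : line * Rn R n) := U z * psi z.2.
pose H0 (z : line * Rn R n) : R := \1_(`]0, T[%classic) z.1 * psi z.2.
have q0 : 0 < q := lt_trans ltr01 q1.
have U0 z : z.1 \notin `]0, T[ -> U z = 0 by move=> /negbTE zT; rewrite
  /zero_ext zT.
have Ut t x : t \in `]0, T[ -> U (t, x) = u t x by move=> tT; rewrite /zero_ext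
  /= tT.
have iH1 : (leb \x mu)%E.-integrable setT (EFin \o H1) := integrable_pow_q a0
  q1 mu_ (uq _).
have iH2 : (leb \x mu)%E.-integrable setT (EFin \o H2).
  exact: (integrable_pow_p al0 al1 a0 p0 mu_ up).
have [iH0 eH0] := integrable_cutoff_strip n a0 T0.
have iH01 : (leb \x mu)%E.-integrable setT (EFin \o (fun z => H0 z + H1 z)).
  exact: (integrableD measurableT iH0 iH1).
have ind t : t \in `]0, T[ -> \1_(`]0, T[%classic) t = 1 :> R.
  by move=> tT; rewrite indicE mem_set.
have iH3 : (leb \x mu)%E.-integrable setT (EFin \o H3).
  have m : measurable_fun setT H3.
    apply: measurable_funM; first exact: measurable_zero_ext.
    exact: (measurableT_comp (@measurable_cutoffRn R n a) (@measurable_snd _ _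
      line (Rn R n))).
  (* [|u| <= 1 + |u| ^ q] on the strip, so the term linear in [u] is dominated by the mass of [psi]
     there and the [q]-th power. *)
  apply: (le_integrable_EFin m _ iH01) => -[t x].
  rewrite /H3 /H0 /H1 -mulrDl normrM (ger0_norm (cutoffRn_ge0 _ _)).
  rewrite ler_wpM2r ?cutoffRn_ge0//=.
  case: (boolP (t \in `]0, T[)) => tT; first by rewrite ind// le_one_add_powR.
  by rewrite U0//= normr0 powR0 ?gt_eqF// addr0 indicE.
have mdecay : measurable_fun setT (decay : line -> R).
  apply: continuous_measurable_fun => t; apply: differentiable_continuous.
  by apply/derivable1_diffP; have := is_derive_decay t; case.
have mdecay' : measurable_fun setT (decay' : line -> R).
  exact: (continuous_measurable_fun continuous_decay').
have decay01 t : t \in `]0, T[ -> 0 <= decay t <= 1.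
  by move=> /one_sub_itv /andP[s0 s1]; rewrite exprn_ge0//= exprn_ile1.
have decayn t : t \in `]0, T[ -> `|decay t| <= 1.
  by move=> /decay01 /andP[s0 s1]; rewrite ger0_norm.
have decayn' t : t \in `]0, T[ -> `|decay' t| <= c.
  move=> /one_sub_itv /andP[s0 s1]; rewrite normrN normrM (ger0_norm c0).
  by rewrite ler_piMr// ger0_norm ?exprn_ge0// exprn_ile1.
have z1 z : z.1 \notin `]0, T[ -> H1 z = 0.
  by move=> /U0 e; rewrite /H1 e normr0 powR0 ?gt_eqF// mul0r.
have z2 z : z.1 \notin `]0, T[ -> H2 z = 0.
  by move=> /U0 e; rewrite /H2 e normr0 powR0 ?gt_eqF// mul0r.
have z3 z : z.1 \notin `]0, T[ -> H3 z = 0 by move=> /U0 e; rewrite /H3 e mul0r.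
have iG1 := integrable_time_factor mdecay decayn z1 iH1.
have iG2 := integrable_time_factor mdecay decayn z2 iH2.
have iG3 := integrable_time_factor mdecay' decayn' z3 iH3.
have e1 : \int[leb]_(t in `]0, T[) \int[mu]_x (`|u t x| `^ q * (decay t * psi
  x)) =
    \int[(leb \x mu)%E]_z (decay z.1 * H1 z).
  transitivity (\int[leb]_t \int[mu]_x (decay t * H1 (t, x))); last first.
    exact: (Rintegral_prod iG1).
  apply: (Rintegral_zero_ext (G := fun t x => decay t * H1 (t, x))) => t x tT.
    by rewrite /H1/= Ut// mulrCA.
  by rewrite z1// mulr0.
have e2 : \int[leb]_(t in `]0, T[) \int[mu]_x (`|u t x| `^ p * (decay t * w x))
  =
    \int[(leb \x mu)%E]_z (decay z.1 * H2 z).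
  transitivity (\int[leb]_t \int[mu]_x (decay t * H2 (t, x))); last first.
    exact: (Rintegral_prod iG2).
  apply: (Rintegral_zero_ext (G := fun t x => decay t * H2 (t, x))) => t x tT.
    by rewrite /H2/= Ut// mulrCA.
  by rewrite z2// mulr0.
have e3 : \int[leb]_(t in `]0, T[) \int[mu]_x (u t x * (decay' t * psi x)) =
    \int[(leb \x mu)%E]_z (decay' z.1 * H3 z).
  transitivity (\int[leb]_t \int[mu]_x (decay' t * H3 (t, x))); last first.
    exact: (Rintegral_prod iG3).
  apply: (Rintegral_zero_ext (G := fun t x => decay' t * H3 (t, x))) => t x tT.
    by rewrite /H3/= Ut// mulrCA.
  by rewrite z3// mulr0.
have e0 : \int[mu]_x (u0 x * (decay 0 * psi x)) = \int[mu]_x (u0 x * psi x).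
  by apply: eq_Rintegral => x _; rewrite decay_0 mul1r.
rewrite e0 e1 e2 e3 in identity.
have low := cutoff_mass_ge lu0 uge; rewrite -/I in low.
rewrite -(ler_pM2r I0); apply: (le_trans low).
have i12 : (leb \x mu)%E.-integrable setT (EFin \o (fun z => decay z.1 * H2 z -
  decay' z.1 * H3 z)).
  exact: (integrableB measurableT iG2 iG3).
have i123 : (leb \x mu)%E.-integrable setT (EFin \o (fun z => decay z.1 * H2 z
  - decay' z.1 * H3 z - decay z.1 * H1 z)).
  exact: (integrableB measurableT i12 iG1).
have iK : (leb \x mu)%E.-integrable setT (EFin \o (fun z => (K1 + K2) * H0 z)).
  exact: (integrableZl measurableT (K1 + K2) iH0).
(* All terms being integrable on the product, the weak formulation becomes one integral, and a
   pointwise comparison of integrands is enough. *)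
have -> : \int[mu]_x (u0 x * psi x) =
    \int[(leb \x mu)%E]_z (decay z.1 * H2 z - decay' z.1 * H3 z - decay z.1 *
      H1 z).
  by rewrite RintegralB// RintegralB// -identity addrK.
have -> : T * (K1 + K2) * I = \int[(leb \x mu)%E]_z ((K1 + K2) * H0 z).
  by rewrite RintegralZl// eH0 -/I mulrCA mulrA.
apply: le_Rintegral => // -[t x] _ /=.
have [tT|tT] := boolP (t \in `]0, T[); last first.
  rewrite z1// z2// z3// !mulr0 !subr0; apply: mulr_ge0.
    by apply: addr_ge0; apply: mulr_ge0 => //; exact: powR_ge0.
  by apply: mulr_ge0; [rewrite indicE|exact: cutoffRn_ge0].
rewrite /H0 /H1 /H2 /H3 /= (Ut _ _ tT) ind// mul1r.
set v := `|u t x|; have v0 : 0 <= v by exact: normr_ge0.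
have /andP[d0 d1] := decay01 _ tT.
have wle := frac_cutoff_le al0 al1 a0 x; rewrite -/A in wle.
have p_ge0 := cutoffRn_ge0 a x.
have b1 := absorb_power p0 pq A0 v0; rewrite -/K1 in b1.
have b2 := absorb_linear q1 c0 v0 (one_sub_itv tT) kq; rewrite -/K2 -/(decay t)
  in b2.
have sk : 0 <= c * (1 - t / T) ^+ k.
  by have /andP[s0 _] := one_sub_itv tT; rewrite mulr_ge0 ?exprn_ge0.
have t1 : decay t * (v `^ p * w x) <= (v `^ q * decay t / 2 + K1) * psi x.
  (* The one-sided bound on [w] suffices because its coefficient [decay t * v ^ p] is
     nonnegative. *)
  apply: (@le_trans _ _ (decay t * (v `^ p * (A * psi x)))).
    by rewrite ler_wpM2l// ler_wpM2l ?powR_ge0.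
  rewrite (_ : decay t * (v `^ p * (A * psi x)) = decay t * (A * v `^ p) * psi
    x); last by ring.
  rewrite ler_wpM2r//.
  apply: (@le_trans _ _ (decay t * (v `^ q / 2 + K1))); first by rewrite
    ler_wpM2l.
  have K10 : 0 <= K1 by rewrite mulr_ge0 ?powR_ge0.
  rewrite mulrDr lerD//; last by rewrite ler_piMl.
  by rewrite le_eqVlt; apply/orP; left; apply/eqP; ring.
have t2 : - (decay' t * (u t x * psi x)) <= (v `^ q * decay t / 2 + K2) * psi x.
  rewrite /decay' -/c mulNr opprK mulrA ler_wpM2r//.
  apply: le_trans b2; rewrite mulrC ler_wpM2r//.
  by rewrite /v ler_norm.
(* The halves of [v ^ q] spent in [t1] and [t2] add up to the term subtracted. *)
have -> : (K1 + K2) * psi x = (v `^ q * decay t / 2 + K1) * psi x + (v `^ q *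
  decay t / 2 + K2) * psi x
   - decay t * (v `^ q * psi x) by field.
by rewrite lerD2r lerD.
Qed.

End main_inequality.

Theorem theorem1p3 (R : realType) (N : nat) (beta p q gamma : R)
    (u0 : Rn R N -> R) :
  (1 <= N)%N ->
  0 < beta < 2 -> 0 < p -> 1 < q -> 0 < gamma < N%:R ->
  L1_loc u0 ->
  (exists2 eps : R, 0 < eps &
    {ae lebesgueRn R N, forall x,
      eps * (1 + enorm x ^+ 2) `^ (- gamma / 2) <= u0 x}) ->
  p < q < p + beta / gamma ->
  ~ exists u : R -> Rn R N -> R, global_weak_solution beta p q u0 u.
Proof.
move=> _ /andP[b0 b2] p0 q1 /andP[g0 _] lu0 [eps eps0 uge] pq [u gu].
have al0 : 0 < beta / 2 by rewrite divr_gt0.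
have al1 : beta / 2 < 1 by rewrite ltr_pdivrMr// mul1r.
have be : beta = 2 * (beta / 2) by field.
have q10 : 0 < q - 1 by rewrite subr_gt0.
pose k := Num.bound (q - 1)^-1.
have kq : 1 <= k%:R * (q - 1).
  rewrite -ler_pdivrMr// mul1r ltW// /k archi_boundP// invr_ge0 ltW//.
apply: (no_uniform_bound (N := N) (C := frac_cutoff_const N (beta / 2)) (k := k.+1%:R)
  eps0 b0 p0 q1 g0 _ _ pq) => //.
  exact: frac_cutoff_const_ge0.
move=> a T a0 T0; have /andP[pq' _] := pq.
(* The selected occurrences are the order of the operator and the two exponents of [a]; the
   arguments [beta / 2] of [frac_cutoff_const] are left as they are. *)
have := gu T T0; rewrite {1 3 5}be => ws.
exact: (main_inequality al0 al1 a0 T0 p0 pq' q1 g0 eps0 kq lu0 uge ws).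
Qed.
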